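(* Suppose that the second order linear differential equation $u''(t)+p_1(t)u'(t)+p_2(t)u(t)=0$ is disconjugate on $I=[a,b]$. Let $c\in C(I)$ and consider the operator $T[c]u(t)\equiv u^{(4)}(t)+p_1(t)u'''(t)+p_2(t)u''(t)+c(t)u(t)$, $t\in I$. Let $\lambda_1>0$ be the least positive eigenvalue of $T[0]$ in $X$; let $\lambda_2<0$ be the maximum of the biggest negative eigenvalue of $T[0]$ in $X_1$ and the biggest negative eigenvalue of $T[0]$ in $X_3$; and let $\lambda_3>0$ be the minimum of the least positive eigenvalue of $T[0]$ in $U_{[a,b]}$ and the least positive eigenvalue of $T[0]$ in $V_{[a,b]}$. Then: \begin{itemize} \item If $-\lambda_1<c(t)\le-\lambda_2$ for every $t\in I$, then $T[c]$ is strongly inverse positive in $X$. \item If $-\lambda_3\le c(t)<-\lambda_1$ for every $t\in I$, then $T[c]$ is strongly inverse negative in $X$. \end{itemize}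
   Context: Let $I=[a,b]$ with $a<b$ real, $p_1\in C^3(I)$, $p_2\in C^2(I)$ real-valued, and $T[0]u(t)=u^{(4)}(t)+p_1(t)u'''(t)+p_2(t)u''(t)$, $t\in I$. An $n$-th order linear differential equation is disconjugate on an interval if every nontrivial solution has fewer than $n$ zeros on that interval, counted with multiplicity. Function spaces: $X=\{u\in C^4(I): u(a)=u(b)=u''(a)=u''(b)=0\}$; $X_1=\{u\in C^4(I): u(a)=u(b)=u'(b)=u''(b)=0\}$; $X_3=\{u\in C^4(I): u(a)=u'(a)=u''(a)=u(b)=0\}$; $U_{[a,b]}=\{u\in C^4(I): u(a)=u'(a)=u(b)=u''(b)=0\}$; $V_{[a,b]}=\{u\in C^4(I): u(a)=u''(a)=u(b)=u'(b)=0\}$. A real number $\lambda$ is an eigenvalue of $T[0]$ in one of these spaces if there is a nontrivial $u$ in that space with $T[0]u=\lambda u$ on $I$. An operator $T$ on $X$ (here $T=T[c]$) is strongly inverse positive (resp. strongly inverse negative) in $X$ if every $u\in X$ such that $Tu\ge 0$ on $I$ and $Tu\not\equiv 0$ satisfies $u>0$ on $(a,b)$, $u'(a)>0$ and $u'(b)<0$ (resp. $u<0$ on $(a,b)$, $u'(a)<0$ and $u'(b)>0$). *)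

(* Defs.v *)
From Stdlib Require Export Reals List.
From Stdlib Require Import Lra ClassicalEpsilon.
Open Scope R_scope.

(* Functions on [a, b] are represented by total functions R -> R.  Every notion
   below depends only on their values on [a, b]; in particular derivatives are
   taken within [a, b], hence are one-sided at the endpoints. *)

Definition seg (a b : R) : R -> Prop := fun t => a <= t <= b.

Definition derivable_on (a b : R) (f : R -> R) : Prop :=
  forall t, seg a b t -> exists l, D_in f (fun _ => l) (seg a b) t.

(* Meaningful only at points where f is derivable within [a, b]. *)
Definition deriv (a b : R) (f : R -> R) (t : R) : R :=
  epsilon (inhabits 0) (fun l => D_in f (fun _ => l) (seg a b) t).

Fixpoint deriv_n (a b : R) (k : nat) (f : R -> R) : R -> R :=
  match k with
  | O => f
  | S k' => deriv a b (deriv_n a b k' f)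
  end.

Definition Ck_on (a b : R) (k : nat) (f : R -> R) : Prop :=
  (forall j, (j < k)%nat -> derivable_on a b (deriv_n a b j f)) /\
  (forall t, seg a b t -> continue_in (deriv_n a b k f) (seg a b) t).

Definition nontrivial_on (a b : R) (u : R -> R) : Prop :=
  exists t, seg a b t /\ u t <> 0.

(* At least n zeros in [a, b] counted with multiplicity: the list consists of
   distinct zeros, each paired with a lower bound m of its multiplicity.  As the
   bounds add up to n, only derivatives of order less than n are involved. *)
Definition has_n_zeros (a b : R) (n : nat) (u : R -> R) : Prop :=
  exists l : list (R * nat),
    NoDup (map fst l) /\
    list_sum (map snd l) = n /\
    forall t m, In (t, m) l ->
      seg a b t /\ forall j, (j < m)%nat -> deriv_n a b j u t = 0.

(* Disconjugacy on [a, b] of the equation L u = 0 of order n. *)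
Definition disconjugate (a b : R) (n : nat) (L : (R -> R) -> R -> R) : Prop :=
  forall u, Ck_on a b n u ->
    (forall t, seg a b t -> L u t = 0) ->
    nontrivial_on a b u ->
    ~ has_n_zeros a b n u.

Definition L2 (a b : R) (p1 p2 : R -> R) (u : R -> R) (t : R) : R :=
  deriv_n a b 2 u t + p1 t * deriv_n a b 1 u t + p2 t * u t.

Definition T (a b : R) (p1 p2 c : R -> R) (u : R -> R) (t : R) : R :=
  deriv_n a b 4 u t + p1 t * deriv_n a b 3 u t + p2 t * deriv_n a b 2 u t
  + c t * u t.

Definition X (a b : R) (u : R -> R) : Prop :=
  Ck_on a b 4 u /\
  u a = 0 /\ u b = 0 /\ deriv_n a b 2 u a = 0 /\ deriv_n a b 2 u b = 0.

Definition X1 (a b : R) (u : R -> R) : Prop :=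
  Ck_on a b 4 u /\
  u a = 0 /\ u b = 0 /\ deriv_n a b 1 u b = 0 /\ deriv_n a b 2 u b = 0.

Definition X3 (a b : R) (u : R -> R) : Prop :=
  Ck_on a b 4 u /\
  u a = 0 /\ deriv_n a b 1 u a = 0 /\ deriv_n a b 2 u a = 0 /\ u b = 0.

Definition U (a b : R) (u : R -> R) : Prop :=
  Ck_on a b 4 u /\
  u a = 0 /\ deriv_n a b 1 u a = 0 /\ u b = 0 /\ deriv_n a b 2 u b = 0.

Definition V (a b : R) (u : R -> R) : Prop :=
  Ck_on a b 4 u /\
  u a = 0 /\ deriv_n a b 2 u a = 0 /\ u b = 0 /\ deriv_n a b 1 u b = 0.

Definition is_eigenvalue (a b : R) (L : (R -> R) -> R -> R)
    (E : (R -> R) -> Prop) (lambda : R) : Prop :=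
  exists u, E u /\ nontrivial_on a b u /\
    forall t, seg a b t -> L u t = lambda * u t.

Definition is_least_positive_eigenvalue (a b : R) (L : (R -> R) -> R -> R)
    (E : (R -> R) -> Prop) (lambda : R) : Prop :=
  is_eigenvalue a b L E lambda /\ 0 < lambda /\
  forall mu, is_eigenvalue a b L E mu -> 0 < mu -> lambda <= mu.

Definition is_biggest_negative_eigenvalue (a b : R) (L : (R -> R) -> R -> R)
    (E : (R -> R) -> Prop) (lambda : R) : Prop :=
  is_eigenvalue a b L E lambda /\ lambda < 0 /\
  forall mu, is_eigenvalue a b L E mu -> mu < 0 -> mu <= lambda.

Definition strongly_inverse_positive (a b : R) (L : (R -> R) -> R -> R)
    (E : (R -> R) -> Prop) : Prop :=
  forall u, E u ->
    (forall t, seg a b t -> 0 <= L u t) ->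
    nontrivial_on a b (L u) ->
    (forall t, a < t < b -> 0 < u t) /\
    0 < deriv_n a b 1 u a /\ deriv_n a b 1 u b < 0.

Definition strongly_inverse_negative (a b : R) (L : (R -> R) -> R -> R)
    (E : (R -> R) -> Prop) : Prop :=
  forall u, E u ->
    (forall t, seg a b t -> 0 <= L u t) ->
    nontrivial_on a b (L u) ->
    (forall t, a < t < b -> u t < 0) /\
    deriv_n a b 1 u a < 0 /\ 0 < deriv_n a b 1 u b.

Lemma deriv_eq (a b : R) (f : R -> R) (t l : R) :
  a < b -> seg a b t -> D_in f (fun _ => l) (seg a b) t -> deriv a b f t = l.
Proof.
  intros Hab Ht Hl.
  apply single_limit with (f := fun s => (f s - f t) / (s - t))
    (D := D_x (seg a b) t) (x0 := t).
  - intros e He; unfold D_x, seg, Rdist in *.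
    destruct (Rlt_dec t b) as [Htb | Htb].
    + exists (t + Rmin (e / 2) (b - t)).
      assert (0 < Rmin (e / 2) (b - t)) by (apply Rmin_glb_lt; lra).
      pose proof (Rmin_l (e / 2) (b - t)); pose proof (Rmin_r (e / 2) (b - t)).
      repeat split; try lra.
      rewrite Rabs_pos_eq; lra.
    + exists (t - Rmin (e / 2) (b - a)).
      assert (0 < Rmin (e / 2) (b - a)) by (apply Rmin_glb_lt; lra).
      pose proof (Rmin_l (e / 2) (b - a)); pose proof (Rmin_r (e / 2) (b - a)).
      repeat split; try lra.
      rewrite Rabs_left; lra.
  - apply (epsilon_spec (inhabits 0)
      (fun l => D_in f (fun _ => l) (seg a b) t)).
    exists l; exact Hl.
  - exact Hl.
Qed.

(* Main.v *)
Require Import Defs.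
From Stdlib Require Import Reals Factorial Lra Lia ClassicalEpsilon Classical List.
From Coquelicot Require Import Coquelicot.
Open Scope R_scope.

(** Proof idea.  Disconjugacy provides a positive solution [y] of the second
    order equation, and the resulting Polya factorization turns [T[0]] into a
    cyclic first order system [u' = v], [v' = r z], [z' = g w], [w' = q T[0]u]
    with positive coefficients; membership in [X] means that [u] and [z] vanish
    at both ends.  All sign statements come from touching arguments: subtract
    from [u] the least multiple of a positive solution [Y] of the homogeneous
    equation for which the difference [D] is nonpositive.  The sign of [D] then
    determines that of [T[0]D], so that [w] is monotone and [z] is "convex" or
    "concave", which is incompatible with a point of contact.

    For [T[M]], [M = - lambda2], the comparison functions are the solutions with
    a triple zero at [a] or at [b]; they are positive inside the interval by
    continuation in [M], since a zero can only enter through the other end,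
    where it produces an eigenvalue in [X1] or [X3].  For [T[- lambda3]] one uses
    instead the solutions with [u = u'' = 0] at one end and [u = 0] at an
    intermediate point; they are positive because the Wronskian of the solutions
    with [u = u'' = 0] at that end has no interior zero, again by continuation,
    now up to the first eigenvalue in [U] or [V].  The same functions give the
    positive eigenfunction for [lambda1], and touching with that eigenfunction
    reduces a variable [c] to these two constants. *)

(** Comparison functions vanish at the end points together with [u], so domination and contact there
    are read from the first nonzero entry of a jet, not from values. The range of [c] includes
    [- lambda2] and [- lambda3], where a comparison function may itself be an eigenfunction; hence
    the recurring alternative that it vanishes at the far end, with a sign condition further down
    its jet. For [T[M]] one comparison function controls the slope at one end only. Inside, a
    contact is needed on both sides of a bad point, which forces two multiples to be fitted
    simultaneously. Above [lambda1] the source has the opposite sign, and the comparison functions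
    are attached to the contact point itself. Positivity of the Wronskian is known only up to the
    first eigenvalue in [V], so the ground state becomes available once [lambda1] is shown to lie
    below it. Reflection of the interval exchanges [X1] with [X3] and [U] with [V], so one-sided
    statements are proved at a single end. *)

(** * Calculus on a closed interval and least dominating multiples *)

Lemma is_derive_cont (f : R -> R) (t l : R) : is_derive f t l -> continuity_pt f t.
Proof.
  intros H; apply derivable_continuous_pt; exists l; now apply is_derive_Reals.
Qed.

Lemma mean_value (f f' : R -> R) (c d : R) :
  c < d -> (forall t, c <= t <= d -> is_derive f t (f' t)) ->
  exists x, c < x < d /\ f d - f c = f' x * (d - c).
Proof.
  intros Hcd H.
  destruct (MVT_cor2 f f' c d Hcd) as [x [E Hx]].
  - intros t Ht; apply is_derive_Reals; now apply H.
  - exists x; split; [exact Hx | exact E].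
Qed.

Lemma nondecreasing (f f' : R -> R) (c d : R) :
  (forall t, c <= t <= d -> is_derive f t (f' t)) ->
  (forall t, c <= t <= d -> 0 <= f' t) ->
  forall s t, c <= s -> s <= t -> t <= d -> f s <= f t.
Proof.
  intros H H0 s t Hs Hst Ht.
  destruct (Rle_lt_or_eq_dec s t Hst) as [Hlt | <-]; [|lra].
  destruct (mean_value f f' s t Hlt) as [x [Hx E]]; [intros; apply H; lra|].
  assert (0 <= f' x) by (apply H0; lra); nra.
Qed.

Lemma nonincreasing (f f' : R -> R) (c d : R) :
  (forall t, c <= t <= d -> is_derive f t (f' t)) ->
  (forall t, c <= t <= d -> f' t <= 0) ->
  forall s t, c <= s -> s <= t -> t <= d -> f t <= f s.
Proof.
  intros H H0 s t Hs Hst Ht.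
  destruct (Rle_lt_or_eq_dec s t Hst) as [Hlt | <-]; [|lra].
  destruct (mean_value f f' s t Hlt) as [x [Hx E]]; [intros; apply H; lra|].
  assert (f' x <= 0) by (apply H0; lra); nra.
Qed.

Lemma increasing_strict (f f' : R -> R) (c d : R) :
  (forall t, c <= t <= d -> is_derive f t (f' t)) ->
  (forall t, c < t < d -> 0 < f' t) ->
  forall s t, c <= s -> s < t -> t <= d -> f s < f t.
Proof.
  intros H H0 s t Hs Hst Ht.
  destruct (mean_value f f' s t Hst) as [x [Hx E]]; [intros; apply H; lra|].
  assert (0 < f' x) by (apply H0; lra); nra.
Qed.

Lemma small_factor (K : R) : 0 < K -> exists n, 0 < n /\ K * n <= / 2.
Proof.
  intros HK. exists (/ (2 * K)). split; [apply Rinv_0_lt_compat; lra|].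
  right; field; lra.
Qed.

Lemma small_step (p q C : R) : 0 < p -> 0 < q -> 0 <= C ->
  exists e, 0 < e <= p /\ e * (C + 1) <= q.
Proof.
  intros Hp Hq HC. exists (Rmin p (q / (C + 1))). repeat split.
  - apply Rmin_glb_lt; [|apply Rdiv_lt_0_compat]; lra.
  - apply Rmin_l.
  - apply Rle_trans with (q / (C + 1) * (C + 1)); [|right; field; lra].
    apply Rmult_le_compat_r; [lra | apply Rmin_r].
Qed.

Lemma nonneg_closed (f : R -> R) (c d : R) :
  (forall t, c < t < d -> 0 < f t) -> 0 <= f c -> 0 <= f d ->
  forall t, c <= t <= d -> 0 <= f t.
Proof.
  intros H Hc Hd t Ht. destruct (Req_dec t c) as [->|N1]; [exact Hc|].
  destruct (Req_dec t d) as [->|N2]; [exact Hd|]. left; apply H; lra.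
Qed.

Lemma positive_after_zero (f f' : R -> R) (c d : R) :
  (forall t, c <= t <= d -> is_derive f t (f' t)) -> f c = 0 ->
  (forall t, c < t < d -> 0 < f' t) -> forall t, c < t <= d -> 0 < f t.
Proof.
  intros H H0 H' t Ht. rewrite <- H0. apply (increasing_strict f f' c d H H'); lra.
Qed.

Lemma pos_nbhd (f : R -> R) (t : R) : continuity_pt f t -> 0 < f t ->
  exists e, 0 < e /\ forall s, Rabs (s - t) < e -> 0 < f s.
Proof.
  intros Hc H.
  destruct (Hc (f t) H) as [e [He Hf]].
  exists e; split; [exact He|]; intros s Hs.
  destruct (Req_dec s t) as [->|Hne]; [exact H|].
  assert (K : Rabs (f s - f t) < f t).
  { apply Hf; split; [split; [exact I | auto] | exact Hs]. }
  apply Rabs_def2 in K; lra.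
Qed.

Lemma neg_nbhd (f : R -> R) (t : R) : continuity_pt f t -> f t < 0 ->
  exists e, 0 < e /\ forall s, Rabs (s - t) < e -> f s < 0.
Proof.
  intros Hc H.
  destruct (pos_nbhd (fun s => - f s) t) as [e [He Hf]].
  - now apply continuity_pt_opp.
  - lra.
  - exists e; split; [exact He|]; intros s Hs; specialize (Hf s Hs); lra.
Qed.

(* Heine-Borel for a local property that is monotone in its parameter. *)
Lemma uniform_on_segment (P : R -> R -> Prop) (c d : R) :
  c <= d ->
  (forall e e' t, 0 < e' -> e' <= e -> P e t -> P e' t) ->
  (forall t, c <= t <= d -> exists e n, 0 < e /\ 0 < n /\
     forall s, c <= s <= d -> Rabs (s - t) < n -> P e s) ->
  exists e, 0 < e /\ forall t, c <= t <= d -> P e t.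
Proof.
  intros Hcd Hmon Hloc.
  set (E := fun x => c <= x <= d /\
    exists e, 0 < e /\ forall t, c <= t <= x -> P e t).
  assert (Ec : E c).
  { split; [lra|]. destruct (Hloc c) as [e [n [He [Hn H]]]]; [lra|].
    exists e; split; [exact He|]. intros t Ht.
    apply H; [lra|]. replace (t - c) with 0 by lra. now rewrite Rabs_R0. }
  destruct (completeness E) as [m [Hub Hlub]].
  - exists d; intros x [Hx _]; lra.
  - exists c; exact Ec.
  - assert (Hm : c <= m <= d).
    { split; [now apply Hub|]. apply Hlub; intros x [Hx _]; lra. }
    destruct (Hloc m Hm) as [e [n [He [Hn H]]]].
    assert (exists x, E x /\ m - n < x) as [x [[Hx [e1 [He1 H1]]] Hxm]].
    { apply NNPP; intros K. assert (m <= m - n); [|lra].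
      apply Hlub; intros x Ex. apply Rnot_lt_le; intros L.
      apply K; exists x; split; assumption. }
    assert (Hxle : x <= m).
    { apply Hub; split; [exact Hx|]; exists e1; split; assumption. }
    set (y := Rmin d (m + n / 2)).
    assert (Hy : y <= d /\ y <= m + n / 2) by (split; [apply Rmin_l | apply Rmin_r]).
    assert (Hmin : 0 < Rmin e e1) by (apply Rmin_glb_lt; assumption).
    assert (Key : forall t, c <= t <= y -> P (Rmin e e1) t).
    { intros t Ht. destruct (Rle_dec t x) as [L|L].
      - apply (Hmon e1); [exact Hmin | apply Rmin_r | apply H1; lra].
      - apply (Hmon e); [exact Hmin | apply Rmin_l |].
        apply H; [lra|]. apply Rabs_def1; lra. }
    destruct (Rle_dec d (m + n / 2)) as [L|L].
    + exists (Rmin e e1); split; [exact Hmin|]. intros t Ht; apply Key.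
      unfold y; rewrite Rmin_left; lra.
    + assert (E y).
      { split; [unfold y; rewrite Rmin_right; lra|]. exists (Rmin e e1); split; assumption. }
      assert (y <= m) by now apply Hub.
      unfold y in *; rewrite Rmin_right in *; lra.
Qed.

(** [f c] may vanish, which is why positivity is assumed on a punctured right neighbourhood. The
    point is the supremum of the [x] up to which [f] stays positive. *)
Lemma first_nonpositive (f : R -> R) (c d e : R) :
  (forall t, c <= t <= d -> continuity_pt f t) ->
  0 < e -> (forall t, c < t < c + e -> t <= d -> 0 < f t) ->
  c < d -> f d <= 0 ->
  exists s, c < s <= d /\ f s = 0 /\ forall t, c < t < s -> 0 < f t.
Proof.
  intros Hc He Hpos Hcd Hd.
  set (E := fun x => c < x <= d /\ forall t, c < t < x -> 0 < f t).
  assert (E0 : E (Rmin d (c + e))).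
  { assert (c < Rmin d (c + e)) by (apply Rmin_glb_lt; lra).
    pose proof (Rmin_l d (c + e)); pose proof (Rmin_r d (c + e)).
    split; [lra|]. intros t Ht; apply Hpos; lra. }
  destruct (completeness E) as [m [Hub Hlub]].
  - exists d; intros x [Hx _]; lra.
  - eexists; exact E0.
  - assert (Hm : c < m <= d).
    { split; [|apply Hlub; intros x [Hx _]; lra].
      apply Rlt_le_trans with (2 := Hub _ E0). apply Rmin_glb_lt; lra. }
    assert (Hbelow : forall t, c < t < m -> 0 < f t).
    { intros t Ht. apply NNPP; intros K. assert (m <= t); [|lra].
      apply Hlub; intros x [Hx Hx']. apply Rnot_lt_le; intros L.
      apply K, Hx'; lra. }
    exists m; split; [exact Hm|]; split; [|exact Hbelow].
    destruct (Rtotal_order (f m) 0) as [L|[L|L]]; [|exact L|].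
    + destruct (neg_nbhd f m) as [n [Hn H]]; [apply Hc; lra | exact L |].
      set (t := Rmax (c + (m - c) / 2) (m - n / 2)).
      assert (m - n / 2 <= t) by apply Rmax_r.
      assert (c + (m - c) / 2 <= t) by apply Rmax_l.
      assert (t < m) by (apply Rmax_lub_lt; lra).
      assert (f t < 0) by (apply H; apply Rabs_def1; lra).
      assert (0 < f t) by (apply Hbelow; lra). lra.
    + assert (m <> d) by (intros ->; lra).
      destruct (pos_nbhd f m) as [n [Hn H']]; [apply Hc; lra | lra |].
      assert (E (Rmin d (m + n))).
      { assert (m < Rmin d (m + n)) by (apply Rmin_glb_lt; lra).
        pose proof (Rmin_l d (m + n)); pose proof (Rmin_r d (m + n)).
        split; [lra|]. intros t Ht. destruct (Rlt_dec t m) as [L1|L1].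
        - apply Hbelow; lra.
        - apply H'; apply Rabs_def1; lra. }
      assert (Rmin d (m + n) <= m) by now apply Hub.
      assert (m < Rmin d (m + n)) by (apply Rmin_glb_lt; lra). lra.
Qed.

(** Since [g] may vanish, quotients give no bound; local bounds are glued by compactness instead.
    For the same reason contact is not stated as a zero of [f - k g]: it is a point near which no
    smaller multiplier works. *)
Lemma least_multiple (f g : R -> R) (c d t0 : R) :
  c <= d -> (forall t, c <= t <= d -> 0 <= g t) ->
  c <= t0 <= d -> 0 < g t0 ->
  (forall t, c <= t <= d -> exists K e, 0 < e /\
     forall s, c <= s <= d -> Rabs (s - t) < e -> f s - K * g s <= 0) ->
  exists k,
    (forall t, c <= t <= d -> f t - k * g t <= 0) /\
    (forall k', (forall t, c <= t <= d -> f t - k' * g t <= 0) -> k <= k') /\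
    exists t, c <= t <= d /\ forall h e, 0 < h -> 0 < e ->
      exists s, c <= s <= d /\ Rabs (s - t) < e /\ 0 < f s - (k - h) * g s.
Proof.
  intros Hcd Hg Ht0 Hgt0 Hloc.
  destruct (uniform_on_segment (fun e t => c <= t <= d -> f t - / e * g t <= 0) c d Hcd)
    as [e0 [He0 H0]].
  { intros e e' t He' Hle H Ht. specialize (H Ht). specialize (Hg t Ht).
    assert (/ e <= / e') by (apply Rinv_le_contravar; lra). nra. }
  { intros t Ht. destruct (Hloc t Ht) as [K [e [He H]]].
    set (K' := Rmax K 1).
    assert (0 < K') by (apply Rlt_le_trans with 1; [lra | apply Rmax_r]).
    exists (/ K'), e. split; [now apply Rinv_0_lt_compat|]. split; [exact He|].
    intros s Hs Hst _. rewrite Rinv_inv. specialize (H s Hs Hst). specialize (Hg s Hs).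
    assert (K <= K') by apply Rmax_l. nra. }
  (* [m] stands for minus the multiplier, which turns the infimum of the admissible multipliers into
     the supremum given by [completeness]. *)
  set (E := fun m => forall t, c <= t <= d -> f t - (- m) * g t <= 0).
  destruct (completeness E) as [m [Hub Hlub]].
  { exists (- (f t0 / g t0)). intros m Hm. specialize (Hm t0 Ht0).
    assert (f t0 / g t0 <= - m); [|lra].
    apply Rmult_le_reg_r with (g t0); [exact Hgt0|].
    unfold Rdiv; rewrite Rmult_assoc, Rinv_l, Rmult_1_r; lra. }
  { exists (- / e0). intros t Ht. rewrite Ropp_involutive. now apply H0. }
  assert (Em : forall t, c <= t <= d -> f t - (- m) * g t <= 0).
  { intros t Ht. apply Rnot_lt_le; intros L.
    specialize (Hg t Ht).
    (* Lowering [m] by at most [h] removes at most half of the excess at [t]; the [1] guards against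
       [g t = 0]. *)
    set (h := (f t - (- m) * g t) / (2 * (g t + 1))).
    assert (Hh : 0 < h) by (apply Rdiv_lt_0_compat; lra).
    assert (Hhe : h * (g t + 1) = (f t - (- m) * g t) / 2) by (unfold h; field; lra).
    assert (exists x, E x /\ m - h < x) as [x [Ex Hx]].
    { apply NNPP; intros K. assert (m <= m - h); [|lra].
      apply Hlub; intros x Ex. apply Rnot_lt_le; intros L'.
      apply K; exists x; split; assumption. }
    specialize (Ex t Ht). nra. }
  exists (- m). split; [exact Em|]. split.
  { intros k' Hk'. assert (- k' <= m); [|lra].
    apply Hub. intros t Ht. rewrite Ropp_involutive. now apply Hk'. }
  (* Without a contact point every point tolerates a smaller multiplier nearby, and compactness
     yields one decrement for the whole segment, against minimality. *)
  apply NNPP; intros K.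
  destruct (uniform_on_segment (fun h t => c <= t <= d -> f t - (- m - h) * g t <= 0) c d Hcd)
    as [h0 [Hh0 H1]].
  { intros e e' t He' Hle H Ht. specialize (H Ht). specialize (Hg t Ht). nra. }
  { intros t Ht. apply NNPP; intros K'. apply K.
    exists t; split; [exact Ht|]. intros h e Hh He. apply NNPP; intros K''.
    apply K'. exists h, e. split; [exact Hh|]. split; [exact He|].
    intros s Hs Hst _. apply Rnot_lt_le; intros L. apply K''.
    exists s; split; [exact Hs|]; split; assumption. }
  assert (m + h0 <= m); [|lra].
  apply Hub. intros t Ht. replace (- (m + h0)) with (- m - h0) by lra. now apply H1.
Qed.

(** * The cyclic first order system *)

(** Positivity and continuity are required on the whole line, which removes side conditions; the
    coefficients of the differential operator are extended by constants outside [[lo, hi]] to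
    fit. *)
Record system := System {
  lo : R; hi : R;
  cr : R -> R; cg : R -> R; cq : R -> R;
  lo_hi : lo < hi;
  cr_cont : forall t, continuity_pt cr t;
  cg_cont : forall t, continuity_pt cg t;
  cq_cont : forall t, continuity_pt cq t;
  cr_pos : forall t, 0 < cr t;
  cg_pos : forall t, 0 < cg t;
  cq_pos : forall t, 0 < cq t }.

(* [j0] is the unknown function, [j1] its derivative, and [j2], [j3] are the
   quasi-derivatives [j1' / cr] and [j2' / cg]. *)
Record jet := Jet { j0 : R -> R; j1 : R -> R; j2 : R -> R; j3 : R -> R }.

Definition solves (S : system) (x : jet) (f : R -> R) (c d : R) : Prop :=
  forall t, c <= t <= d ->
    is_derive (j0 x) t (j1 x t) /\
    is_derive (j1 x) t (cr S t * j2 x t) /\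
    is_derive (j2 x) t (cg S t * j3 x t) /\
    is_derive (j3 x) t (cq S t * f t).

Definition jlin (k : R) (x : jet) (l : R) (y : jet) : jet :=
  Jet (fun t => k * j0 x t + l * j0 y t) (fun t => k * j1 x t + l * j1 y t)
      (fun t => k * j2 x t + l * j2 y t) (fun t => k * j3 x t + l * j3 y t).

(** The entries of odd index change sign, so that the reflected jet solves a system of the same
    form, again with positive coefficients. *)
Definition jref (S : system) (x : jet) : jet :=
  Jet (fun t => j0 x (lo S + hi S - t)) (fun t => - j1 x (lo S + hi S - t))
      (fun t => j2 x (lo S + hi S - t)) (fun t => - j3 x (lo S + hi S - t)).

Lemma continuity_pt_reflect (s : R) (f : R -> R) :
  (forall t, continuity_pt f t) -> forall t, continuity_pt (fun t => f (s - t)) t.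
Proof.
  intros H t. apply (continuity_pt_comp (fun t => s - t) f); [|apply H].
  apply continuity_pt_minus; [apply continuity_pt_const; intros ? ?; reflexivity|].
  apply derivable_continuous_pt, derivable_pt_id.
Qed.

Definition sref (S : system) : system :=
  System (lo S) (hi S) (fun t => cr S (lo S + hi S - t))
    (fun t => cg S (lo S + hi S - t)) (fun t => cq S (lo S + hi S - t))
    (lo_hi S)
    (continuity_pt_reflect _ _ (cr_cont S)) (continuity_pt_reflect _ _ (cg_cont S))
    (continuity_pt_reflect _ _ (cq_cont S))
    (fun t => cr_pos S _) (fun t => cg_pos S _) (fun t => cq_pos S _).

Lemma is_derive_reflect (s : R) (f : R -> R) (t l : R) :
  is_derive f (s - t) l -> is_derive (fun t => f (s - t)) t (- l).
Proof.
  intros H. replace (- l) with (scal (-1) l) by (unfold scal; simpl; unfold mult; simpl; ring).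
  apply (is_derive_comp f (fun t => s - t)); [exact H|].
  auto_derive; [exact I | ring].
Qed.

Lemma is_derive_reflect_opp (s : R) (f : R -> R) (t l : R) :
  is_derive f (s - t) l -> is_derive (fun t => - f (s - t)) t l.
Proof.
  intros H. pose proof (is_derive_opp _ _ _ (is_derive_reflect _ _ _ _ H)) as H'.
  unfold opp in H'; simpl in H'; now rewrite Ropp_involutive in H'.
Qed.

Lemma solves_ref (S : system) (x : jet) (f : R -> R) (c d : R) :
  solves S x f c d ->
  solves (sref S) (jref S x) (fun t => f (lo S + hi S - t))
    (lo S + hi S - d) (lo S + hi S - c).
Proof.
  intros H t Ht. destruct (H (lo S + hi S - t)) as [H0 [H1 [H2 H3]]]; [lra|].
  simpl. split; [|split; [|split]].
  - exact (is_derive_reflect _ _ _ _ H0).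
  - exact (is_derive_reflect_opp _ _ _ _ H1).
  - replace (cg S (lo S + hi S - t) * - j3 x (lo S + hi S - t))
      with (- (cg S (lo S + hi S - t) * j3 x (lo S + hi S - t))) by ring.
    exact (is_derive_reflect _ _ _ _ H2).
  - exact (is_derive_reflect_opp _ _ _ _ H3).
Qed.

Lemma solves_sub (S : system) (x : jet) (f : R -> R) (c d c' d' : R) :
  solves S x f c d -> c <= c' -> d' <= d -> solves S x f c' d'.
Proof. intros H Hc Hd t Ht; apply H; lra. Qed.

Ltac restrict H := apply (solves_sub _ _ _ _ _ _ _ H); lra.

Lemma solves_ext (S : system) (x : jet) (f f' : R -> R) (c d : R) :
  solves S x f c d -> (forall t, c <= t <= d -> f t = f' t) -> solves S x f' c d.
Proof. intros H E t Ht; rewrite <- E by exact Ht; now apply H. Qed.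

Lemma is_derive_lin (k l : R) (f g : R -> R) (t f' g' : R) :
  is_derive f t f' -> is_derive g t g' ->
  is_derive (fun t => k * f t + l * g t) t (k * f' + l * g').
Proof.
  intros Hf Hg.
  apply (is_derive_plus (fun t => k * f t) (fun t => l * g t));
    now apply is_derive_scal.
Qed.

Lemma solves_lin (S : system) (k l : R) (x y : jet) (f g : R -> R) (c d : R) :
  solves S x f c d -> solves S y g c d ->
  solves S (jlin k x l y) (fun t => k * f t + l * g t) c d.
Proof.
  intros Hx Hy t Ht.
  destruct (Hx t Ht) as [X0 [X1 [X2 X3]]]. destruct (Hy t Ht) as [Y0 [Y1 [Y2 Y3]]].
  pose proof (is_derive_lin k l _ _ _ _ _ X0 Y0) as D0.
  pose proof (is_derive_lin k l _ _ _ _ _ X1 Y1) as D1.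
  pose proof (is_derive_lin k l _ _ _ _ _ X2 Y2) as D2.
  pose proof (is_derive_lin k l _ _ _ _ _ X3 Y3) as D3.
  simpl. split; [|split; [|split]].
  - exact D0.
  - replace (cr S t * (k * j2 x t + l * j2 y t))
      with (k * (cr S t * j2 x t) + l * (cr S t * j2 y t)) by ring. exact D1.
  - replace (cg S t * (k * j3 x t + l * j3 y t))
      with (k * (cg S t * j3 x t) + l * (cg S t * j3 y t)) by ring. exact D2.
  - replace (cq S t * (k * f t + l * g t))
      with (k * (cq S t * f t) + l * (cq S t * g t)) by ring. exact D3.
Qed.

Section Components.
Context (S : system) (x : jet) (f : R -> R) (c d : R) (Hx : solves S x f c d).

Lemma solves_cont t : c <= t <= d ->
  continuity_pt (j0 x) t /\ continuity_pt (j1 x) t /\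
  continuity_pt (j2 x) t /\ continuity_pt (j3 x) t.
Proof.
  intros Ht; destruct (Hx t Ht) as [H0 [H1 [H2 H3]]].
  repeat split; eapply is_derive_cont; eassumption.
Qed.

Lemma j0_incr : (forall t, c <= t <= d -> 0 <= j1 x t) ->
  forall s t, c <= s -> s <= t -> t <= d -> j0 x s <= j0 x t.
Proof.
  intros H. apply nondecreasing with (f' := j1 x); [|exact H].
  intros t Ht; now destruct (Hx t Ht).
Qed.

Lemma j0_decr : (forall t, c <= t <= d -> j1 x t <= 0) ->
  forall s t, c <= s -> s <= t -> t <= d -> j0 x t <= j0 x s.
Proof.
  intros H. apply nonincreasing with (f' := j1 x); [|exact H].
  intros t Ht; now destruct (Hx t Ht).
Qed.

Lemma j1_incr : (forall t, c <= t <= d -> 0 <= j2 x t) ->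
  forall s t, c <= s -> s <= t -> t <= d -> j1 x s <= j1 x t.
Proof.
  intros H. apply nondecreasing with (f' := fun t => cr S t * j2 x t).
  - intros t Ht; now destruct (Hx t Ht) as [_ [? _]].
  - intros t Ht. apply Rmult_le_pos; [left; apply cr_pos | now apply H].
Qed.

Lemma j1_decr : (forall t, c <= t <= d -> j2 x t <= 0) ->
  forall s t, c <= s -> s <= t -> t <= d -> j1 x t <= j1 x s.
Proof.
  intros H. apply nonincreasing with (f' := fun t => cr S t * j2 x t).
  - intros t Ht; now destruct (Hx t Ht) as [_ [? _]].
  - intros t Ht. pose proof (cr_pos S t); pose proof (H t Ht); nra.
Qed.

Lemma j2_incr : (forall t, c <= t <= d -> 0 <= j3 x t) ->
  forall s t, c <= s -> s <= t -> t <= d -> j2 x s <= j2 x t.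
Proof.
  intros H. apply nondecreasing with (f' := fun t => cg S t * j3 x t).
  - intros t Ht; now destruct (Hx t Ht) as [_ [_ [? _]]].
  - intros t Ht. apply Rmult_le_pos; [left; apply cg_pos | now apply H].
Qed.

Lemma j2_decr : (forall t, c <= t <= d -> j3 x t <= 0) ->
  forall s t, c <= s -> s <= t -> t <= d -> j2 x t <= j2 x s.
Proof.
  intros H. apply nonincreasing with (f' := fun t => cg S t * j3 x t).
  - intros t Ht; now destruct (Hx t Ht) as [_ [_ [? _]]].
  - intros t Ht. pose proof (cg_pos S t); pose proof (H t Ht); nra.
Qed.

Lemma j3_incr : (forall t, c <= t <= d -> 0 <= f t) ->
  forall s t, c <= s -> s <= t -> t <= d -> j3 x s <= j3 x t.
Proof.
  intros H. apply nondecreasing with (f' := fun t => cq S t * f t).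
  - intros t Ht; now destruct (Hx t Ht) as [_ [_ [_ ?]]].
  - intros t Ht. apply Rmult_le_pos; [left; apply cq_pos | now apply H].
Qed.

Lemma j2_mean : c < d -> exists s, c < s < d /\ j2 x d - j2 x c = cg S s * j3 x s * (d - c).
Proof.
  intros Hcd. apply (mean_value _ (fun s => cg S s * j3 x s)); [exact Hcd|].
  intros t Ht; now destruct (Hx t Ht) as [_ [_ [? _]]].
Qed.

End Components.

(* The first nonzero entry of the jet makes [j0] negative to the right of [t]. *)
Definition lexneg (x : jet) (t : R) : Prop :=
  j0 x t < 0 \/ j0 x t = 0 /\ (j1 x t < 0 \/ j1 x t = 0 /\
    (j2 x t < 0 \/ j2 x t = 0 /\ j3 x t < 0)).

Definition lexneg_left (x : jet) (t : R) : Prop :=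
  j0 x t < 0 \/ j0 x t = 0 /\ (0 < j1 x t \/ j1 x t = 0 /\
    (j2 x t < 0 \/ j2 x t = 0 /\ 0 < j3 x t)).

(** * The sign of a solution beside a zero *)

(** One integration transports the sign of [F'] just after [c] to [F]; chaining it from the first
    nonzero entry of a jet up to [j0] gives [lexneg_right_neg]. *)
Lemma neg_step (F F' k : R -> R) (c d : R) :
  c < d ->
  (forall t, c <= t <= d -> is_derive F t (k t * F' t)) -> (forall t, 0 < k t) ->
  F c = 0 ->
  (exists e, 0 < e /\ forall t, c < t < c + e -> t <= d -> F' t < 0) ->
  exists e, 0 < e /\ forall t, c < t < c + e -> t <= d -> F t < 0.
Proof.
  intros Hcd HF Hk H0 [e [He H]].
  exists e; split; [exact He|]. intros t Ht Htd.
  destruct (mean_value F (fun t => k t * F' t) c t) as [s [Hs E]]; [lra | |].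
  - intros s Hs; apply HF; lra.
  - specialize (Hk s). assert (F' s < 0) by (apply H; lra). 
    assert (0 < k s * - F' s * (t - c)) by (repeat apply Rmult_lt_0_compat; lra). nra.
Qed.

Lemma neg_start (F : R -> R) (c d : R) :
  continuity_pt F c -> F c < 0 ->
  exists e, 0 < e /\ forall t, c < t < c + e -> t <= d -> F t < 0.
Proof.
  intros Hc H. destruct (neg_nbhd F c Hc H) as [e [He K]].
  exists e; split; [exact He|]. intros t Ht _. apply K, Rabs_def1; lra.
Qed.

Lemma lexneg_right_neg (S : system) (x : jet) (f : R -> R) (c d : R) :
  c < d -> solves S x f c d -> lexneg x c ->
  exists e, 0 < e /\ forall t, c < t < c + e -> t <= d -> j0 x t < 0.
Proof.
  intros Hcd Hx H.
  destruct (solves_cont S x f c d Hx c) as [C0 [C1 [C2 C3]]]; [lra|].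
  assert (D0 : forall t, c <= t <= d -> is_derive (j0 x) t (1 * j1 x t)).
  { intros t Ht; rewrite Rmult_1_l; now destruct (Hx t Ht). }
  assert (D1 : forall t, c <= t <= d -> is_derive (j1 x) t (cr S t * j2 x t)).
  { intros t Ht; now destruct (Hx t Ht) as [_ [? _]]. }
  assert (D2 : forall t, c <= t <= d -> is_derive (j2 x) t (cg S t * j3 x t)).
  { intros t Ht; now destruct (Hx t Ht) as [_ [_ [? _]]]. }
  destruct H as [H|[E0 [H|[E1 [H|[E2 H]]]]]].
  - now apply neg_start.
  - apply (neg_step _ _ (fun _ => 1) c d Hcd D0); [intros; lra | exact E0 |].
    now apply neg_start.
  - apply (neg_step _ _ (fun _ => 1) c d Hcd D0); [intros; lra | exact E0 |].
    apply (neg_step _ _ _ c d Hcd D1); [apply cr_pos | exact E1 |].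
    now apply neg_start.
  - apply (neg_step _ _ (fun _ => 1) c d Hcd D0); [intros; lra | exact E0 |].
    apply (neg_step _ _ _ c d Hcd D1); [apply cr_pos | exact E1 |].
    apply (neg_step _ _ _ c d Hcd D2); [apply cg_pos | exact E2 |].
    now apply neg_start.
Qed.

Lemma lexneg_left_neg (S : system) (x : jet) (f : R -> R) (c d : R) :
  c < d -> solves S x f c d -> lexneg_left x d ->
  exists e, 0 < e /\ forall t, d - e < t < d -> c <= t -> j0 x t < 0.
Proof.
  intros Hcd Hx H.
  destruct (lexneg_right_neg (sref S) (jref S x) (fun t => f (lo S + hi S - t))
    (lo S + hi S - d) (lo S + hi S - c)) as [e [He K]].
  - lra.
  - now apply solves_ref.
  - unfold lexneg; simpl. replace (lo S + hi S - (lo S + hi S - d)) with d by ring.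
    destruct H as [H|[E0 [H|[E1 [H|[E2 H]]]]]].
    + left; lra.
    + right; split; [lra | left; lra].
    + right; split; [lra | right; split; [lra | left; lra]].
    + right; split; [lra | right; split; [lra | right; split; lra]].
  - exists e; split; [exact He|]. intros t Ht Hct.
    specialize (K (lo S + hi S - t) ltac:(lra) ltac:(lra)). simpl in K.
    now replace (lo S + hi S - (lo S + hi S - t)) with t in K by ring.
Qed.

Lemma not_lexneg (S : system) (x : jet) (f : R -> R) (c d t : R) :
  solves S x f c d -> (forall t, c <= t <= d -> 0 <= j0 x t) ->
  c <= t < d -> ~ lexneg x t.
Proof.
  intros Hx H Ht L.
  destruct (lexneg_right_neg S x f t d ltac:(lra)) as [e [He K]]; [|exact L|].
  - restrict Hx.
  - assert (t < Rmin d (t + e / 2)) by (apply Rmin_glb_lt; lra).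
    pose proof (Rmin_l d (t + e / 2)); pose proof (Rmin_r d (t + e / 2)).
    specialize (K (Rmin d (t + e / 2)) ltac:(lra) ltac:(lra)).
    specialize (H (Rmin d (t + e / 2)) ltac:(lra)). lra.
Qed.

Lemma not_lexneg_left (S : system) (x : jet) (f : R -> R) (c d t : R) :
  solves S x f c d -> (forall t, c <= t <= d -> 0 <= j0 x t) ->
  c < t <= d -> ~ lexneg_left x t.
Proof.
  intros Hx H Ht L.
  destruct (lexneg_left_neg S x f c t ltac:(lra)) as [e [He K]]; [|exact L|].
  - restrict Hx.
  - assert (Rmax c (t - e / 2) < t) by (apply Rmax_lub_lt; lra).
    pose proof (Rmax_l c (t - e / 2)); pose proof (Rmax_r c (t - e / 2)).
    specialize (K (Rmax c (t - e / 2)) ltac:(lra) ltac:(lra)).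
    specialize (H (Rmax c (t - e / 2)) ltac:(lra)). lra.
Qed.

Lemma interior_zero (S : system) (x : jet) (f : R -> R) (c d t : R) :
  solves S x f c d -> (forall t, c <= t <= d -> 0 <= j0 x t) ->
  c < t < d -> j0 x t = 0 -> j1 x t = 0 /\ 0 <= j2 x t.
Proof.
  intros Hx H Ht E.
  pose proof (not_lexneg S x f c d t Hx H ltac:(lra)) as N1.
  pose proof (not_lexneg_left S x f c d t Hx H ltac:(lra)) as N2.
  assert (E1 : j1 x t = 0).
  { destruct (Rtotal_order (j1 x t) 0) as [L|[L|L]]; [|exact L|]; exfalso.
    - apply N1; right; auto.
    - apply N2; right; auto. }
  split; [exact E1|]. apply Rnot_lt_le; intros L.
  apply N1; right; auto.
Qed.

Definition jopp (x : jet) : jet := jlin (-1) x 0 x.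

Lemma jopp_solves (S : system) (x : jet) (f : R -> R) (c d : R) :
  solves S x f c d -> solves S (jopp x) (fun t => - f t) c d.
Proof.
  intros H. apply solves_ext with (fun t => -1 * f t + 0 * f t).
  - now apply solves_lin.
  - intros; ring.
Qed.

Lemma dominated_right (x y : jet) (t : R) :
  j0 x t = 0 -> j0 y t = 0 -> 0 < j1 y t -> exists K, lexneg (jlin 1 x (- K) y) t.
Proof.
  intros Hx Hy H. exists ((j1 x t + 1) / j1 y t). right; simpl.
  split; [rewrite Hx, Hy; ring|]. left.
  replace (1 * j1 x t + - ((j1 x t + 1) / j1 y t) * j1 y t) with (-1) by (field; lra). lra.
Qed.

Lemma dominated_left (x y : jet) (t : R) :
  j0 x t = 0 -> j0 y t = 0 -> j1 y t < 0 -> exists K, lexneg_left (jlin 1 x (- K) y) t.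
Proof.
  intros Hx Hy H. exists ((j1 x t - 1) / j1 y t). right; simpl.
  split; [rewrite Hx, Hy; ring|]. left.
  replace (1 * j1 x t + - ((j1 x t - 1) / j1 y t) * j1 y t) with 1 by (field; lra). lra.
Qed.

(* At an end point where [y] vanishes, contact means that no smaller multiple of
   [y] dominates [x] nearby; this forces [x - k y] to vanish to higher order. *)
Lemma touching (S : system) (x y : jet) (f g : R -> R) (c d : R) :
  c < d -> solves S x f c d -> solves S y g c d ->
  (forall t, c <= t <= d -> 0 <= j0 y t) ->
  (forall t, c < t < d -> 0 < j0 y t) ->
  (0 < j0 y c \/ exists K, lexneg (jlin 1 x (- K) y) c) ->
  (0 < j0 y d \/ exists K, lexneg_left (jlin 1 x (- K) y) d) ->
  exists k,
    (forall t, c <= t <= d -> j0 (jlin 1 x (- k) y) t <= 0) /\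
    (forall k', (forall t, c <= t <= d -> j0 x t - k' * j0 y t <= 0) -> k <= k') /\
    ((exists t, c < t < d /\ j0 (jlin 1 x (- k) y) t = 0) \/
     (forall h, 0 < h -> ~ lexneg (jlin 1 x (h - k) y) c) \/
     (forall h, 0 < h -> ~ lexneg_left (jlin 1 x (h - k) y) d)).
Proof.
  intros Hcd Hx Hy Hy0 Hy1 Hc Hd.
  assert (Cont : forall K t, c <= t <= d -> continuity_pt (fun t => j0 x t - K * j0 y t) t).
  { intros K t Ht. apply continuity_pt_minus.
    - now apply (solves_cont S x f c d).
    - apply continuity_pt_mult; [apply continuity_pt_const; intros ? ?; reflexivity|].
      now apply (solves_cont S y g c d). }
  assert (Neg : forall t, c <= t <= d -> 0 < j0 y t -> forall K, j0 x t - K * j0 y t < 0 ->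
     exists e, 0 < e /\ forall s, c <= s <= d -> Rabs (s - t) < e -> j0 x s - K * j0 y s <= 0).
  { intros t Ht Hyt K HK. destruct (neg_nbhd _ t (Cont K t Ht) HK) as [e [He H]].
    exists e; split; [exact He|]. intros s _ Hs. left. now apply (H s). }
  assert (Pos : forall t, c <= t <= d -> 0 < j0 y t -> exists K e, 0 < e /\
     forall s, c <= s <= d -> Rabs (s - t) < e -> j0 x s - K * j0 y s <= 0).
  { intros t Ht Hyt. exists (j0 x t / j0 y t + 1). apply Neg; [exact Ht | exact Hyt |].
    replace ((j0 x t / j0 y t + 1) * j0 y t) with (j0 x t + j0 y t) by (field; lra). lra. }
  assert (Lc : forall K, lexneg (jlin 1 x (- K) y) c -> exists e, 0 < e /\
     forall s, c <= s <= d -> Rabs (s - c) < e -> j0 x s - K * j0 y s <= 0).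
  { intros K HK.
    destruct (lexneg_right_neg S _ _ c d Hcd (solves_lin S 1 (- K) x y f g c d Hx Hy) HK)
      as [e [He H]].
    exists e; split; [exact He|]. intros s Hs Hse. apply Rabs_def2 in Hse.
    destruct (Req_dec s c) as [->|].
    - destruct HK as [HK|[HK _]]; simpl in HK; lra.
    - specialize (H s ltac:(lra) ltac:(lra)). simpl in H. lra. }
  assert (Ld : forall K, lexneg_left (jlin 1 x (- K) y) d -> exists e, 0 < e /\
     forall s, c <= s <= d -> Rabs (s - d) < e -> j0 x s - K * j0 y s <= 0).
  { intros K HK.
    destruct (lexneg_left_neg S _ _ c d Hcd (solves_lin S 1 (- K) x y f g c d Hx Hy) HK)
      as [e [He H]].
    exists e; split; [exact He|]. intros s Hs Hse. apply Rabs_def2 in Hse.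
    destruct (Req_dec s d) as [->|].
    - destruct HK as [HK|[HK _]]; simpl in HK; lra.
    - specialize (H s ltac:(lra) ltac:(lra)). simpl in H. lra. }
  destruct (least_multiple (j0 x) (j0 y) c d ((c + d) / 2)) as [k [K1 [K2 [t [Ht K3]]]]].
  - lra.
  - exact Hy0.
  - lra.
  - apply Hy1; lra.
  - intros t Ht. destruct (Req_dec t c) as [->|Nc].
    + destruct Hc as [Hc|[K HK]]; [now apply Pos|]. exists K; now apply Lc.
    + destruct (Req_dec t d) as [->|Nd].
      * destruct Hd as [Hd|[K HK]]; [now apply Pos|]. exists K; now apply Ld.
      * apply Pos; [exact Ht|]. apply Hy1; lra.
  - exists k. split; [intros t' Ht'; specialize (K1 t' Ht'); simpl; lra|]. split; [exact K2|].
    destruct (Req_dec t c) as [->|Nc]; [|destruct (Req_dec t d) as [->|Nd]].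
    + right; left. intros h Hh L.
      replace (h - k) with (- (k - h)) in L by ring.
      destruct (Lc _ L) as [e [He H]]. destruct (K3 h e Hh He) as [s [Hs [Hse Hpos]]].
      specialize (H s Hs Hse). lra.
    + right; right. intros h Hh L.
      replace (h - k) with (- (k - h)) in L by ring.
      destruct (Ld _ L) as [e [He H]]. destruct (K3 h e Hh He) as [s [Hs [Hse Hpos]]].
      specialize (H s Hs Hse). lra.
    + left; exists t; split; [lra|].
      destruct (K1 t Ht) as [Hneg|]; [|simpl; lra]. exfalso.
      assert (Hyt : 0 < j0 y t) by (apply Hy1; lra).
      (* Half of the gap at [t]: with the multiplier [k - h] the difference would remain negative
         near [t], so [t] would not be a contact point. *)
      set (h := - (j0 x t - k * j0 y t) / (2 * j0 y t)).
      assert (Hh : 0 < h) by (apply Rdiv_lt_0_compat; lra).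
      assert (Hhe : h * j0 y t = - (j0 x t - k * j0 y t) / 2) by (unfold h; field; lra).
      destruct (Neg t Ht Hyt (k - h)) as [e [He H]]; [nra|].
      destruct (K3 h e Hh He) as [s [Hs [Hse Hpos]]]. specialize (H s Hs Hse). lra.
Qed.

(** * Dependence on the eigenvalue parameter *)

Definition jnorm2 (x : jet) (t : R) : R :=
  j0 x t * j0 x t + j1 x t * j1 x t + j2 x t * j2 x t + j3 x t * j3 x t.

Lemma jnorm2_nonneg (x : jet) (t : R) : 0 <= jnorm2 x t.
Proof.
  unfold jnorm2. pose proof (Rle_0_sqr (j0 x t)); pose proof (Rle_0_sqr (j1 x t));
    pose proof (Rle_0_sqr (j2 x t)); pose proof (Rle_0_sqr (j3 x t)); unfold Rsqr in *; lra.
Qed.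

Lemma two_mul_le (k B x y : R) : 0 <= k <= B -> 2 * (k * x * y) <= B * (x * x + y * y).
Proof.
  intros Hk. assert (0 <= (x - y) * (x - y)) by apply Rle_0_sqr.
  assert (0 <= (x + y) * (x + y)) by apply Rle_0_sqr. 
  assert (0 <= k * ((x - y) * (x - y))) by (apply Rmult_le_pos; lra).
  assert (0 <= x * x) by apply Rle_0_sqr. assert (0 <= y * y) by apply Rle_0_sqr.
  assert (0 <= (B - k) * (x * x + y * y)) by (apply Rmult_le_pos; lra). nra.
Qed.

Lemma coeff_bound (S : system) :
  exists B, 0 < B /\ forall t, lo S <= t <= hi S -> cr S t <= B /\ cg S t <= B /\ cq S t <= B.
Proof.
  pose proof (lo_hi S) as Hab.
  destruct (continuity_ab_maj (cr S) (lo S) (hi S)) as [m1 [M1 _]]; [lra | intros; apply cr_cont |].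
  destruct (continuity_ab_maj (cg S) (lo S) (hi S)) as [m2 [M2 _]]; [lra | intros; apply cg_cont |].
  destruct (continuity_ab_maj (cq S) (lo S) (hi S)) as [m3 [M3 _]]; [lra | intros; apply cq_cont |].
  exists (cr S m1 + cg S m2 + cq S m3).
  pose proof (cr_pos S m1); pose proof (cg_pos S m2); pose proof (cq_pos S m3).
  split; [lra|]. intros t Ht. specialize (M1 t Ht); specialize (M2 t Ht); specialize (M3 t Ht). lra.
Qed.

(** Gronwall's inequality for the squared norm of the jet, with a constant uniform in the parameter
    as long as [Rabs lam <= L]. *)
Lemma energy_estimate (S : system) (L : R) : 0 <= L ->
  exists C, 0 < C /\ forall x f lam e E,
    Rabs lam <= L -> solves S x f (lo S) (hi S) ->
    (forall t, lo S <= t <= hi S -> f t = lam * j0 x t + e t /\ e t * e t <= E) ->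
    forall t, lo S <= t <= hi S -> jnorm2 x t <= C * (jnorm2 x (lo S) + E).
Proof.
  intros HL. destruct (coeff_bound S) as [B [HB Hb]]. pose proof (lo_hi S) as Hab.
  (* Each of the five cross terms in the derivative of [jnorm2] is split by [two_mul_le]; [c] bounds
     what any single square collects, and only the error term leaves [B * E]. *)
  set (c := 1 + 3 * B + B * L).
  assert (Hc : 0 < c) by (unfold c; nra).
  exists ((1 + B * (hi S - lo S)) * exp (c * (hi S - lo S))).
  split; [apply Rmult_lt_0_compat; [nra | apply exp_pos]|].
  intros x f lam e E Hlam Hx He t Ht.
  assert (HE : 0 <= E).
  { destruct (He t Ht) as [_ H]. pose proof (Rle_0_sqr (e t)); unfold Rsqr in *; lra. }
  (* The integrating factor absorbs [c * jnorm2]; as this factor is at most one, the linear term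
     absorbs [B * E]. *)
  set (G := fun t => jnorm2 x t * exp (- c * (t - lo S)) - B * E * (t - lo S)).
  set (N' := fun t => 2 * (j0 x t * j1 x t + j1 x t * (cr S t * j2 x t)
                      + j2 x t * (cg S t * j3 x t) + j3 x t * (cq S t * f t))).
  assert (HG : G t <= G (lo S)).
  { apply nonincreasing with (c := lo S) (d := hi S)
      (f' := fun t => (N' t - c * jnorm2 x t) * exp (- c * (t - lo S)) - B * E); [| |lra..].
    - intros s Hs. destruct (Hx s Hs) as [H0 [H1 [H2 H3]]].
      unfold G, jnorm2. auto_derive.
      + repeat split; eexists; eassumption.
      + assert (E0 : Derive (fun u : R => j0 x u) s = j1 x s) by exact (is_derive_unique _ _ _ H0).
        assert (E1 : Derive (fun u : R => j1 x u) s = cr S s * j2 x s) by exact (is_derive_unique _ _ _ H1).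
        assert (E2 : Derive (fun u : R => j2 x u) s = cg S s * j3 x s) by exact (is_derive_unique _ _ _ H2).
        assert (E3 : Derive (fun u : R => j3 x u) s = cq S s * f s) by exact (is_derive_unique _ _ _ H3).
        rewrite E0, E1, E2, E3. unfold N', jnorm2, Rminus. ring.
    - intros s Hs. destruct (He s Hs) as [Ef Ee]. destruct (Hb s Hs) as [B1 [B2 B3]].
      assert (HN : N' s <= c * jnorm2 x s + B * E).
      { unfold N', jnorm2, c. rewrite Ef.
        pose proof (cr_pos S s); pose proof (cg_pos S s); pose proof (cq_pos S s).
        pose proof (two_mul_le 1 1 (j0 x s) (j1 x s) ltac:(lra)).
        pose proof (two_mul_le (cr S s) B (j1 x s) (j2 x s) ltac:(lra)).
        pose proof (two_mul_le (cg S s) B (j2 x s) (j3 x s) ltac:(lra)).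
        pose proof (two_mul_le (cq S s) B (j3 x s) (e s) ltac:(lra)).
        assert (2 * (cq S s * j3 x s * (lam * j0 x s)) <= B * L * (j3 x s * j3 x s + j0 x s * j0 x s)).
        { assert (Hl : 0 <= cq S s * Rabs lam <= B * L).
          { split; [apply Rmult_le_pos; [lra | apply Rabs_pos]|].
            apply Rmult_le_compat; try lra. apply Rabs_pos. }
          destruct (Rcase_abs lam) as [Hn|Hn].
          - rewrite Rabs_left in Hl by lra.
            pose proof (two_mul_le (cq S s * - lam) (B * L) (j3 x s) (- j0 x s) Hl). nra.
          - rewrite Rabs_right in Hl by lra.
            pose proof (two_mul_le (cq S s * lam) (B * L) (j3 x s) (j0 x s) Hl). nra. }
        pose proof (Rle_0_sqr (j0 x s)); pose proof (Rle_0_sqr (j1 x s));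
        pose proof (Rle_0_sqr (j2 x s)); pose proof (Rle_0_sqr (j3 x s)); unfold Rsqr in *.
        assert (B * (e s * e s) <= B * E) by (apply Rmult_le_compat_l; lra).
        assert (0 <= B * (j0 x s * j0 x s)) by (apply Rmult_le_pos; lra).
        assert (0 <= B * (j1 x s * j1 x s)) by (apply Rmult_le_pos; lra).
        assert (0 <= B * (j2 x s * j2 x s)) by (apply Rmult_le_pos; lra).
        assert (0 <= B * (j3 x s * j3 x s)) by (apply Rmult_le_pos; lra).
        assert (0 <= B * L * (j1 x s * j1 x s)) by (apply Rmult_le_pos; [apply Rmult_le_pos; lra | lra]).
        assert (0 <= B * L * (j2 x s * j2 x s)) by (apply Rmult_le_pos; [apply Rmult_le_pos; lra | lra]).
        lra. }
      assert (exp (- c * (s - lo S)) <= 1).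
      { rewrite <- exp_0. destruct (Req_dec s (lo S)) as [->|].
        - right; f_equal; ring.
        - left; apply exp_increasing. nra. }
      pose proof (exp_pos (- c * (s - lo S))).
      assert (0 <= B * E) by (apply Rmult_le_pos; lra). nra. }
  unfold G in HG. rewrite Rminus_diag, !Rmult_0_r, exp_0 in HG.
  assert (Hn : jnorm2 x t * exp (- c * (t - lo S)) <= (1 + B * (hi S - lo S)) * (jnorm2 x (lo S) + E)).
  { pose proof (jnorm2_nonneg x (lo S)).
    assert (B * E * (t - lo S) <= B * E * (hi S - lo S)).
    { apply Rmult_le_compat_l; [|lra]. apply Rmult_le_pos; lra. }
    assert (0 <= B * (hi S - lo S) * jnorm2 x (lo S))
      by (apply Rmult_le_pos; [apply Rmult_le_pos; lra | lra]).
    nra. }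
  assert (He' : exp (- c * (t - lo S)) * exp (c * (t - lo S)) = 1).
  { rewrite <- exp_plus. rewrite <- exp_0. f_equal; ring. }
  assert (exp (c * (t - lo S)) <= exp (c * (hi S - lo S))).
  { destruct (Req_dec t (hi S)) as [->|]; [lra|]. left; apply exp_increasing; nra. }
  pose proof (exp_pos (c * (t - lo S))).
  assert (0 <= jnorm2 x (lo S) + E) by (pose proof (jnorm2_nonneg x (lo S)); lra).
  assert (0 < 1 + B * (hi S - lo S)) by nra.
  replace (jnorm2 x t) with (jnorm2 x t * exp (- c * (t - lo S)) * exp (c * (t - lo S)))
    by (rewrite Rmult_assoc, He'; ring).
  apply Rle_trans with ((1 + B * (hi S - lo S)) * (jnorm2 x (lo S) + E) * exp (c * (t - lo S))).
  - apply Rmult_le_compat_r; lra.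
  - assert (0 <= (1 + B * (hi S - lo S)) * (jnorm2 x (lo S) + E)) by (apply Rmult_le_pos; lra).
    nra.
Qed.

Lemma sqr_le_abs (x c : R) : 0 <= c -> x * x <= c * c -> Rabs x <= c.
Proof.
  intros Hc H. rewrite <- (Rabs_pos_eq c) by exact Hc. apply Rsqr_le_abs_0. exact H.
Qed.

Lemma jnorm2_abs (x : jet) (t c : R) : 0 <= c -> jnorm2 x t <= c * c ->
  Rabs (j0 x t) <= c /\ Rabs (j1 x t) <= c /\ Rabs (j2 x t) <= c /\ Rabs (j3 x t) <= c.
Proof.
  intros Hc H. unfold jnorm2 in H.
  pose proof (Rle_0_sqr (j0 x t)); pose proof (Rle_0_sqr (j1 x t));
    pose proof (Rle_0_sqr (j2 x t)); pose proof (Rle_0_sqr (j3 x t)); unfold Rsqr in *.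
  repeat split; apply sqr_le_abs; lra.
Qed.

Definition data (x : jet) (t c0 c1 c2 c3 : R) : Prop :=
  j0 x t = c0 /\ j1 x t = c1 /\ j2 x t = c2 /\ j3 x t = c3.

Definition hom (S : system) (lam : R) (x : jet) (c d : R) : Prop :=
  solves S x (fun t => lam * j0 x t) c d.

Lemma hom_lin (S : system) (lam k l c d : R) (x y : jet) :
  hom S lam x c d -> hom S lam y c d -> hom S lam (jlin k x l y) c d.
Proof.
  intros Hx Hy. apply solves_ext with (1 := solves_lin S k l _ _ _ _ _ _ Hx Hy).
  intros; simpl; ring.
Qed.

(** The difference of the solutions for [lam] and [mu] starts from the zero jet and solves the [lam]
    equation with error [(lam - mu) * j0 y], so the energy estimate makes it proportional to
    [lam - mu]. One constant serves for both estimates. *)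
Lemma parameter_bound (S : system) (L c0 c1 c2 c3 : R) : 0 <= L ->
  exists C, 0 < C /\
    (forall lam x, Rabs lam <= L -> hom S lam x (lo S) (hi S) -> data x (lo S) c0 c1 c2 c3 ->
      forall t, lo S <= t <= hi S ->
      Rabs (j0 x t) <= C /\ Rabs (j1 x t) <= C /\ Rabs (j2 x t) <= C /\ Rabs (j3 x t) <= C) /\
    (forall lam mu x y, Rabs lam <= L -> Rabs mu <= L ->
      hom S lam x (lo S) (hi S) -> hom S mu y (lo S) (hi S) ->
      data x (lo S) c0 c1 c2 c3 -> data y (lo S) c0 c1 c2 c3 ->
      forall t, lo S <= t <= hi S ->
      Rabs (j0 x t - j0 y t) <= C * Rabs (lam - mu) /\
      Rabs (j1 x t - j1 y t) <= C * Rabs (lam - mu) /\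
      Rabs (j2 x t - j2 y t) <= C * Rabs (lam - mu) /\
      Rabs (j3 x t - j3 y t) <= C * Rabs (lam - mu)).
Proof.
  intros HL. destruct (energy_estimate S L HL) as [C [HC H]].
  set (n := c0 * c0 + c1 * c1 + c2 * c2 + c3 * c3).
  assert (Hn : 0 <= n).
  { pose proof (Rle_0_sqr c0); pose proof (Rle_0_sqr c1);
    pose proof (Rle_0_sqr c2); pose proof (Rle_0_sqr c3); unfold n, Rsqr in *; lra. }
  assert (Hbd : forall lam x, Rabs lam <= L -> hom S lam x (lo S) (hi S) ->
    data x (lo S) c0 c1 c2 c3 -> forall t, lo S <= t <= hi S -> jnorm2 x t <= C * n).
  { intros lam x Hlam Hx [E0 [E1 [E2 E3]]] t Ht.
    replace (C * n) with (C * (jnorm2 x (lo S) + 0)).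
    - apply (H x _ lam (fun _ => 0) 0 Hlam Hx); [|exact Ht]. intros s _; split; lra.
    - unfold jnorm2, n; rewrite E0, E1, E2, E3; ring. }
  (* Chosen so that [K >= 1], [C <= K] and [C * n <= K]; hence [K * K] exceeds both [C * n] and
     [C * C * n]. *)
  set (K := (1 + C) * (1 + n)).
  assert (HCn : 0 <= C * n) by (apply Rmult_le_pos; lra).
  assert (HK : 1 <= K) by (unfold K; nra).
  exists K; split; [lra|]. split.
  - intros lam x Hlam Hx Hd t Ht. apply jnorm2_abs; [lra|].
    apply Rle_trans with (C * n); [now apply (Hbd lam)|].
    apply Rle_trans with K; [unfold K; nra|]. nra.
  - intros lam mu x y Hlam Hmu Hx Hy Hdx Hdy t Ht.
    pose proof (Rabs_pos (lam - mu)) as Hp.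
    assert (Hdiff : jnorm2 (jlin 1 x (-1) y) t <= (K * Rabs (lam - mu)) * (K * Rabs (lam - mu))).
    { apply Rle_trans with (C * (jnorm2 (jlin 1 x (-1) y) (lo S)
        + (lam - mu) * (lam - mu) * (C * n))).
      - apply (H _ _ lam (fun t => (lam - mu) * j0 y t) _ Hlam (solves_lin _ 1 (-1) _ _ _ _ _ _ Hx Hy));
          [|exact Ht].
        intros s Hs. split; [simpl; ring|].
        replace ((lam - mu) * j0 y s * ((lam - mu) * j0 y s))
          with ((lam - mu) * (lam - mu) * (j0 y s * j0 y s)) by ring.
        apply Rmult_le_compat_l; [apply Rle_0_sqr|].
        specialize (Hbd mu y Hmu Hy Hdy s Hs). unfold jnorm2 in Hbd.
        pose proof (Rle_0_sqr (j1 y s)); pose proof (Rle_0_sqr (j2 y s));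
        pose proof (Rle_0_sqr (j3 y s)); unfold Rsqr in *. lra.
      - replace (jnorm2 (jlin 1 x (-1) y) (lo S)) with 0.
        2:{ unfold jnorm2; simpl.
            destruct Hdx as [E0 [E1 [E2 E3]]], Hdy as [F0 [F1 [F2 F3]]].
            rewrite E0, E1, E2, E3, F0, F1, F2, F3; ring. }
        assert (Es : (lam - mu) * (lam - mu) = Rabs (lam - mu) * Rabs (lam - mu)).
        { rewrite <- Rabs_mult. symmetry; apply Rabs_pos_eq, Rle_0_sqr. }
        rewrite Es, Rplus_0_l.
        set (r := Rabs (lam - mu)) in *.
        replace (C * (r * r * (C * n))) with ((r * r) * (C * C * n)) by ring.
        replace (K * r * (K * r)) with ((r * r) * (K * K)) by ring.
        apply Rmult_le_compat_l; [apply Rle_0_sqr|].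
        apply Rle_trans with (K * (C * n)).
        + assert (C <= K) by (unfold K; nra).
          replace (C * C * n) with (C * (C * n)) by ring. apply Rmult_le_compat_r; lra.
        + apply Rmult_le_compat_l; [lra|]. unfold K; nra. }
    apply jnorm2_abs in Hdiff; [|apply Rmult_le_pos; lra]. simpl in Hdiff.
    replace (j0 x t - j0 y t) with (1 * j0 x t + -1 * j0 y t) by ring.
    replace (j1 x t - j1 y t) with (1 * j1 x t + -1 * j1 y t) by ring.
    replace (j2 x t - j2 y t) with (1 * j2 x t + -1 * j2 y t) by ring.
    replace (j3 x t - j3 y t) with (1 * j3 x t + -1 * j3 y t) by ring.
    exact Hdiff.
Qed.

(** Nonnegativity persists up to the supremum of the good parameters by the Lipschitz bound. There a
    zero is excluded inside and at [d], so strict positivity passes to slightly larger parameters.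
    Near [c], where [F] may vanish, compactness fails and uniform positivity is assumed. The value
    at [d] for [L] itself is left free, since [L] may be an eigenvalue. *)
Lemma positivity_continuation (F : R -> R -> R) (c d L n C : R) :
  c < d -> 0 <= L -> 0 < n ->
  (forall l t, 0 <= l <= L -> c < t < c + n -> t <= d -> 0 < F l t) ->
  (forall l m t, 0 <= l <= L -> 0 <= m <= L -> c <= t <= d ->
     Rabs (F l t - F m t) <= C * Rabs (l - m)) ->
  (forall l t, 0 <= l <= L -> c <= t <= d -> continuity_pt (F l) t) ->
  (forall t, c < t <= d -> 0 < F 0 t) ->
  (forall l, 0 <= l < L -> F l d <> 0) ->
  (forall l t, 0 <= l <= L -> (forall s, c < s <= d -> 0 <= F l s) -> c < t < d -> F l t <> 0) ->
  forall t, c < t < d -> 0 < F L t.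
Proof.
  intros Hcd HL Hn Hnear Hlip Hcont H0 Hend Hint.
  (* The Lipschitz bound itself forces [C >= 0], unless the parameter interval is a single point. *)
  assert (HC : 0 <= C \/ L = 0).
  { destruct (Req_dec L 0) as [|NL]; [now right | left].
    apply Rnot_lt_le; intros HC.
    specialize (Hlip 0 L c ltac:(lra) ltac:(lra) ltac:(lra)).
    pose proof (Rabs_pos (F 0 c - F L c)).
    rewrite (Rabs_left (0 - L)) in Hlip by lra. nra. }
  destruct HC as [HC|HL0]; [|subst L; intros t Ht; apply H0; lra].
  set (E := fun l => 0 <= l <= L /\ forall m, 0 <= m <= l -> forall t, c < t <= d -> 0 <= F m t).
  assert (E0 : E 0).
  { split; [lra|]. intros m Hm t Ht. replace m with 0 by lra. left; now apply H0. }
  destruct (completeness E) as [l [Hub Hlub]].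
  { exists L; intros x [Hx _]; lra. }
  { exists 0; exact E0. }
  assert (Hl : 0 <= l <= L).
  { split; [now apply Hub|]. apply Hlub; intros x [Hx _]; lra. }
  assert (Hbelow : forall m, 0 <= m < l -> forall t, c < t <= d -> 0 <= F m t).
  { intros m Hm t Ht. apply NNPP; intros K. assert (l <= m); [|lra].
    apply Hlub; intros x [Hx Hx']. apply Rnot_lt_le; intros L'.
    apply K, (Hx' m); [lra | exact Ht]. }
  (* A negative value at [l] would survive at [l - e] for small [e], where nonnegativity is already
     known. *)
  assert (Hat : forall t, c < t <= d -> 0 <= F l t).
  { intros t Ht. apply Rnot_lt_le; intros Hneg.
    destruct (Req_dec l 0) as [E1|Nl]; [rewrite E1 in Hneg; specialize (H0 t Ht); lra|].
    destruct (small_step l (- F l t) C) as [e [He He2]]; [lra..|].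
    pose proof (Hbelow (l - e) ltac:(lra) t Ht).
    pose proof (Hlip (l - e) l t ltac:(lra) ltac:(lra) ltac:(lra)) as Hd.
    replace (l - e - l) with (- e) in Hd by ring.
    rewrite Rabs_Ropp, (Rabs_pos_eq e) in Hd by lra.
    apply Rabs_le_between in Hd. nra. }
  assert (HlL : l = L).
  { apply NNPP; intros Nl.
    assert (Hlt : 0 <= l < L) by lra.
    assert (Hpos : forall t, c < t <= d -> 0 < F l t).
    { intros t Ht. destruct (Hat t Ht) as [|E']; [assumption|]. exfalso.
      destruct (Req_dec t d) as [->|Nd]; [now apply (Hend l Hlt)|].
      apply (Hint l t Hl Hat); [lra | now symmetry]. }
    (* Below [c'] the uniform hypothesis applies; on [[c', d]] the positive minimum of [F l] fixes
       the admissible increment [e]. *)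
    set (c' := Rmin d (c + n / 2)).
    assert (Hc' : c < c') by (apply Rmin_glb_lt; lra).
    assert (Hc'd : c' <= d) by apply Rmin_l.
    assert (Hc'n : c' <= c + n / 2) by apply Rmin_r.
    destruct (continuity_ab_min (F l) c' d Hc'd) as [m [Hm Hmin]].
    { intros t Ht; apply Hcont; lra. }
    assert (Hfm : 0 < F l m) by (apply Hpos; lra).
    destruct (small_step (L - l) (F l m) C) as [e [He He2]]; [lra..|].
    assert (E (l + e)).
    { split; [lra|]. intros p Hp t Ht.
      destruct (Rlt_dec p l) as [L1|L1]; [apply Hbelow; [lra | exact Ht]|].
      destruct (Rle_dec c' t) as [L2|L2].
      - specialize (Hm t ltac:(lra)).
        pose proof (Hlip p l t ltac:(lra) ltac:(lra) ltac:(lra)) as Hd.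
        rewrite (Rabs_pos_eq (p - l)) in Hd by lra.
        apply Rabs_le_between in Hd. nra.
      - left; apply Hnear; lra. }
    assert (l + e <= l) by now apply Hub. lra. }
  subst l. intros t Ht. destruct (Hat t ltac:(lra)) as [|E']; [assumption|].
  exfalso. apply (Hint L t ltac:(lra) Hat Ht). now symmetry.
Qed.

(** * Volterra equations and initial value problems *)

(** Precomposition with [clamp] extends a function on [[a, b]] by its end values, so that continuity
    within the segment becomes continuity on the line. *)
Definition clamp (a b t : R) : R := Rmax a (Rmin b t).

Lemma clamp_in (a b t : R) : a <= b -> a <= clamp a b t <= b.
Proof.
  intros H; unfold clamp; split; [apply Rmax_l|].
  apply Rmax_lub; [exact H | apply Rmin_l].
Qed.

Lemma clamp_id (a b t : R) : a <= t <= b -> clamp a b t = t.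
Proof. intros H; unfold clamp. rewrite Rmin_right, Rmax_right; lra. Qed.

Lemma clamp_lip (a b s t : R) : a <= b -> Rabs (clamp a b s - clamp a b t) <= Rabs (s - t).
Proof.
  intros H; unfold clamp, Rmax, Rmin, Rabs.
  repeat destruct (Rle_dec _ _); repeat destruct (Rcase_abs _); lra.
Qed.

Lemma clamp_cont (a b : R) (f : R -> R) : a <= b ->
  (forall t, a <= t <= b -> continue_in f (seg a b) t) ->
  forall t, continuity_pt (fun t => f (clamp a b t)) t.
Proof.
  intros H Hf t e He.
  destruct (Hf (clamp a b t) (clamp_in a b t H) e He) as [n [Hn K]].
  exists n; split; [exact Hn|]. intros s [_ Hs]. simpl in *. unfold Rdist in *.
  destruct (Req_dec (clamp a b t) (clamp a b s)) as [E|E].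
  - rewrite E. rewrite Rminus_diag, Rabs_R0. exact He.
  - apply K. split; [split; [apply clamp_in; exact H | exact E]|].
    apply Rle_lt_trans with (2 := Hs). now apply clamp_lip.
Qed.

Lemma continuity_pt_clamp (a b : R) (f : R -> R) : a <= b ->
  (forall t, continuity_pt f t) -> forall t, continuity_pt (fun t => f (clamp a b t)) t.
Proof.
  intros H Hf. apply clamp_cont; [exact H|]. intros t _ e He.
  destruct (Hf t e He) as [n [Hn K]]. exists n; split; [exact Hn|].
  intros s [[_ Hs] Hst]. apply K. split; [split; [exact I | exact Hs] | exact Hst].
Qed.

(** Picard iteration: each application of [Phi] raises the power of [t - a] and divides by the new
    exponent, so the increments are dominated by the exponential series of [K (b - a)] and the
    iterates converge on the whole segment. *)
Lemma volterra_fixed_point (a b K : R) (Phi : (R -> R) -> R -> R) :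
  a < b -> 0 <= K ->
  (forall f, (forall t, continuity_pt f t) -> forall t, continuity_pt (Phi f) t) ->
  (forall f g C n, (forall t, continuity_pt f t) -> (forall t, continuity_pt g t) -> 0 <= C ->
     (forall t, a <= t <= b -> Rabs (f t - g t) <= C * (t - a) ^ n) ->
     forall t, a <= t <= b ->
       Rabs (Phi f t - Phi g t) <= K * C / INR (S n) * (t - a) ^ (S n)) ->
  exists f, (forall t, continuity_pt f t) /\ forall t, a <= t <= b -> f t = Phi f t.
Proof.
  intros Hab HK Hcont Hlip.
  set (it := fix it n := match n with O => (fun _ : R => 0)
                         | S n' => fun t => Phi (it n') (clamp a b t) end).
  assert (Hit : forall n t, continuity_pt (it n) t).
  { induction n as [|n IH]; intros t; simpl.
    - apply continuity_pt_const; intros ? ?; reflexivity.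
    - apply continuity_pt_clamp; [lra|]. now apply Hcont. }
  assert (HitS : forall n t, a <= t <= b -> it (S n) t = Phi (it n) t).
  { intros n t Ht; simpl. now rewrite clamp_id. }
  destruct (continuity_ab_maj (fun t => Rabs (it 1%nat t - it 0%nat t)) a b) as [m [Hm Hmab]].
  { lra. }
  { intros t _. apply (continuity_pt_comp (fun t => it 1%nat t - it 0%nat t) Rabs).
    - apply continuity_pt_minus; apply Hit.
    - apply Rcontinuity_abs. }
  set (C0 := Rabs (it 1%nat m - it 0%nat m)) in *.
  assert (HC0 : 0 <= C0) by apply Rabs_pos.
  set (B := K * (b - a)).
  assert (HB : 0 <= B) by (unfold B; apply Rmult_le_pos; lra).
  assert (Hstep : forall n t, a <= t <= b ->
    Rabs (it (S n) t - it n t) <= (C0 * K ^ n / INR (fact n)) * (t - a) ^ n).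
  { induction n as [|n IH]; intros t Ht.
    - specialize (Hm t Ht). replace (C0 * K ^ 0 / INR (fact 0) * (t - a) ^ 0) with C0
        by (simpl; field). exact Hm.
    - rewrite (HitS (S n)), (HitS n) by exact Ht.
      pose proof (INR_fact_lt_0 n).
      replace (C0 * K ^ S n / INR (fact (S n))) with (K * (C0 * K ^ n / INR (fact n)) / INR (S n)).
      + apply Hlip; [apply Hit | apply Hit | | exact IH | exact Ht].
        apply Rmult_le_pos; [apply Rmult_le_pos; [lra | now apply pow_le]|].
        left; now apply Rinv_0_lt_compat.
      + rewrite fact_simpl, mult_INR. simpl pow. field.
        split; [lra|]. apply not_0_INR; lia. }
  (* Partial sums majorizing the iterates; they converge to [C0 * exp B], and their tails bound all
     distances below. *)
  set (s := fun n => C0 * sum_f_R0 (fun i => / INR (fact i) * B ^ i) n).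
  (* From index one on the iterates factor through [clamp], so estimates on [[a, b]] hold at every
     real point. *)
  set (g := fun n => it (S n)).
  assert (Hgs : forall n t, Rabs (g (S n) t - g n t) <= s (S n) - s n).
  { intros n t. unfold g.
    assert (Ecl : forall k, it (S k) t = it (S k) (clamp a b t)).
    { intros k; simpl. now rewrite (clamp_id a b (clamp a b t)) by (apply clamp_in; lra). }
    rewrite !Ecl. pose proof (clamp_in a b t ltac:(lra)) as Hc.
    apply Rle_trans with (1 := Hstep (S n) _ Hc).
    unfold s. rewrite tech5. pose proof (INR_fact_lt_0 (S n)).
    replace (C0 * (sum_f_R0 (fun i => / INR (fact i) * B ^ i) n + / INR (fact (S n)) * B ^ S n) -
      C0 * sum_f_R0 (fun i => / INR (fact i) * B ^ i) n) with
      (C0 * K ^ S n / INR (fact (S n)) * (b - a) ^ S n).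
    2:{ unfold B. rewrite Rpow_mult_distr. field; lra. }
    apply Rmult_le_compat_l.
    - apply Rmult_le_pos; [apply Rmult_le_pos; [lra | now apply pow_le]|].
      left; now apply Rinv_0_lt_compat.
    - apply pow_incr; lra. }
  assert (Hgs2 : forall n k t, Rabs (g (n + k)%nat t - g n t) <= s (n + k)%nat - s n).
  { intros n k t; induction k as [|k IH].
    - rewrite Nat.add_0_r, !Rminus_diag, Rabs_R0. lra.
    - rewrite Nat.add_succ_r. pose proof (Hgs (n + k)%nat t).
      replace (g (S (n + k)) t - g n t) with
        ((g (S (n + k)) t - g (n + k)%nat t) + (g (n + k)%nat t - g n t)) by ring.
      eapply Rle_trans; [apply Rabs_triang|]. lra. }
  set (sl := C0 * exp B).
  assert (Hs : Un_cv s sl).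
  { unfold s, sl. apply (CV_mult (fun _ => C0)).
    - intros e He; exists 0%nat; intros; unfold Rdist; rewrite Rminus_diag, Rabs_R0; exact He.
    - unfold exp. destruct (exist_exp B) as [x Hx]; simpl. exact Hx. }
  assert (Hsg : forall n, s n <= sl).
  { apply growing_ineq; [|exact Hs]. intros n. pose proof (Hgs n 0). 
    pose proof (Rabs_pos (g (S n) 0 - g n 0)). lra. }
  assert (Hlim : forall t, exists l, Un_cv (fun n => g n t) l).
  { intros t. destruct (Rcomplete.R_complete (fun n => g n t)) as [l Hl]; [|now exists l].
    intros e He. destruct (Hs (e / 2)) as [N HN]; [lra|]. exists N.
    assert (Hone : forall n, (n >= N)%nat -> Rabs (g n t - g N t) < e / 2).
    { intros n Hn. replace n with (N + (n - N))%nat by lia.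
      apply Rle_lt_trans with (1 := Hgs2 N _ t).
      specialize (HN N (Nat.le_refl N)). unfold Rdist in HN. apply Rabs_def2 in HN.
      pose proof (Hsg (N + (n - N))%nat). lra. }
    intros n p Hn Hp. unfold Rdist.
    replace (g n t - g p t) with ((g n t - g N t) - (g p t - g N t)) by ring.
    eapply Rle_lt_trans; [apply Rabs_triang|]. rewrite Rabs_Ropp.
    pose proof (Hone n Hn); pose proof (Hone p Hp). lra. }
  set (f := fun t => epsilon (inhabits 0) (fun l => Un_cv (fun n => g n t) l)).
  assert (Hf : forall t, Un_cv (fun n => g n t) (f t)).
  { intros t. apply (epsilon_spec (inhabits 0) (fun l => Un_cv (fun n => g n t) l)), Hlim. }
  assert (Hfg : forall n t, Rabs (f t - g n t) <= sl - s n).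
  { intros n t. apply Rnot_lt_le; intros L.
    destruct (Hf t (Rabs (f t - g n t) - (sl - s n))) as [N HN]; [lra|].
    specialize (HN (n + N)%nat ltac:(lia)). unfold Rdist in HN.
    pose proof (Hgs2 n N t). pose proof (Hsg (n + N)%nat).
    pose proof (Rabs_triang (f t - g (n + N)%nat t) (g (n + N)%nat t - g n t)) as T.
    replace (f t - g (n + N)%nat t + (g (n + N)%nat t - g n t)) with (f t - g n t) in T by ring.
    rewrite Rabs_minus_sym in HN. lra. }
  assert (Hr : forall e, 0 < e -> exists N, forall n, (n >= N)%nat -> sl - s n < e).
  { intros e He. destruct (Hs e He) as [N HN]. exists N; intros n Hn.
    specialize (HN n Hn). unfold Rdist in HN. apply Rabs_def2 in HN. lra. }
  assert (Hfc : forall t, continuity_pt f t).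
  { intros t e He. destruct (Hr (e / 3)) as [N HN]; [lra|].
    specialize (HN N (Nat.le_refl N)).
    destruct (Hit (S N) t (e / 3)) as [n [Hn H]]; [lra|].
    exists n; split; [exact Hn|]. intros u Hu. specialize (H u Hu).
    simpl in *. unfold Rdist in *. fold (it (S N)) in *.
    pose proof (Hfg N u) as H1. pose proof (Hfg N t) as H2.
    change (Rabs (g N u - g N t) < e / 3) in H.
    replace (f u - f t) with ((f u - g N u) + (g N u - g N t) - (f t - g N t)) by ring.
    eapply Rle_lt_trans; [apply Rabs_triang|]. rewrite Rabs_Ropp.
    pose proof (Rabs_triang (f u - g N u) (g N u - g N t)). lra. }
  exists f; split; [exact Hfc|]. intros t Ht.
  apply Rminus_diag_uniq. destruct (Req_dec (f t - Phi f t) 0) as [|Hne]; [assumption|].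
  exfalso. apply Rabs_pos_lt in Hne. set (e := Rabs (f t - Phi f t)) in *.
  (* With iterates within this [d] of [f], the defect [e] of [f] is at most [d + B * d = e / 2],
     which is absurd. *)
  destruct (Hr (e / (2 * (1 + B)))) as [N HN].
  { apply Rdiv_lt_0_compat; lra. }
  pose proof (HN N (Nat.le_refl N)) as H1. pose proof (HN (S N) ltac:(lia)) as H2.
  assert (Hde : e / (2 * (1 + B)) * (1 + B) = e / 2) by (field; lra).
  set (d := e / (2 * (1 + B))) in *.
  assert (Hd : 0 < d) by (unfold d; apply Rdiv_lt_0_compat; lra).
  pose proof (Hlip (g N) f d 0%nat (Hit (S N)) Hfc ltac:(lra)) as H3.
  specialize (H3 ltac:(intros u _; rewrite Rabs_minus_sym; simpl; pose proof (Hfg N u); lra) t Ht).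
  rewrite <- (HitS (S N)) in H3 by exact Ht. fold (g (S N)) in H3. simpl INR in H3. simpl pow in H3.
  pose proof (Hfg (S N) t) as H4.
  assert (K * d / 1 * ((t - a) * 1) <= B * d).
  { unfold B. assert (0 <= K * d) by (apply Rmult_le_pos; lra).
    replace (K * (b - a) * d) with (K * d * (b - a)) by ring.
    replace (K * d / 1 * ((t - a) * 1)) with (K * d * (t - a)) by field.
    apply Rmult_le_compat_l; lra. }
  pose proof (Rabs_triang (f t - g (S N) t) (g (S N) t - Phi f t)) as T.
  replace (f t - g (S N) t + (g (S N) t - Phi f t)) with (f t - Phi f t) in T by ring.
  fold e in T. nra.
Qed.

Definition prim_from (a c : R) (h : R -> R) (t : R) : R := c + RInt h a t.

Lemma prim_from_derive (a c : R) (h : R -> R) :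
  (forall t, continuity_pt h t) -> forall t, is_derive (prim_from a c h) t (h t).
Proof.
  intros Hh t.
  assert (Hc : forall s, continuous h s) by (intros s; apply continuity_pt_filterlim, Hh).
  unfold prim_from. replace (h t) with (plus 0 (h t)) by (unfold plus; simpl; ring).
  apply (is_derive_plus (fun _ => c) (fun t => RInt h a t)); [apply @is_derive_const|].
  apply is_derive_RInt with a; [|apply Hc].
  apply filter_forall; intros s. apply (RInt_correct (V := R_CompleteNormedModule)).
  apply (ex_RInt_continuous (V := R_CompleteNormedModule)). intros; apply Hc.
Qed.

Lemma prim_from_start (a c : R) (h : R -> R) : prim_from a c h a = c.
Proof. unfold prim_from. rewrite RInt_point. unfold zero; simpl; ring. Qed.

Lemma prim_from_cont (a c : R) (h : R -> R) :
  (forall t, continuity_pt h t) -> forall t, continuity_pt (prim_from a c h) t.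
Proof. intros Hh t. eapply is_derive_cont. now apply prim_from_derive. Qed.

Lemma prim_from_close (a b c C : R) (h h' : R -> R) (n : nat) :
  (forall t, continuity_pt h t) -> (forall t, continuity_pt h' t) ->
  (forall t, a <= t <= b -> Rabs (h t - h' t) <= C * (t - a) ^ n) ->
  forall t, a <= t <= b ->
    Rabs (prim_from a c h t - prim_from a c h' t) <= C / INR (S n) * (t - a) ^ S n.
Proof.
  intros Hh Hh' H t Ht.
  assert (Hn : INR (S n) <> 0) by (apply not_0_INR; lia).
  assert (Hpow : forall k s, is_derive (fun s => k / INR (S n) * (s - a) ^ S n) s (k * (s - a) ^ n)).
  { intros k s. auto_derive; [exact I|].
    replace (Nat.pred (S n)) with n by reflexivity. unfold Rminus. field. exact Hn. }
  assert (Hd : forall s, is_derive (fun s => prim_from a c h s - prim_from a c h' s) s (h s - h' s)).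
  { intros s. apply (is_derive_minus (prim_from a c h) (prim_from a c h')); now apply prim_from_derive. }
  assert (H0 : (a - a) ^ S n = 0) by (rewrite Rminus_diag; apply pow_i; lia).
  apply Rabs_le; split.
  - pose proof (nondecreasing (fun s => (prim_from a c h s - prim_from a c h' s)
      + C / INR (S n) * (s - a) ^ S n)
      (fun s => (h s - h' s) + C * (s - a) ^ n) a b) as M.
    specialize (M ltac:(intros s _;
      apply (is_derive_plus (fun s => prim_from a c h s - prim_from a c h' s)); [apply Hd | apply Hpow])).
    specialize (M ltac:(intros s Hs; specialize (H s Hs); apply Rabs_le_between in H; lra)).
    specialize (M a t ltac:(lra) ltac:(lra) ltac:(lra)). cbv beta in M.
    rewrite !prim_from_start, H0 in M. lra.
  - pose proof (nondecreasing (fun s => C / INR (S n) * (s - a) ^ S n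
      - (prim_from a c h s - prim_from a c h' s)) (fun s => C * (s - a) ^ n - (h s - h' s)) a b) as M.
    specialize (M ltac:(intros s _;
      apply (is_derive_minus (fun s => C / INR (S n) * (s - a) ^ S n)); [apply Hpow | apply Hd])).
    specialize (M ltac:(intros s Hs; specialize (H s Hs); apply Rabs_le_between in H; lra)).
    specialize (M a t ltac:(lra) ltac:(lra) ltac:(lra)). cbv beta in M.
    rewrite !prim_from_start, H0 in M. lra.
Qed.

Lemma prim_from_close_weak (a b c C : R) (h h' : R -> R) (n : nat) :
  0 <= C ->
  (forall t, continuity_pt h t) -> (forall t, continuity_pt h' t) ->
  (forall t, a <= t <= b -> Rabs (h t - h' t) <= C * (t - a) ^ n) ->
  forall t, a <= t <= b ->
    Rabs (prim_from a c h t - prim_from a c h' t) <= C * (b - a) * (t - a) ^ n.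
Proof.
  intros HC Hh Hh' H t Ht.
  apply Rle_trans with (1 := prim_from_close a b c C h h' n Hh Hh' H t Ht).
  simpl pow. assert (0 <= (t - a) ^ n) by (apply pow_le; lra).
  assert (1 <= INR (S n)) by (rewrite S_INR; pose proof (pos_INR n); lra).
  assert (Hinv : / INR (S n) <= 1) by (rewrite <- Rinv_1; apply Rinv_le_contravar; lra).
  assert (0 < / INR (S n)) by (apply Rinv_0_lt_compat; lra).
  unfold Rdiv. rewrite <- (Rmult_assoc _ (t - a)).
  apply Rmult_le_compat_r; [assumption|].
  rewrite Rmult_assoc. apply Rmult_le_compat_l; [exact HC|]. nra.
Qed.

Lemma mult_close (m : R -> R) (a b M C : R) (h h' : R -> R) (n : nat) :
  (forall t, a <= t <= b -> Rabs (m t) <= M) ->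
  (forall t, a <= t <= b -> Rabs (h t - h' t) <= C * (t - a) ^ n) ->
  forall t, a <= t <= b -> Rabs (m t * h t - m t * h' t) <= M * C * (t - a) ^ n.
Proof.
  intros Hm H t Ht. rewrite <- Rmult_minus_distr_l, Rabs_mult, Rmult_assoc.
  apply Rmult_le_compat; [apply Rabs_pos.. | now apply Hm | now apply H].
Qed.

Lemma cont_mult (f g : R -> R) : (forall t, continuity_pt f t) -> (forall t, continuity_pt g t) ->
  forall t, continuity_pt (fun t => f t * g t) t.
Proof. intros Hf Hg t. now apply continuity_pt_mult. Qed.

Lemma cont_scal (k : R) (f : R -> R) : (forall t, continuity_pt f t) ->
  forall t, continuity_pt (fun t => k * f t) t.
Proof. intros Hf t. now apply (continuity_pt_scal f). Qed.

(** Only [j0] is iterated; the other entries are recovered by nested integration. The gain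
    [1 / (n + 1)] is taken from the innermost integral, and the three outer ones are estimated by
    the length of the interval. *)
Lemma initial_value_problem (S : system) (lam c0 c1 c2 c3 : R) :
  exists x, hom S lam x (lo S) (hi S) /\ data x (lo S) c0 c1 c2 c3.
Proof.
  destruct (coeff_bound S) as [B [HB Hb]]. pose proof (lo_hi S) as Hab.
  set (a := lo S) in *. set (b := hi S) in *.
  set (X3 := fun u => prim_from a c3 (fun t => cq S t * (lam * u t))).
  set (X2 := fun u => prim_from a c2 (fun t => cg S t * X3 u t)).
  set (X1 := fun u => prim_from a c1 (fun t => cr S t * X2 u t)).
  set (X0 := fun u => prim_from a c0 (X1 u)).
  assert (C3 : forall u, (forall t, continuity_pt u t) -> forall t, continuity_pt (X3 u) t).
  { intros u Hu; apply prim_from_cont, cont_mult; [apply cq_cont | now apply cont_scal]. }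
  assert (C2 : forall u, (forall t, continuity_pt u t) -> forall t, continuity_pt (X2 u) t).
  { intros u Hu; apply prim_from_cont, cont_mult; [apply cg_cont | now apply C3]. }
  assert (C1 : forall u, (forall t, continuity_pt u t) -> forall t, continuity_pt (X1 u) t).
  { intros u Hu; apply prim_from_cont, cont_mult; [apply cr_cont | now apply C2]. }
  assert (C0 : forall u, (forall t, continuity_pt u t) -> forall t, continuity_pt (X0 u) t).
  { intros u Hu; apply prim_from_cont; now apply C1. }
  assert (Br : forall t, a <= t <= b -> Rabs (cr S t) <= B).
  { intros t Ht. rewrite Rabs_pos_eq; [apply (Hb t Ht) | left; apply cr_pos]. }
  assert (Bg : forall t, a <= t <= b -> Rabs (cg S t) <= B).
  { intros t Ht. rewrite Rabs_pos_eq; [apply (Hb t Ht) | left; apply cg_pos]. }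
  assert (Bq : forall t, a <= t <= b -> Rabs (cq S t) <= B).
  { intros t Ht. rewrite Rabs_pos_eq; [apply (Hb t Ht) | left; apply cq_pos]. }
  pose proof (Rabs_pos lam) as Hlam.
  destruct (volterra_fixed_point a b (B * (B * (B * Rabs lam) * (b - a)) * (b - a) * (b - a)) X0)
    as [u [Hu Hfix]].
  - exact Hab.
  - repeat (apply Rmult_le_pos; try lra).
  - exact C0.
  - intros f g C n Hf Hg HC H.
    assert (Hn : 0 < INR (Datatypes.S n)) by (apply lt_0_INR; lia).
    assert (HC' : 0 <= B * (Rabs lam * C) / INR (Datatypes.S n)).
    { apply Rmult_le_pos; [repeat (apply Rmult_le_pos; try lra) | left; now apply Rinv_0_lt_compat]. }
    assert (H3 : forall t, a <= t <= b -> Rabs (X3 f t - X3 g t)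
        <= B * (Rabs lam * C) / INR (Datatypes.S n) * (t - a) ^ Datatypes.S n).
    { apply prim_from_close.
      - apply cont_mult; [apply cq_cont | now apply cont_scal].
      - apply cont_mult; [apply cq_cont | now apply cont_scal].
      - apply mult_close; [exact Bq|].
        apply (mult_close (fun _ => lam)); [intros; lra | exact H]. }
    assert (H2 := prim_from_close_weak a b c2 _ _ _ _ (Rmult_le_pos B _ (Rlt_le _ _ HB) HC')
      (cont_mult _ _ (cg_cont S) (C3 f Hf)) (cont_mult _ _ (cg_cont S) (C3 g Hg))
      (mult_close _ a b B _ _ _ _ Bg H3)).
    fold (X2 f) in H2. fold (X2 g) in H2.
    match type of H2 with forall t, _ -> _ <= ?k * _ => assert (HC2 : 0 <= k) end.
    { apply Rmult_le_pos; [now apply Rmult_le_pos; [lra|] | lra]. }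
    assert (H1 := prim_from_close_weak a b c1 _ _ _ _ (Rmult_le_pos B _ (Rlt_le _ _ HB) HC2)
      (cont_mult _ _ (cr_cont S) (C2 f Hf)) (cont_mult _ _ (cr_cont S) (C2 g Hg))
      (mult_close _ a b B _ _ _ _ Br H2)).
    fold (X1 f) in H1. fold (X1 g) in H1.
    match type of H1 with forall t, _ -> _ <= ?k * _ => assert (HC1 : 0 <= k) end.
    { apply Rmult_le_pos; [now apply Rmult_le_pos; [lra|] | lra]. }
    assert (H0 := prim_from_close_weak a b c0 _ _ _ _ HC1 (C1 f Hf) (C1 g Hg) H1).
    fold (X0 f) in H0. fold (X0 g) in H0.
    intros t Ht. apply Rle_trans with (1 := H0 t Ht). right. field. lra.
  - exists (Jet (X0 u) (X1 u) (X2 u) (X3 u)). split.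
    + intros t Ht. simpl. rewrite <- Hfix by exact Ht.
      split; [apply prim_from_derive; now apply C1|].
      split; [apply (prim_from_derive a c1 (fun t => cr S t * X2 u t));
        apply cont_mult; [apply cr_cont | now apply C2]|].
      split; [apply (prim_from_derive a c2 (fun t => cg S t * X3 u t));
        apply cont_mult; [apply cg_cont | now apply C3]|].
      apply (prim_from_derive a c3 (fun t => cq S t * (lam * u t))).
      apply cont_mult; [apply cq_cont | now apply cont_scal].
    + unfold data; simpl. repeat split; apply prim_from_start.
Qed.

Definition fundamental (S : system) (c0 c1 c2 c3 lam : R) : jet :=
  epsilon (inhabits (Jet id id id id))
    (fun x => hom S lam x (lo S) (hi S) /\ data x (lo S) c0 c1 c2 c3).

Lemma fundamental_spec (S : system) (c0 c1 c2 c3 lam : R) :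
  hom S lam (fundamental S c0 c1 c2 c3 lam) (lo S) (hi S) /\
  data (fundamental S c0 c1 c2 c3 lam) (lo S) c0 c1 c2 c3.
Proof.
  apply (epsilon_spec (inhabits (Jet id id id id))
    (fun x => hom S lam x (lo S) (hi S) /\ data x (lo S) c0 c1 c2 c3)), initial_value_problem.
Qed.

(* Normalized solutions, indexed by the only nonzero entry of the jet at [lo]. *)
Definition sol1 (S : system) := fundamental S 0 1 0 0.
Definition sol3 (S : system) := fundamental S 0 0 0 1.

Lemma sol1_spec (S : system) (lam : R) :
  hom S lam (sol1 S lam) (lo S) (hi S) /\ data (sol1 S lam) (lo S) 0 1 0 0.
Proof. apply fundamental_spec. Qed.

Lemma sol3_spec (S : system) (lam : R) :
  hom S lam (sol3 S lam) (lo S) (hi S) /\ data (sol3 S lam) (lo S) 0 0 0 1.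
Proof. apply fundamental_spec. Qed.

(** The unknown of the fixed point equation is the second derivative: [y'] and [y] are its integrals
    and thus differentiable on the whole line, although the equation is asserted on [[a, b]]
    only. *)
Lemma second_order_ivp (a b : R) (p1 p2 : R -> R) (c0 c1 : R) :
  a < b -> (forall t, continuity_pt p1 t) -> (forall t, continuity_pt p2 t) ->
  exists y y' y'', (forall t, is_derive y t (y' t)) /\ (forall t, is_derive y' t (y'' t)) /\
    (forall t, continuity_pt y'' t) /\
    (forall t, a <= t <= b -> y'' t + p1 t * y' t + p2 t * y t = 0) /\
    y a = c0 /\ y' a = c1.
Proof.
  intros Hab H1 H2.
  assert (Hmax : forall p, (forall t, continuity_pt p t) -> exists M, 0 <= M /\
    forall t, a <= t <= b -> Rabs (p t) <= M).
  { intros p Hp. destruct (continuity_ab_maj (fun t => Rabs (p t)) a b) as [m [Hm _]]; [lra | |].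
    - intros t _. apply (continuity_pt_comp p Rabs); [apply Hp | apply Rcontinuity_abs].
    - exists (Rabs (p m)); split; [apply Rabs_pos | exact Hm]. }
  destruct (Hmax p1 H1) as [B1 [HB1 Hb1]]. destruct (Hmax p2 H2) as [B2 [HB2 Hb2]].
  set (Y1 := fun f => prim_from a c1 f). set (Y0 := fun f => prim_from a c0 (Y1 f)).
  assert (C1 : forall f, (forall t, continuity_pt f t) -> forall t, continuity_pt (Y1 f) t).
  { intros f Hf; now apply prim_from_cont. }
  assert (C0 : forall f, (forall t, continuity_pt f t) -> forall t, continuity_pt (Y0 f) t).
  { intros f Hf; now apply prim_from_cont, C1. }
  destruct (volterra_fixed_point a b (B1 + B2 * (b - a))
    (fun f t => (-1) * (p1 t * Y1 f t + p2 t * Y0 f t))) as [f [Hf Hfix]].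
  - exact Hab.
  - assert (0 <= B2 * (b - a)) by (apply Rmult_le_pos; lra). lra.
  - intros f Hf. apply cont_scal. intros t. apply continuity_pt_plus; apply cont_mult; auto.
  - intros f g C n Hf Hg HC H t Ht.
    assert (Hn : 0 < INR (S n)) by (apply lt_0_INR; lia).
    assert (HC' : 0 <= C / INR (S n)).
    { apply Rmult_le_pos; [lra | left; now apply Rinv_0_lt_compat]. }
    assert (D1 := prim_from_close a b c1 C f g n Hf Hg H). fold (Y1 f) in D1. fold (Y1 g) in D1.
    assert (D0 := prim_from_close_weak a b c0 _ _ _ _ HC' (C1 f Hf) (C1 g Hg) D1).
    fold (Y0 f) in D0. fold (Y0 g) in D0.
    assert (E1 := mult_close p1 a b B1 _ _ _ _ Hb1 D1 t Ht).
    assert (E0 := mult_close p2 a b B2 _ _ _ _ Hb2 D0 t Ht).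
    replace (-1 * (p1 t * Y1 f t + p2 t * Y0 f t) - -1 * (p1 t * Y1 g t + p2 t * Y0 g t))
      with (- ((p1 t * Y1 f t - p1 t * Y1 g t) + (p2 t * Y0 f t - p2 t * Y0 g t))) by ring.
    rewrite Rabs_Ropp. eapply Rle_trans; [apply Rabs_triang|].
    replace ((B1 + B2 * (b - a)) * C / INR (S n) * (t - a) ^ S n) with
      (B1 * (C / INR (S n)) * (t - a) ^ S n + B2 * (C / INR (S n) * (b - a)) * (t - a) ^ S n)
      by (field; lra). lra.
  - exists (Y0 f), (Y1 f), f. split; [|split; [|split; [|split; [|split]]]].
    + now apply prim_from_derive, C1.
    + now apply prim_from_derive.
    + exact Hf.
    + intros t Ht. rewrite (Hfix t Ht) at 1. ring.
    + apply prim_from_start.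
    + apply prim_from_start.
Qed.

(** * Solutions with a triple zero *)

Lemma derive_zero (F : R -> R) (c d t l : R) :
  c < d -> c <= t <= d -> (forall s, c <= s <= d -> F s = 0) -> is_derive F t l -> l = 0.
Proof.
  intros Hcd Ht HF Hl. apply NNPP; intros Hne.
  assert (He : 0 < Rabs l) by now apply Rabs_pos_lt.
  apply is_derive_Reals in Hl. destruct (Hl (Rabs l) He) as [[n Hn] H]. simpl in H.
  assert (Hex : exists h, h <> 0 /\ Rabs h < n /\ c <= t + h <= d).
  { destruct (Rlt_dec t d) as [L|L].
    - exists (Rmin (n / 2) (d - t)).
      assert (0 < Rmin (n / 2) (d - t)) by (apply Rmin_glb_lt; lra).
      pose proof (Rmin_l (n / 2) (d - t)); pose proof (Rmin_r (n / 2) (d - t)).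
      rewrite Rabs_pos_eq; lra.
    - exists (- Rmin (n / 2) (d - c)).
      assert (0 < Rmin (n / 2) (d - c)) by (apply Rmin_glb_lt; lra).
      pose proof (Rmin_l (n / 2) (d - c)); pose proof (Rmin_r (n / 2) (d - c)).
      rewrite Rabs_Ropp, Rabs_pos_eq; lra. }
  destruct Hex as [h [Hh [Hhn Hin]]]. specialize (H h Hh Hhn).
  rewrite (HF (t + h) Hin), (HF t Ht), Rminus_diag in H.
  replace (0 / h - l) with (- l) in H by (field; exact Hh).
  rewrite Rabs_Ropp in H. lra.
Qed.

Lemma j1_zero (S : system) (x : jet) (f : R -> R) (c d : R) :
  c < d -> solves S x f c d -> (forall t, c <= t <= d -> j1 x t = 0) ->
  forall t, c <= t <= d -> j2 x t = 0 /\ j3 x t = 0 /\ f t = 0.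
Proof.
  intros Hcd Hx H1.
  assert (Z : forall (F : R -> R) k l t, c <= t <= d -> 0 < k ->
    (forall s, c <= s <= d -> F s = 0) -> is_derive F t (k * l) -> l = 0).
  { intros F k l t Ht Hk HF Hd. pose proof (derive_zero F c d t _ Hcd Ht HF Hd) as E.
    destruct (Rmult_integral _ _ E); lra. }
  assert (H2 : forall t, c <= t <= d -> j2 x t = 0).
  { intros t Ht. apply (Z (j1 x) (cr S t) _ t Ht (cr_pos S t) H1), (Hx t Ht). }
  assert (H3 : forall t, c <= t <= d -> j3 x t = 0).
  { intros t Ht. apply (Z (j2 x) (cg S t) _ t Ht (cg_pos S t) H2), (Hx t Ht). }
  intros t Ht. repeat split; auto.
  apply (Z (j3 x) (cq S t) _ t Ht (cq_pos S t) H3), (Hx t Ht).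
Qed.

Lemma jet_zero (S : system) (x : jet) (f : R -> R) (c d : R) :
  c < d -> solves S x f c d -> (forall t, c <= t <= d -> j0 x t = 0) ->
  forall t, c <= t <= d -> j1 x t = 0 /\ j2 x t = 0 /\ j3 x t = 0 /\ f t = 0.
Proof.
  intros Hcd Hx H0.
  assert (H1 : forall t, c <= t <= d -> j1 x t = 0).
  { intros t Ht. apply (derive_zero (j0 x) c d t); auto. apply (Hx t Ht). }
  intros t Ht. split; [now apply H1 | now apply (j1_zero S x f c d)].
Qed.

Lemma jet_nonzero (S : system) (x : jet) (f : R -> R) (c d t : R) :
  c < d -> solves S x f c d -> c <= t <= d -> j1 x t <> 0 \/ j3 x t <> 0 ->
  exists s, c <= s <= d /\ j0 x s <> 0.
Proof.
  intros Hcd Hx Ht Hne. apply NNPP; intros N.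
  destruct (jet_zero S x f c d Hcd Hx) with (t := t) as [Z1 [_ [Z3 _]]]; [|exact Ht|tauto].
  intros s Hs. apply NNPP; intros N'. apply N. exists s; split; assumption.
Qed.

(** A maximum principle. If [j2] were positive at [t], the mean value theorem would give a point
    before [t] with [j3 > 0]; as [j3] is nondecreasing, [j2] would keep growing up to [d], against
    its sign there. *)
Lemma j2_nonpos (S : system) (x : jet) (f : R -> R) (c d : R) :
  solves S x f c d -> (forall t, c <= t <= d -> 0 <= f t) ->
  j2 x c <= 0 -> j2 x d <= 0 -> forall t, c <= t <= d -> j2 x t <= 0.
Proof.
  intros Hx Hf Hc Hd t Ht. apply Rnot_lt_le; intros L.
  assert (c < t) by (destruct (Req_dec c t) as [E|]; [rewrite E in Hc|]; lra).
  destruct (j2_mean S x f c t) as [s [Hs E]]; [restrict Hx | lra|].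
  pose proof (cg_pos S s).
  assert (H3 : 0 < j3 x s).
  { apply Rnot_le_lt; intros L'.
    assert (cg S s * j3 x s <= 0) by nra. nra. }
  assert (j2 x t <= j2 x d); [|lra].
  apply (j2_incr S x f s d); [restrict Hx | | lra..].
  intros u Hu. apply Rle_trans with (j3 x s); [lra|].
  apply (j3_incr S x f c d Hx Hf); lra.
Qed.

Lemma j0_nonneg (S : system) (x : jet) (f : R -> R) (c d : R) :
  solves S x f c d -> (forall t, c <= t <= d -> 0 <= f t) ->
  0 <= j0 x c -> 0 <= j1 x c -> 0 <= j2 x c -> 0 <= j3 x c ->
  forall t, c <= t <= d -> 0 <= j0 x t.
Proof.
  intros Hx Hf H0 H1 H2 H3.
  assert (K3 : forall t, c <= t <= d -> 0 <= j3 x t).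
  { intros t Ht. apply Rle_trans with (1 := H3). apply (j3_incr S x f c d Hx Hf); lra. }
  assert (K2 : forall t, c <= t <= d -> 0 <= j2 x t).
  { intros t Ht. apply Rle_trans with (1 := H2). apply (j2_incr S x f c d Hx K3); lra. }
  assert (K1 : forall t, c <= t <= d -> 0 <= j1 x t).
  { intros t Ht. apply Rle_trans with (1 := H1). apply (j1_incr S x f c d Hx K2); lra. }
  intros t Ht. apply Rle_trans with (1 := H0). apply (j0_incr S x f c d Hx K1); lra.
Qed.

Lemma cubic_start_pos (S : system) (x : jet) (f : R -> R) (c d : R) :
  solves S x f c d -> j0 x c = 0 -> j1 x c = 0 -> j2 x c = 0 ->
  (forall t, c <= t <= d -> 0 < j3 x t) ->
  forall t, c < t <= d -> 0 < j0 x t /\ 0 < j1 x t /\ 0 < j2 x t.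
Proof.
  intros Hx D0 D1 D2 K3.
  assert (K2 : forall s, c < s <= d -> 0 < j2 x s).
  { apply (positive_after_zero _ (fun u => cg S u * j3 x u)); [|exact D2|].
    - intros u Hu; apply (Hx u Hu).
    - intros u Hu; apply Rmult_lt_0_compat; [apply cg_pos | apply K3; lra]. }
  assert (K1 : forall s, c < s <= d -> 0 < j1 x s).
  { apply (positive_after_zero _ (fun u => cr S u * j2 x u)); [|exact D1|].
    - intros u Hu; apply (Hx u Hu).
    - intros u Hu; apply Rmult_lt_0_compat; [apply cr_pos | apply K2; lra]. }
  intros s Hs. repeat split; auto. revert s Hs.
  apply (positive_after_zero _ (j1 x)); [|exact D0|].
  - intros u Hu; apply (Hx u Hu).
  - intros u Hu; apply K1; lra.
Qed.

(** Passage to the limit [h -> 0]; it turns the failure of domination for every smaller multiplier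
    into information on the limiting difference. *)
Lemma small_multiple (p q : R) : (forall h, 0 < h -> ~ 0 < p + h * q) -> p <= 0.
Proof.
  intros H. apply Rnot_lt_le; intros L. pose proof (Rabs_pos q).
  apply (H (p / (2 * (Rabs q + 1)))).
  - apply Rdiv_lt_0_compat; lra.
  - assert (E : p / (2 * (Rabs q + 1)) * (Rabs q + 1) = p / 2) by (field; lra).
    assert (0 < p / (2 * (Rabs q + 1))) by (apply Rdiv_lt_0_compat; lra).
    pose proof (Rle_abs (- q)). rewrite Rabs_Ropp in *. nra.
Qed.

Lemma nonpos_jopp (S : system) (x : jet) (f : R -> R) (c d : R) :
  solves S x f c d -> (forall t, c <= t <= d -> j0 x t <= 0) ->
  solves S (jopp x) (fun t => - f t) c d /\ (forall t, c <= t <= d -> 0 <= j0 (jopp x) t).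
Proof.
  intros Hx H; split; [now apply jopp_solves|].
  intros t Ht; specialize (H t Ht); simpl; lra.
Qed.

Lemma interior_zero_nonpos (S : system) (x : jet) (f : R -> R) (c d t : R) :
  solves S x f c d -> (forall t, c <= t <= d -> j0 x t <= 0) ->
  c < t < d -> j0 x t = 0 -> j1 x t = 0 /\ j2 x t <= 0.
Proof.
  intros Hx H Ht E. destruct (nonpos_jopp S x f c d Hx H) as [Hx' H'].
  destruct (interior_zero S (jopp x) _ c d t Hx' H' Ht) as [E1 E2]; simpl in *; lra.
Qed.

Lemma left_zero_nonpos (S : system) (x : jet) (f : R -> R) (c d t : R) :
  solves S x f c d -> (forall t, c <= t <= d -> j0 x t <= 0) ->
  c <= t < d -> j0 x t = 0 -> j1 x t <= 0 /\ (j1 x t = 0 -> j2 x t <= 0 /\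
   (j2 x t = 0 -> j3 x t <= 0)).
Proof.
  intros Hx H Ht E. destruct (nonpos_jopp S x f c d Hx H) as [Hx' H'].
  pose proof (not_lexneg S (jopp x) _ c d t Hx' H' Ht) as N.
  unfold lexneg in N; simpl in N.
  split; [|intros E1; split; [|intros E2]]; apply Rnot_lt_le; intros L; apply N.
  - right; split; [lra | left; lra].
  - right; split; [lra | right; split; [lra | left; lra]].
  - right; split; [lra | right; split; [lra | right; split; lra]].
Qed.

Lemma right_zero_nonpos (S : system) (x : jet) (f : R -> R) (c d t : R) :
  solves S x f c d -> (forall t, c <= t <= d -> j0 x t <= 0) ->
  c < t <= d -> j0 x t = 0 -> 0 <= j1 x t /\ (j1 x t = 0 -> j2 x t <= 0 /\
   (j2 x t = 0 -> 0 <= j3 x t)).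
Proof.
  intros Hx H Ht E. destruct (nonpos_jopp S x f c d Hx H) as [Hx' H'].
  pose proof (not_lexneg_left S (jopp x) _ c d t Hx' H' Ht) as N.
  unfold lexneg_left in N; simpl in N.
  split; [|intros E1; split; [|intros E2]]; apply Rnot_lt_le; intros L; apply N.
  - right; split; [lra | left; lra].
  - right; split; [lra | right; split; [lra | left; lra]].
  - right; split; [lra | right; split; [lra | right; split; lra]].
Qed.

(** For each [h] the jet of [x - (k - h) y] at [c] is not [lexneg]. Where [y] vanishes, the value
    does not depend on [h], so the limit [h -> 0] concerns the slope; combined with the sign of the
    difference it makes the zero double. *)
Lemma contact_left (S : system) (x y : jet) (f : R -> R) (c d k : R) :
  c < d -> solves S (jlin 1 x (- k) y) f c d ->
  (forall t, c <= t <= d -> j0 (jlin 1 x (- k) y) t <= 0) ->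
  (forall h, 0 < h -> ~ lexneg (jlin 1 x (h - k) y) c) ->
  j0 (jlin 1 x (- k) y) c = 0 /\
  (j0 y c = 0 -> j1 (jlin 1 x (- k) y) c = 0 /\ j2 (jlin 1 x (- k) y) c <= 0).
Proof.
  intros Hcd HD Hneg Hc.
  assert (E : j0 (jlin 1 x (- k) y) c = 0).
  { apply Rle_antisym; [apply Hneg; lra|].
    assert (- j0 (jlin 1 x (- k) y) c <= 0); [|lra].
    apply small_multiple with (- j0 y c). intros h Hh L. apply (Hc h Hh).
    left; simpl in *; lra. }
  split; [exact E|]. intros Ey.
  destruct (left_zero_nonpos S _ f c d c HD Hneg ltac:(lra) E) as [N1 N2].
  assert (E1 : j1 (jlin 1 x (- k) y) c = 0).
  { apply Rle_antisym; [exact N1|].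
    assert (- j1 (jlin 1 x (- k) y) c <= 0); [|lra].
    apply small_multiple with (- j1 y c). intros h Hh L. apply (Hc h Hh).
    right; split; [simpl in *; rewrite Ey in *; lra | left; simpl in *; lra]. }
  split; [exact E1 | now apply N2].
Qed.

Lemma contact_right (S : system) (x y : jet) (f : R -> R) (c d k : R) :
  c < d -> solves S (jlin 1 x (- k) y) f c d ->
  (forall t, c <= t <= d -> j0 (jlin 1 x (- k) y) t <= 0) ->
  (forall h, 0 < h -> ~ lexneg_left (jlin 1 x (h - k) y) d) ->
  j0 (jlin 1 x (- k) y) d = 0 /\
  (j0 y d = 0 -> j1 (jlin 1 x (- k) y) d = 0 /\ j2 (jlin 1 x (- k) y) d <= 0).
Proof.
  intros Hcd HD Hneg Hc.
  assert (E : j0 (jlin 1 x (- k) y) d = 0).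
  { apply Rle_antisym; [apply Hneg; lra|].
    assert (- j0 (jlin 1 x (- k) y) d <= 0); [|lra].
    apply small_multiple with (- j0 y d). intros h Hh L. apply (Hc h Hh).
    left; simpl in *; lra. }
  split; [exact E|]. intros Ey.
  destruct (right_zero_nonpos S _ f c d d HD Hneg ltac:(lra) E) as [N1 N2].
  assert (E1 : j1 (jlin 1 x (- k) y) d = 0).
  { apply Rle_antisym; [|exact N1].
    apply small_multiple with (j1 y d). intros h Hh L. apply (Hc h Hh).
    right; split; [simpl in *; rewrite Ey in *; lra | left; simpl in *; lra]. }
  split; [exact E1 | now apply N2].
Qed.

(** As [cr] is positive, [j2] vanishes exactly where [u''] does: these are the boundary conditions
    of [X]. *)
Definition hinged (S : system) (x : jet) : Prop :=
  j0 x (lo S) = 0 /\ j2 x (lo S) = 0 /\ j0 x (hi S) = 0 /\ j2 x (hi S) = 0.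

(** The parameter is [- M] because [hom S lam] encodes [T[0]u = lam u] and here [T[M]u = 0]. The
    vanishing alternative at [hi] occurs when [- M] is an eigenvalue in [X3]. *)
Definition positive_cubic (S : system) (M : R) (A : jet) : Prop :=
  hom S (- M) A (lo S) (hi S) /\ data A (lo S) 0 0 0 1 /\
  (forall t, lo S < t < hi S -> 0 < j0 A t) /\
  (0 < j0 A (hi S) \/ j0 A (hi S) = 0 /\ j1 A (hi S) < 0).

Lemma positive_cubic_exists (S : system) (M : R) : 0 < M ->
  (forall m x, 0 < m < M -> hom S (- m) x (lo S) (hi S) -> data x (lo S) 0 0 0 1 ->
     j0 x (hi S) <> 0) ->
  exists A, positive_cubic S M A.
Proof.
  intros HM Heig. pose proof (lo_hi S) as Hab.
  set (A := fun m => sol3 S (- m)).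
  assert (HA : forall m, hom S (- m) (A m) (lo S) (hi S) /\ data (A m) (lo S) 0 0 0 1)
    by (intros m; apply sol3_spec).
  destruct (parameter_bound S M 0 0 0 1 ltac:(lra)) as [C [HC [Hbd Hlip]]].
  destruct (coeff_bound S) as [B [HB Hb]].
  assert (Habs : forall m, 0 <= m <= M -> Rabs (- m) <= M).
  { intros m Hm. rewrite Rabs_Ropp, Rabs_pos_eq; lra. }
  (* No second contact with zero: [j2] is concave and vanishes at [lo]. *)
  assert (Hnot : forall m t, 0 <= m <= M -> lo S < t <= hi S ->
    (forall s, lo S <= s <= t -> 0 <= j0 (A m) s) -> j0 (A m) t = 0 -> j1 (A m) t <> 0).
  { intros m t Hm Ht Hpos E0 E1. destruct (HA m) as [Hh [D0 [D1 [D2 D3]]]].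
    assert (Hsub : solves S (A m) (fun s => - m * j0 (A m) s) (lo S) t).
    { restrict Hh. }
    assert (J2 : 0 <= j2 (A m) t).
    { apply Rnot_lt_le; intros L.
      apply (not_lexneg_left S _ _ (lo S) t t Hsub Hpos ltac:(lra)).
      right; split; [exact E0 | right; split; [exact E1 | now left]]. }
    pose proof (jopp_solves _ _ _ _ _ Hsub) as Hop.
    assert (K2 : forall s, lo S <= s <= t -> 0 <= j2 (A m) s).
    { intros s Hs. pose proof (j2_nonpos S _ _ (lo S) t Hop) as K. simpl in K.
      assert (-1 * j2 (A m) s + 0 * j2 (A m) s <= 0); [|lra].
      apply K; [| lra | lra | exact Hs].
      intros u Hu; specialize (Hpos u Hu). nra. }
    assert (K1 : forall s, lo S <= s <= t -> j1 (A m) s = 0).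
    { intros s Hs. pose proof (j1_incr S _ _ (lo S) t Hsub K2) as K.
      pose proof (K (lo S) s ltac:(lra) ltac:(lra) ltac:(lra)).
      pose proof (K s t ltac:(lra) ltac:(lra) ltac:(lra)). lra. }
    destruct (j1_zero S _ _ (lo S) t ltac:(lra) Hsub K1 (lo S) ltac:(lra)) as [_ [K3 _]]. lra. }
  assert (Hint : forall m t, 0 <= m <= M -> (forall s, lo S < s <= hi S -> 0 <= j0 (A m) s) ->
     lo S < t < hi S -> j0 (A m) t <> 0).
  { intros m t Hm Hpos Ht E0. destruct (HA m) as [Hh [D0 _]].
    assert (Hpos' : forall s, lo S <= s <= hi S -> 0 <= j0 (A m) s).
    { intros s Hs. destruct (Req_dec s (lo S)) as [->|]; [lra | apply Hpos; lra]. }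
    destruct (interior_zero S _ _ (lo S) (hi S) t Hh Hpos' Ht E0) as [E1 _].
    apply (Hnot m t Hm); [lra | | exact E0 | exact E1]. intros s Hs; apply Hpos'; lra. }
  (* The entry [j3] starts at 1 and its derivative is bounded by [B * (M * C)]; on an interval of
     length [n] it keeps at least half its value, uniformly in [m]. *)
  assert (HBMC : 0 < B * (M * C)) by (repeat apply Rmult_lt_0_compat; lra).
  destruct (small_factor _ HBMC) as [n [Hn Hn2]].
  assert (Hnear : forall m t, 0 <= m <= M -> lo S < t < lo S + n -> t <= hi S -> 0 < j0 (A m) t).
  { intros m t Hm Ht Htd. destruct (HA m) as [Hh [D0 [D1 [D2 D3]]]].
    assert (K3 : forall s, lo S <= s <= t -> 0 < j3 (A m) s).
    { intros s Hs. destruct (Req_dec s (lo S)) as [->|Ns]; [lra|].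
      destruct (mean_value (j3 (A m)) (fun s => cq S s * (- m * j0 (A m) s)) (lo S) s) as [u [Hu E]];
        [lra | intros u Hu; apply (Hh u); lra|].
      destruct (Hbd (- m) (A m) (Habs m Hm) Hh (conj D0 (conj D1 (conj D2 D3))) u ltac:(lra)) as [Hu0 _].
      destruct (Hb u ltac:(lra)) as [_ [_ Hq]]. pose proof (cq_pos S u).
      assert (Rabs (cq S u * (- m * j0 (A m) u)) <= B * (M * C)).
      { rewrite !Rabs_mult. rewrite (Rabs_pos_eq (cq S u)) by lra.
        apply Rmult_le_compat; [lra | | exact Hq |].
        - apply Rmult_le_pos; apply Rabs_pos.
        - apply Rmult_le_compat; [apply Rabs_pos.. | now apply Habs | exact Hu0]. }
      apply Rabs_le_between in H0.
      assert (B * (M * C) * (s - lo S) <= B * (M * C) * n) by (apply Rmult_le_compat_l; lra).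
      nra. }
    assert (Hsub : solves S (A m) (fun s => - m * j0 (A m) s) (lo S) t).
    { restrict Hh. }
    apply (cubic_start_pos S _ _ (lo S) t Hsub D0 D1 D2 K3). lra. }
  assert (Hzero : forall t, lo S < t <= hi S -> 0 < j0 (A 0) t).
  { destruct (HA 0) as [Hh [D0 [D1 [D2 D3]]]].
    assert (H3 : forall s, lo S <= s <= hi S -> 0 <= 0 * j0 (A 0) s) by (intros; lra).
    assert (Hh' : solves S (A 0) (fun s => 0 * j0 (A 0) s) (lo S) (hi S)).
    { apply solves_ext with (1 := Hh); intros; ring. }
    assert (K3 : forall s, lo S <= s <= hi S -> 0 < j3 (A 0) s).
    { intros s Hs. pose proof (j3_incr S _ _ _ _ Hh' H3 (lo S) s); lra. }
    intros t Ht. now apply (cubic_start_pos S _ _ (lo S) (hi S) Hh D0 D1 D2 K3). }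
  assert (Hpos : forall t, lo S < t < hi S -> 0 < j0 (A M) t).
  { apply (positivity_continuation (fun m => j0 (A m)) (lo S) (hi S) M n C); auto; try lra.
    - intros l m t Hl Hm Ht.
      destruct (HA l) as [Hhl Dl], (HA m) as [Hhm Dm].
      destruct (Hlip (- l) (- m) _ _ (Habs l Hl) (Habs m Hm) Hhl Hhm Dl Dm t Ht) as [H _].
      now replace (Rabs (l - m)) with (Rabs (- l - - m)) by (rewrite Rabs_minus_sym; f_equal; ring).
    - intros l t Hl Ht. destruct (HA l) as [Hh _]. apply (solves_cont S _ _ _ _ Hh t Ht).
    - intros l Hl E. destruct (Req_dec l 0) as [->|Nl].
      + specialize (Hzero (hi S)). lra.
      + apply (Heig l (A l)); [lra | apply HA | apply HA | exact E]. }
  exists (A M). destruct (HA M) as [Hh D]. split; [exact Hh|]. split; [exact D|].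
  split; [exact Hpos|].
  assert (Hpos' : forall s, lo S <= s <= hi S -> 0 <= j0 (A M) s).
  { intros s Hs. destruct (Req_dec s (lo S)) as [->|N1]; [destruct D; lra|].
    destruct (Req_dec s (hi S)) as [->|N2]; [|left; apply Hpos; lra].
    apply Rnot_lt_le; intros L.
    destruct (neg_nbhd (j0 (A M)) (hi S)) as [e [He K]]; [|exact L|].
    - apply (solves_cont S _ _ _ _ Hh); lra.
    - set (u := Rmax ((lo S + hi S) / 2) (hi S - e / 2)).
      assert ((lo S + hi S) / 2 <= u) by apply Rmax_l.
      assert (hi S - e / 2 <= u) by apply Rmax_r.
      assert (u < hi S) by (apply Rmax_lub_lt; lra).
      specialize (K u ltac:(apply Rabs_def1; lra)). specialize (Hpos u ltac:(lra)). lra. }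
  destruct (Hpos' (hi S) ltac:(lra)) as [L|E]; [now left | right].
  split; [now symmetry|].
  destruct (Rtotal_order (j1 (A M) (hi S)) 0) as [L|[L|L]]; [exact L | exfalso..].
  - apply (Hnot M (hi S)); auto; lra.
  - apply (not_lexneg_left S _ _ (lo S) (hi S) (hi S) Hh Hpos' ltac:(lra)).
    right; split; [now symmetry | now left].
Qed.

(** * Strong inverse positivity of [T[M]] for a constant [M] *)

(** Knaster-Tarski on the line: the supremum of the [k] with [k <= F k] is fixed, so monotonicity
    takes the place of continuity. *)
Lemma monotone_fixed_point (F : R -> R) (K : R) :
  0 <= F 0 -> (forall k l, k <= l -> F k <= F l) -> (forall k, F k <= K) ->
  exists k, F k = k.
Proof.
  intros H0 Hmon HK.
  set (E := fun k => k <= F k).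
  destruct (completeness E) as [m [Hub Hlub]].
  - exists K. intros k Hk. apply Rle_trans with (1 := Hk), HK.
  - exists 0. exact H0.
  - assert (Em : m <= F m).
    { apply Hlub. intros k Hk. apply Rle_trans with (1 := Hk), Hmon, Hub, Hk. }
    exists m. apply Rle_antisym; [|exact Em]. apply Hub. unfold E. now apply Hmon.
Qed.

(* Right-hand side of [T[0]u = lam u + h]. *)
Definition source (lam : R) (x : jet) (h : R -> R) (t : R) : R := lam * j0 x t + h t.

Lemma solves_sub_multiple (S : system) (lam k c d : R) (x y : jet) (h : R -> R) :
  solves S x (source lam x h) c d -> hom S lam y c d ->
  solves S (jlin 1 x (- k) y) (source lam (jlin 1 x (- k) y) h) c d.
Proof.
  intros Hx Hy. apply solves_ext with (1 := solves_lin S 1 (- k) x y _ _ c d Hx Hy).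
  intros t _; unfold source; simpl; ring.
Qed.

(** If the slope were nonpositive, [x] could be touched by a multiple of [A], and the difference [D]
    would satisfy [T[0]D >= 0]. Each kind of contact then makes the jet of [D] at [lo] nonnegative
    or [D] nonincreasing towards zero, hence [D = 0] and [h = 0]. *)
Lemma slope_pos_lo (S : system) (M : R) (A x : jet) (h : R -> R) :
  0 <= M -> positive_cubic S M A ->
  solves S x (source (- M) x h) (lo S) (hi S) ->
  hinged S x ->
  (forall t, lo S <= t <= hi S -> 0 <= h t) ->
  (exists t, lo S <= t <= hi S /\ h t <> 0) ->
  0 < j1 x (lo S).
Proof.
  intros HM [HA [[A0 [A1 [A2 A3]]] [Apos Aend]]] Hx [X0 [X2 [Xb X2b]]] Hh [th [Hth Hne]].
  pose proof (lo_hi S) as Hab.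
  apply Rnot_le_lt; intros Hle.
  destruct (touching S x A _ _ (lo S) (hi S) Hab Hx HA) as [k [Dneg [_ K3]]].
  - apply nonneg_closed; [exact Apos | lra | destruct Aend; lra].
  - exact Apos.
  (* When the slope is zero, the last entries decide: subtracting this multiple leaves [-1]. *)
  - right. exists (j3 x (lo S) + 1). right; simpl. split; [rewrite X0, A0; lra|].
    rewrite A1, A2, A3, X2. destruct Hle as [L|E].
    + left; lra.
    + right; split; [lra | right; split; lra].
  - destruct Aend as [L|[E L]]; [now left | right]. now apply dominated_left.
  - pose proof (solves_sub_multiple S (- M) k _ _ x A h Hx HA) as HD.
    set (D := jlin 1 x (- k) A) in *.
    assert (Df : forall t, lo S <= t <= hi S -> 0 <= source (- M) D h t).
    { intros t Ht. specialize (Dneg t Ht). specialize (Hh t Ht). unfold source. nra. }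
    assert (Dlo : j0 D (lo S) = 0 /\ j1 D (lo S) = j1 x (lo S) /\ j2 D (lo S) = 0 /\
       j3 D (lo S) = j3 x (lo S) - k).
    { unfold D; simpl. rewrite A0, A1, A2, A3, X0, X2. repeat split; ring. }
    destruct Dlo as [D0 [D1 [D2 D3]]].
    assert (Zero : (forall t, lo S <= t <= hi S -> 0 <= j0 D t) -> False).
    { intros Dp. apply Hne.
      assert (DE : forall t, lo S <= t <= hi S -> j0 D t = 0).
      { intros t Ht; apply Rle_antisym; auto. }
      destruct (jet_zero S D _ _ _ Hab HD DE th Hth) as [_ [_ [_ E]]].
      unfold source in E. rewrite (DE th Hth) in E. lra. }
    assert (Start : j1 D (lo S) = 0 -> 0 <= j3 D (lo S) -> False).
    { intros E1 E3. apply Zero. apply (j0_nonneg S D _ _ _ HD Df); lra. }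
    (* [j2] is nonpositive on [[lo, t]], so the slope decreases from a nonpositive value to zero and
       must vanish identically. *)
    assert (Inner : forall t, lo S < t <= hi S -> j0 D t = 0 -> j1 D t = 0 -> j2 D t <= 0 -> False).
    { intros t Ht E0 E1 E2.
      assert (Hsub : solves S D (source (- M) D h) (lo S) t).
      { restrict HD. }
      assert (N2 : forall s, lo S <= s <= t -> j2 D s <= 0).
      { apply (j2_nonpos S D _ _ _ Hsub); [intros; apply Df; lra | lra | exact E2]. }
      assert (N1 : forall s, lo S <= s <= t -> j1 D s = 0).
      { intros s Hs. pose proof (j1_decr S D _ _ _ Hsub N2) as K.
        pose proof (K (lo S) s ltac:(lra) ltac:(lra) ltac:(lra)).
        pose proof (K s t ltac:(lra) ltac:(lra) ltac:(lra)). lra. }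
      destruct (j1_zero S D _ (lo S) t ltac:(lra) Hsub N1 (lo S) ltac:(lra)) as [_ [Z3 _]].
      apply Start; [apply N1; lra | lra]. }
    destruct K3 as [[t [Ht Et]] | [Kl | Kr]].
    + destruct (interior_zero_nonpos S D _ _ _ t HD Dneg Ht Et) as [E1 E2].
      apply (Inner t); auto; lra.
    + destruct (contact_left S x A _ _ _ k Hab HD Dneg Kl) as [_ E]. fold D in E.
      destruct (E A0) as [E1 _]. apply Start; [exact E1|].
      assert (- j3 D (lo S) <= 0); [|lra].
      apply small_multiple with (-1). intros e He L. apply (Kl e He).
      right; simpl. rewrite A0, A1, A2, A3, X0, X2. split; [ring|].
      right; split; [lra|]. right; split; lra.
    + destruct (contact_right S x A _ _ _ k Hab HD Dneg Kr) as [E0 E]. fold D in E0, E.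
      destruct Aend as [L|[Eb L]].
      (* Here [x] vanishes at [hi] while [A] does not, so contact forces [k = 0] and [D] coincides
         with [x]. *)
      * assert (k = 0).
        { unfold D in E0; simpl in E0. rewrite Xb in E0. nra. }
        assert (N2 : forall s, lo S <= s <= hi S -> j2 D s <= 0).
        { apply (j2_nonpos S D _ _ _ HD Df); [lra|]. unfold D; simpl; subst k; lra. }
        assert (N1 : forall s, lo S <= s <= hi S -> j1 D s <= 0).
        { intros s Hs. apply Rle_trans with (j1 D (lo S)); [|lra].
          apply (j1_decr S D _ _ _ HD N2); lra. }
        apply Zero. intros t Ht. rewrite <- E0. apply (j0_decr S D _ _ _ HD N1); lra.
      * destruct (E Eb) as [E1 E2]. apply (Inner (hi S)); auto; lra.
Qed.

Lemma solves_ref_ref (S : system) (x : jet) (f : R -> R) (c d : R) :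
  solves (sref (sref S)) x f c d -> solves S x f c d.
Proof.
  intros H t Ht. destruct (H t Ht) as [H0 [H1 [H2 H3]]]. simpl in *.
  replace (lo S + hi S - (lo S + hi S - t)) with t in * by ring. auto.
Qed.

Lemma solves_unref (S : system) (x : jet) (f : R -> R) :
  solves (sref S) x f (lo S) (hi S) ->
  solves S (jref S x) (fun t => f (lo S + hi S - t)) (lo S) (hi S).
Proof.
  intros H. apply solves_ref_ref.
  pose proof (solves_ref (sref S) x f _ _ H) as K. simpl in K.
  replace (lo S + hi S - hi S) with (lo S) in K by ring.
  replace (lo S + hi S - lo S) with (hi S) in K by ring. exact K.
Qed.

Lemma solves_reflected (S : system) (x : jet) (f : R -> R) :
  solves S x f (lo S) (hi S) ->
  solves (sref S) (jref S x) (fun t => f (lo S + hi S - t)) (lo S) (hi S).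
Proof.
  intros H. pose proof (solves_ref S x f _ _ H) as K.
  replace (lo S + hi S - hi S) with (lo S) in K by ring.
  replace (lo S + hi S - lo S) with (hi S) in K by ring. exact K.
Qed.

Lemma reflect_lo (S : system) : lo S + hi S - lo S = hi S. Proof. ring. Qed.
Lemma reflect_hi (S : system) : lo S + hi S - hi S = lo S. Proof. ring. Qed.

Lemma hinged_ref (S : system) (x : jet) : hinged S x -> hinged (sref S) (jref S x).
Proof. unfold hinged; simpl. rewrite reflect_lo, reflect_hi. tauto. Qed.

Lemma slope_neg_hi (S : system) (M : R) (A x : jet) (h : R -> R) :
  0 <= M -> positive_cubic (sref S) M A ->
  solves S x (source (- M) x h) (lo S) (hi S) ->
  hinged S x ->
  (forall t, lo S <= t <= hi S -> 0 <= h t) ->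
  (exists t, lo S <= t <= hi S /\ h t <> 0) ->
  j1 x (hi S) < 0.
Proof.
  intros HM HA Hx Xh Hh [th [Hth Hne]].
  assert (0 < j1 (jref S x) (lo S)).
  { apply (slope_pos_lo (sref S) M A (jref S x) (fun t => h (lo S + hi S - t))); auto.
    - exact (solves_reflected S x _ Hx).
    - now apply hinged_ref.
    - simpl; intros t Ht; apply Hh; lra.
    - exists (lo S + hi S - th); simpl; split; [lra|].
      now replace (lo S + hi S - (lo S + hi S - th)) with th by ring. }
  simpl in H. rewrite reflect_lo in H. lra.
Qed.

(** For use on one side of a fixed point: [y] leaves zero upwards at [c], so the multiplier is
    positive, and a strict inequality at [d] keeps the contact away from [d]. Contact at [c] is
    possible when [B] vanishes there, and is then a double zero of the difference. *)
Lemma contact_after_lo (S : system) (y B : jet) (f g : R -> R) (c d : R) :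
  c < d -> solves S y f c d -> solves S B g c d ->
  j0 y c = 0 -> 0 < j1 y c ->
  (forall t, c < t <= d -> 0 < j0 B t) ->
  (0 < j0 B c \/ j0 B c = 0 /\ 0 < j1 B c) ->
  exists l, 0 < l /\ (forall t, c <= t <= d -> j0 y t - l * j0 B t <= 0) /\
    (forall l', (forall t, c <= t <= d -> j0 y t - l' * j0 B t <= 0) -> l <= l') /\
    (j0 y d - l * j0 B d < 0 -> exists t, c <= t < d /\
      j0 y t - l * j0 B t = 0 /\ j1 y t - l * j1 B t = 0 /\ j2 y t - l * j2 B t <= 0).
Proof.
  intros Hcd Hy HB Y0 Y1 Bp Bc.
  assert (Bnn : forall t, c <= t <= d -> 0 <= j0 B t).
  { intros t Ht. destruct (Req_dec t c) as [->|N]; [destruct Bc; lra | left; apply Bp; lra]. }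
  destruct (touching S y B _ _ c d Hcd Hy HB) as [l [Dneg [L2 L3]]].
  - exact Bnn.
  - intros t Ht; apply Bp; lra.
  - destruct Bc as [|[E L]]; [now left | right]. now apply dominated_right.
  - left; apply Bp; lra.
  - exists l.
    assert (L1 : forall t, c <= t <= d -> j0 y t - l * j0 B t <= 0).
    { intros t Ht; specialize (Dneg t Ht); simpl in Dneg; lra. }
    assert (Lpos : 0 < l).
    { apply Rnot_le_lt; intros Ll.
      apply (not_lexneg S _ _ c d c (jopp_solves S _ _ _ _ Hy)).
      - intros t Ht. specialize (L1 t Ht). specialize (Bnn t Ht). simpl. nra.
      - lra.
      - right; simpl. split; [rewrite Y0; ring | left; lra]. }
    split; [exact Lpos|]. split; [exact L1|]. split; [exact L2|]. intros Hd.
    pose proof (solves_lin S 1 (- l) y B _ _ c d Hy HB) as HD.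
    destruct L3 as [[t [Ht Et]] | [Kl | Kr]].
    + exists t. split; [lra|].
      destruct (interior_zero_nonpos S _ _ c d t HD Dneg Ht Et) as [E1 E2]; simpl in *; lra.
    + destruct (contact_left S y B _ _ _ l Hcd HD Dneg Kl) as [E0 E].
      exists c. split; [lra|]. destruct Bc as [L|[Eb L]].
      * simpl in E0. nra.
      * destruct (E Eb) as [E1 E2]. simpl in *; lra.
    + destruct (contact_right S y B _ _ _ l Hcd HD Dneg Kr) as [E0 _]. simpl in E0. lra.
Qed.

Lemma contact_before_hi (S : system) (y B : jet) (f g : R -> R) (c d : R) :
  c < d -> solves S y f c d -> solves S B g c d ->
  j0 y d = 0 -> j1 y d < 0 ->
  (forall t, c <= t < d -> 0 < j0 B t) ->
  (0 < j0 B d \/ j0 B d = 0 /\ j1 B d < 0) ->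
  exists l, 0 < l /\ (forall t, c <= t <= d -> j0 y t - l * j0 B t <= 0) /\
    (forall l', (forall t, c <= t <= d -> j0 y t - l' * j0 B t <= 0) -> l <= l') /\
    (j0 y c - l * j0 B c < 0 -> exists t, c < t <= d /\
      j0 y t - l * j0 B t = 0 /\ j1 y t - l * j1 B t = 0 /\ j2 y t - l * j2 B t <= 0).
Proof.
  intros Hcd Hy HB Y0 Y1 Bp Bd.
  set (s := lo S + hi S).
  assert (Ed : s - (s - d) = d) by ring. assert (Ec : s - (s - c) = c) by ring.
  destruct (contact_after_lo (sref S) (jref S y) (jref S B) _ _ (s - d) (s - c) ltac:(lra)
    (solves_ref _ _ _ _ _ Hy) (solves_ref _ _ _ _ _ HB)) as [l [L1 [L2 [L3 L4]]]].
  - simpl. fold s. now rewrite Ed.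
  - simpl. fold s. rewrite Ed; lra.
  - simpl. fold s. intros t Ht. apply Bp; lra.
  - simpl. fold s. rewrite Ed. destruct Bd as [|[? ?]]; [now left | right; lra].
  - simpl in *. fold s in L2, L3, L4. exists l. split; [exact L1|]. split; [|split].
    + intros t Ht. specialize (L2 (s - t) ltac:(lra)).
      now replace (s - (s - t)) with t in L2 by ring.
    + intros l' Hl'. apply L3. intros t Ht. apply Hl'; lra.
    + intros Hc. rewrite Ec in L4. destruct (L4 Hc) as [t [Ht E]].
      exists (s - t). split; lra.
Qed.

(* If [j0 x t0 <= 0], multiples [k A] and [l B] of the two one-sided comparison
   functions are fitted so that [x - k A - l B <= 0] has a contact on each side
   of [t0]: each of [k], [l] is minimal given the other, by a monotone fixed point. *)
Lemma interior_positive (S : system) (M : R) (A A' x : jet) (h : R -> R) :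
  0 <= M -> positive_cubic S M A -> positive_cubic (sref S) M A' ->
  solves S x (source (- M) x h) (lo S) (hi S) ->
  hinged S x ->
  (forall t, lo S <= t <= hi S -> 0 <= h t) ->
  0 < j1 x (lo S) -> j1 x (hi S) < 0 ->
  forall t, lo S < t < hi S -> 0 < j0 x t.
Proof.
  intros HM [HA [[A0 [A1 _]] [Apos Aend]]] [HA' [[B0 [B1 _]] [Bpos Bend]]] Hx
    [X0 [X2 [Xb X2b]]] Hh Sa Sb t0 Ht0.
  pose proof (lo_hi S) as Hab.
  apply Rnot_le_lt; intros Hle.
  pose proof (solves_unref S A' _ HA') as HB. set (B := jref S A') in *.
  assert (HB' : hom S (- M) B (lo S) (hi S)) by exact HB. clear HB HA'.
  assert (Bb : j0 B (hi S) = 0 /\ j1 B (hi S) = 0).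
  { simpl in *. rewrite reflect_hi. lra. }
  assert (Bp : forall t, lo S < t < hi S -> 0 < j0 B t).
  { intros t Ht. simpl in *. apply Bpos; lra. }
  assert (Ba : 0 < j0 B (lo S) \/ j0 B (lo S) = 0 /\ 0 < j1 B (lo S)).
  { simpl in *. rewrite reflect_lo. destruct Bend as [|[? ?]]; [left; lra | right; split; lra]. }
  assert (Ann : forall t, lo S <= t <= hi S -> 0 <= j0 A t)
    by (apply nonneg_closed; [assumption | lra | destruct Aend; lra]).
  assert (Bnn : forall t, lo S <= t <= hi S -> 0 <= j0 B t)
    by (apply nonneg_closed; [assumption | destruct Ba; lra | lra]).
  clearbody B. clear B0 B1 Bpos Bend A'.
  set (F0 := fun k l t => j0 x t - k * j0 A t - l * j0 B t).
  set (F1 := fun k l t => j1 x t - k * j1 A t - l * j1 B t).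
  set (F2 := fun k l t => j2 x t - k * j2 A t - l * j2 B t).
  assert (HF : forall k l, solves S (jlin 1 (jlin 1 x (- k) A) (- l) B)
     (source (- M) (jlin 1 (jlin 1 x (- k) A) (- l) B) h) (lo S) (hi S)).
  { intros k l. apply solves_sub_multiple; [now apply solves_sub_multiple | exact HB']. }
  assert (Left : forall k, exists l, 0 < l /\ (forall t, lo S <= t <= t0 -> F0 k l t <= 0) /\
    (forall l', (forall t, lo S <= t <= t0 -> F0 k l' t <= 0) -> l <= l') /\
    (F0 k l t0 < 0 -> exists t, lo S <= t < t0 /\ F0 k l t = 0 /\ F1 k l t = 0 /\ F2 k l t <= 0)).
  { intros k.
    destruct (contact_after_lo S (jlin 1 x (- k) A) B _ _ (lo S) t0 ltac:(lra)
      (solves_sub S _ _ _ _ (lo S) t0 (solves_sub_multiple S (- M) k _ _ x A h Hx HA) ltac:(lra) ltac:(lra))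
      (solves_sub S _ _ _ _ (lo S) t0 HB' ltac:(lra) ltac:(lra))) as [l [L1 [L2 [L3 L4]]]].
    - simpl; rewrite X0, A0; ring.
    - simpl; rewrite A1; lra.
    - intros t Ht; apply Bp; lra.
    - exact Ba.
    - simpl in *. exists l. split; [exact L1|]. unfold F0, F1, F2. split; [|split].
      + intros t Ht. specialize (L2 t Ht). lra.
      + intros l' Hl'. apply L3. intros t Ht. specialize (Hl' t Ht). lra.
      + intros E. destruct (L4 ltac:(lra)) as [t [Ht [E0 [E1 E2]]]].
        exists t. split; [exact Ht|]. repeat split; lra. }
  assert (Right : forall l, exists k, 0 < k /\ (forall t, t0 <= t <= hi S -> F0 k l t <= 0) /\
    (forall k', (forall t, t0 <= t <= hi S -> F0 k' l t <= 0) -> k <= k') /\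
    (F0 k l t0 < 0 -> exists t, t0 < t <= hi S /\ F0 k l t = 0 /\ F1 k l t = 0 /\ F2 k l t <= 0)).
  { intros l.
    destruct (contact_before_hi S (jlin 1 x (- l) B) A _ _ t0 (hi S) ltac:(lra)
      (solves_sub S _ _ _ _ t0 (hi S) (solves_sub_multiple S (- M) l _ _ x B h Hx HB') ltac:(lra) ltac:(lra))
      (solves_sub S _ _ _ _ t0 (hi S) HA ltac:(lra) ltac:(lra))) as [k [K1 [K2 [K3 K4]]]].
    - simpl. destruct Bb as [-> _]. rewrite Xb; ring.
    - simpl. destruct Bb as [_ ->]. lra.
    - intros t Ht; apply Apos; lra.
    - exact Aend.
    - simpl in *. exists k. split; [exact K1|]. unfold F0, F1, F2. split; [|split].
      + intros t Ht. specialize (K2 t Ht). lra.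
      + intros k' Hk'. apply K3. intros t Ht. specialize (Hk' t Ht). lra.
      + intros E. destruct (K4 ltac:(lra)) as [t [Ht [E0 [E1 E2]]]].
        exists t. split; [exact Ht|]. repeat split; lra. }
  set (Pl := fun k l => 0 < l /\ (forall t, lo S <= t <= t0 -> F0 k l t <= 0) /\
    (forall l', (forall t, lo S <= t <= t0 -> F0 k l' t <= 0) -> l <= l') /\
    (F0 k l t0 < 0 -> exists t, lo S <= t < t0 /\ F0 k l t = 0 /\ F1 k l t = 0 /\ F2 k l t <= 0)).
  set (Pk := fun l k => 0 < k /\ (forall t, t0 <= t <= hi S -> F0 k l t <= 0) /\
    (forall k', (forall t, t0 <= t <= hi S -> F0 k' l t <= 0) -> k <= k') /\
    (F0 k l t0 < 0 -> exists t, t0 < t <= hi S /\ F0 k l t = 0 /\ F1 k l t = 0 /\ F2 k l t <= 0)).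
  set (ell := fun k => epsilon (inhabits 0) (Pl k)).
  set (kap := fun l => epsilon (inhabits 0) (Pk l)).
  assert (Hell : forall k, Pl k (ell k)) by (intros k; apply epsilon_spec, Left).
  assert (Hkap : forall l, Pk l (kap l)) by (intros l; apply epsilon_spec, Right).
  clearbody ell kap.
  assert (Mell : forall k k', k <= k' -> ell k' <= ell k).
  { intros k k' Hk. destruct (Hell k') as [_ [_ [Hmin _]]]. destruct (Hell k) as [_ [Hok _]].
    apply Hmin. intros t Ht. specialize (Hok t Ht). specialize (Ann t ltac:(lra)).
    unfold F0 in *. nra. }
  assert (Mkap : forall l l', l <= l' -> kap l' <= kap l).
  { intros l l' Hl. destruct (Hkap l') as [_ [_ [Hmin _]]]. destruct (Hkap l) as [_ [Hok _]].
    apply Hmin. intros t Ht. specialize (Hok t Ht). specialize (Bnn t ltac:(lra)).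
    unfold F0 in *. nra. }
  (* [ell] and [kap] are both nonincreasing, so their composition is nondecreasing; positivity of
     [ell] bounds it by [kap 0]. *)
  destruct (monotone_fixed_point (fun k => kap (ell k)) (kap 0)) as [k Ek].
  - destruct (Hkap (ell 0)) as [H _]; lra.
  - intros k k' Hk. now apply Mkap, Mell.
  - intros k. apply Mkap. destruct (Hell k) as [H _]; lra.
  - destruct (Hell k) as [Lpos [Lok [_ Lc]]]. destruct (Hkap (ell k)) as [Kpos [Kok [_ Kc]]].
    rewrite Ek in *. set (l := ell k) in *.
    (* Both multipliers are positive and [j0 x t0 <= 0], so neither contact is at [t0]. *)
    assert (Neg : F0 k l t0 < 0).
    { unfold F0. specialize (Apos t0 Ht0). specialize (Bp t0 Ht0).
      assert (0 < k * j0 A t0) by now apply Rmult_lt_0_compat.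
      assert (0 < l * j0 B t0) by now apply Rmult_lt_0_compat. lra. }
    destruct (Lc Neg) as [s1 [Hs1 [E10 [E11 E12]]]].
    destruct (Kc Neg) as [s2 [Hs2 [E20 [E21 E22]]]].
    specialize (HF k l). set (F := jlin 1 (jlin 1 x (- k) A) (- l) B) in *.
    assert (EF0 : forall t, j0 F t = F0 k l t) by (intros; unfold F, F0; simpl; ring).
    assert (EF1 : forall t, j1 F t = F1 k l t) by (intros; unfold F, F1; simpl; ring).
    assert (EF2 : forall t, j2 F t = F2 k l t) by (intros; unfold F, F2; simpl; ring).
    assert (Fneg : forall t, lo S <= t <= hi S -> j0 F t <= 0).
    { intros t Ht. rewrite EF0. destruct (Rle_dec t t0); [apply Lok | apply Kok]; lra. }
    assert (HFs : solves S F (source (- M) F h) s1 s2).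
    { restrict HF. }
    (* Concavity of [F] between the contacts, with zero slope at [s2], makes [F] nondecreasing from
       zero at [s1], against its negative value at [t0]. *)
    assert (N2 : forall t, s1 <= t <= s2 -> j2 F t <= 0).
    { apply (j2_nonpos S F _ _ _ HFs); [|rewrite EF2; exact E12|rewrite EF2; exact E22].
      intros t Ht. specialize (Fneg t ltac:(lra)). specialize (Hh t ltac:(lra)).
      unfold source. nra. }
    assert (N1 : forall t, s1 <= t <= s2 -> 0 <= j1 F t).
    { intros t Ht. apply Rle_trans with (j1 F s2); [rewrite EF1; lra|].
      apply (j1_decr S F _ _ _ HFs N2); lra. }
    assert (j0 F s1 <= j0 F t0) by (apply (j0_incr S F _ _ _ HFs N1); lra).
    rewrite !EF0 in H. lra.
Qed.

(** * Wronskians of hinged solutions *)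

Definition strongly_pos (S : system) (x : jet) : Prop :=
  (forall t, lo S < t < hi S -> 0 < j0 x t) /\ 0 < j1 x (lo S) /\ j1 x (hi S) < 0.

Lemma inverse_positive_at (S : system) (M : R) (A A' : jet) :
  0 <= M -> positive_cubic S M A -> positive_cubic (sref S) M A' ->
  forall x h, solves S x (source (- M) x h) (lo S) (hi S) -> hinged S x ->
  (forall t, lo S <= t <= hi S -> 0 <= h t) ->
  (exists t, lo S <= t <= hi S /\ h t <> 0) -> strongly_pos S x.
Proof.
  intros HM HA HA' x h Hx Xh Hh Hne.
  assert (Sa : 0 < j1 x (lo S)) by (apply (slope_pos_lo S M A x h); assumption).
  assert (Sb : j1 x (hi S) < 0) by (apply (slope_neg_hi S M A' x h); assumption).
  split; [|split; assumption].
  apply (interior_positive S M A A' x h); assumption.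
Qed.

(** Up to a first return to zero the source [lam * j0 A] is nonnegative, so [j3], and with it every
    other entry, stays positive; no return is possible. *)
Lemma cubic_pos (S : system) (lam : R) (A : jet) :
  0 <= lam -> hom S lam A (lo S) (hi S) -> data A (lo S) 0 0 0 1 ->
  forall t, lo S < t <= hi S -> 0 < j0 A t.
Proof.
  intros Hl HA [D0 [D1 [D2 D3]]] t Ht. pose proof (lo_hi S) as Hab.
  apply Rnot_le_lt; intros Hle.
  destruct (lexneg_right_neg S (jopp A) _ (lo S) (hi S) Hab (jopp_solves _ _ _ _ _ HA)) as [e [He Hnear]].
  { right; simpl. split; [lra|]. right; split; [lra|]. right; split; lra. }
  destruct (first_nonpositive (j0 A) (lo S) t e) as [s [Hs [Es Hpos]]].
  - intros u Hu. apply (solves_cont S A _ _ _ HA); lra.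
  - exact He.
  - intros u Hu Hut. specialize (Hnear u Hu ltac:(lra)). simpl in Hnear. lra.
  - lra.
  - exact Hle.
  - assert (Hsub : solves S A (fun t => lam * j0 A t) (lo S) s).
    { restrict HA. }
    assert (Hf : forall u, lo S <= u <= s -> 0 <= lam * j0 A u).
    { intros u Hu. apply Rmult_le_pos; [exact Hl|].
      destruct (Req_dec u (lo S)) as [->|]; [lra|].
      destruct (Req_dec u s) as [->|]; [lra|]. left; apply Hpos; lra. }
    assert (K3 : forall u, lo S <= u <= s -> 0 < j3 A u).
    { intros u Hu. pose proof (j3_incr S A _ _ _ Hsub Hf (lo S) u); lra. }
    destruct (cubic_start_pos S A _ (lo S) s Hsub D0 D1 D2 K3 s); lra.
Qed.

Lemma hom_unique (S : system) (lam c0 c1 c2 c3 : R) (x y : jet) :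
  hom S lam x (lo S) (hi S) -> hom S lam y (lo S) (hi S) ->
  data x (lo S) c0 c1 c2 c3 -> data y (lo S) c0 c1 c2 c3 ->
  forall t, lo S <= t <= hi S -> j0 x t = j0 y t /\ j1 x t = j1 y t /\ j2 x t = j2 y t /\ j3 x t = j3 y t.
Proof.
  intros Hx Hy Dx Dy t Ht.
  destruct (parameter_bound S (Rabs lam) c0 c1 c2 c3 (Rabs_pos lam)) as [C [_ [_ H]]].
  specialize (H lam lam x y (Rle_refl _) (Rle_refl _) Hx Hy Dx Dy t Ht).
  rewrite Rminus_diag, Rabs_R0, Rmult_0_r in H.
  assert (Z : forall r, Rabs r <= 0 -> r = 0).
  { intros r Hr. apply Rabs_le_between in Hr. lra. }
  destruct H as [H0 [H1 [H2 H3]]].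
  apply Z in H0, H1, H2, H3. repeat split; lra.
Qed.

(** The six minors formed from the entries are the coordinates of the plane spanned by [P] and [Q];
    they satisfy a closed linear system, the second compound of the first order system. *)
Definition minor (f g : jet -> R -> R) (P Q : jet) (t : R) : R :=
  f P t * g Q t - g P t * f Q t.

Lemma minor_derive (f g : jet -> R -> R) (P Q : jet) (t a b a' b' l : R) :
  is_derive (f P) t a -> is_derive (g P) t b ->
  is_derive (f Q) t a' -> is_derive (g Q) t b' ->
  a * g Q t + f P t * b' - (b * f Q t + g P t * a') = l ->
  is_derive (minor f g P Q) t l.
Proof.
  intros Hf Hg Hf' Hg' <-. unfold minor.
  apply (is_derive_minus (fun t => f P t * g Q t) (fun t => g P t * f Q t)).
  - apply (is_derive_mult (f P) (g Q)); [assumption.. | exact Rmult_comm].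
  - apply (is_derive_mult (g P) (f Q)); [assumption.. | exact Rmult_comm].
Qed.

Section Minors.
Context (S : system) (lam c d : R) (P Q : jet).
Context (HP : hom S lam P c d) (HQ : hom S lam Q c d).

Ltac derive_minor Ht :=
  destruct (HP _ Ht) as [? [? [? ?]]]; destruct (HQ _ Ht) as [? [? [? ?]]];
  eapply minor_derive;
    [match goal with H : is_derive ?F _ _ |- is_derive ?F _ _ => exact H end ..
    | unfold minor; ring].

Lemma m12_derive t : c <= t <= d ->
  is_derive (minor j0 j1 P Q) t (cr S t * minor j0 j2 P Q t).
Proof. intros Ht. derive_minor Ht. Qed.

Lemma m13_derive t : c <= t <= d ->
  is_derive (minor j0 j2 P Q) t (minor j1 j2 P Q t + cg S t * minor j0 j3 P Q t).
Proof. intros Ht. derive_minor Ht. Qed.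

Lemma m14_derive t : c <= t <= d ->
  is_derive (minor j0 j3 P Q) t (minor j1 j3 P Q t).
Proof. intros Ht. derive_minor Ht. Qed.

Lemma m23_derive t : c <= t <= d ->
  is_derive (minor j1 j2 P Q) t (cg S t * minor j1 j3 P Q t).
Proof. intros Ht. derive_minor Ht. Qed.

Lemma m24_derive t : c <= t <= d ->
  is_derive (minor j1 j3 P Q) t (cr S t * minor j2 j3 P Q t - lam * cq S t * minor j0 j1 P Q t).
Proof. intros Ht. derive_minor Ht. Qed.

Lemma m34_derive t : c <= t <= d ->
  is_derive (minor j2 j3 P Q) t (- lam * cq S t * minor j0 j2 P Q t).
Proof. intros Ht. derive_minor Ht. Qed.

(** Positivity of the minor of [j1] and [j3] is integrated through the compound system by
    [m14_derive], [m23_derive], [m13_derive] and [m12_derive]; all four minors start at zero. *)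
Lemma minors_pos :
  data P c 0 1 0 0 -> data Q c 0 0 0 1 ->
  (forall t, c <= t <= d -> 0 < minor j1 j3 P Q t) ->
  forall t, c < t <= d -> 0 < minor j0 j1 P Q t /\
    0 < minor j0 j2 P Q t.
Proof.
  intros [P0 [P1 [P2 P3]]] [Q0 [Q1 [Q2 Q3]]] H24.
  assert (H14 : forall t, c < t <= d -> 0 < minor j0 j3 P Q t).
  { apply (positive_after_zero _ _ c d m14_derive);
      [unfold minor; rewrite P0, Q0; ring | intros s Hs; apply H24; lra]. }
  assert (H23 : forall t, c < t <= d -> 0 < minor j1 j2 P Q t).
  { apply (positive_after_zero _ _ c d m23_derive);
      [unfold minor; rewrite P2, Q2; ring | intros s Hs].
    apply Rmult_lt_0_compat; [apply cg_pos | apply H24; lra]. }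
  assert (H13 : forall t, c < t <= d -> 0 < minor j0 j2 P Q t).
  { apply (positive_after_zero _ _ c d m13_derive);
      [unfold minor; rewrite P0, Q0; ring | intros s Hs].
    apply Rplus_lt_0_compat; [apply H23; lra|].
    apply Rmult_lt_0_compat; [apply cg_pos | apply H14; lra]. }
  intros t Ht; split; [|now apply H13]. revert t Ht.
  apply (positive_after_zero _ _ c d m12_derive);
    [unfold minor; rewrite P0, Q0; ring | intros s Hs].
  apply Rmult_lt_0_compat; [apply cr_pos | apply H13; lra].
Qed.

End Minors.

(** For [lam = 0] the minor of [j2] and [j3] does not fall below its initial value zero, so that of
    [j1] and [j3] stays at least one and [minors_pos] applies. *)
Lemma minors_pos_zero (S : system) (P Q : jet) :
  hom S 0 P (lo S) (hi S) -> hom S 0 Q (lo S) (hi S) ->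
  data P (lo S) 0 1 0 0 -> data Q (lo S) 0 0 0 1 ->
  forall t, lo S < t <= hi S -> 0 < minor j0 j1 P Q t /\
    0 < minor j0 j2 P Q t.
Proof.
  intros HP HQ DP DQ. apply (minors_pos S 0 _ _ P Q HP HQ DP DQ).
  destruct DP as [P0 [P1 [P2 P3]]], DQ as [Q0 [Q1 [Q2 Q3]]].
  assert (H34 : forall t, lo S <= t <= hi S -> 0 <= minor j2 j3 P Q t).
  { intros t Ht. apply Rle_trans with (minor j2 j3 P Q (lo S)).
    - unfold minor; rewrite P2, P3, Q2, Q3; lra.
    - apply (nondecreasing _ _ (lo S) (hi S) (m34_derive S 0 _ _ P Q HP HQ)); [|lra..].
      intros s Hs; lra. }
  intros t Ht. apply Rlt_le_trans with (minor j1 j3 P Q (lo S)).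
  - unfold minor; rewrite P1, P3, Q1, Q3; lra.
  - apply (nondecreasing _ _ (lo S) (hi S) (m24_derive S 0 _ _ P Q HP HQ)); [|lra..].
    intros s Hs. pose proof (cr_pos S s). specialize (H34 s Hs).
    assert (0 <= cr S s * minor j2 j3 P Q s) by (apply Rmult_le_pos; lra). lra.
Qed.

Lemma minor_lipschitz (C e : R) (f g f' g' F G F' G' : R) :
  0 <= C -> Rabs f <= C -> Rabs g <= C -> Rabs F' <= C -> Rabs G' <= C ->
  Rabs (f - F) <= C * e -> Rabs (g - G) <= C * e ->
  Rabs (f' - F') <= C * e -> Rabs (g' - G') <= C * e ->
  Rabs ((f * g' - g * f') - (F * G' - G * F')) <= 4 * C * C * e.
Proof.
  intros HC Hf Hg HF' HG' H1 H2 H3 H4.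
  replace (f * g' - g * f' - (F * G' - G * F')) with
    ((f * (g' - G') + (f - F) * G') + - (g * (f' - F') + (g - G) * F')) by ring.
  eapply Rle_trans; [apply Rabs_triang|]. rewrite Rabs_Ropp.
  assert (Hm : forall u v U V, Rabs u <= U -> Rabs v <= V -> Rabs (u * v) <= U * V).
  { intros u v U0 V0 Hu Hv. rewrite Rabs_mult. apply Rmult_le_compat; auto using Rabs_pos. }
  pose proof (Rabs_triang (f * (g' - G')) ((f - F) * G')).
  pose proof (Rabs_triang (g * (f' - F')) ((g - G) * F')).
  pose proof (Hm _ _ _ _ Hf H4). pose proof (Hm _ _ _ _ H1 HG').
  pose proof (Hm _ _ _ _ Hg H3). pose proof (Hm _ _ _ _ H2 HF'). nra.
Qed.

(** [sol1] and [sol3] span the solutions with [u = u'' = 0] at [lo]. A zero of [wronskian] at [t]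
    means that a nontrivial one has a double zero at [t]; a zero of [hinge_minor], that one has
    [u = u'' = 0] at [t]. *)
Definition wronskian (S : system) (lam t : R) : R :=
  minor j0 j1 (sol1 S lam) (sol3 S lam) t.
Definition hinge_minor (S : system) (lam t : R) : R :=
  minor j0 j2 (sol1 S lam) (sol3 S lam) t.

Lemma ratio_derive (S : system) (lam t : R) : lo S <= t <= hi S -> 0 < j0 (sol3 S lam) t ->
  is_derive (fun u => j0 (sol1 S lam) u / j0 (sol3 S lam) u) t
    (- wronskian S lam t / (j0 (sol3 S lam) t) ^ 2).
Proof.
  intros Ht Hp. destruct (sol1_spec S lam) as [H1 _]. destruct (sol3_spec S lam) as [H3 _].
  destruct (H1 t Ht) as [d1 _]. destruct (H3 t Ht) as [d3 _].
  replace (- wronskian S lam t) with (j1 (sol1 S lam) t * j0 (sol3 S lam) t -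
    j0 (sol1 S lam) t * j1 (sol3 S lam) t) by (unfold wronskian, minor; ring).
  apply is_derive_div; [exact d1 | exact d3 | lra].
Qed.

Lemma minors_bound (S : system) (L : R) : 0 <= L -> exists C, 0 < C /\
  forall l m t, 0 <= l <= L -> 0 <= m <= L -> lo S <= t <= hi S ->
  Rabs (wronskian S l t - wronskian S m t) <= C * Rabs (l - m) /\
  Rabs (hinge_minor S l t - hinge_minor S m t) <= C * Rabs (l - m) /\
  Rabs (wronskian S l t) <= C /\
  Rabs (minor j2 j3 (sol1 S l) (sol3 S l) t) <= C.
Proof.
  intros HL.
  destruct (parameter_bound S L 0 1 0 0 HL) as [C1 [HC1 [Bd1 Lip1]]].
  destruct (parameter_bound S L 0 0 0 1 HL) as [C2 [HC2 [Bd2 Lip2]]].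
  set (C := C1 + C2).
  exists (4 * C * C + 2 * C * C). split; [unfold C; nra|].
  intros l m t Hl Hm Ht.
  assert (Al : Rabs l <= L) by (rewrite Rabs_pos_eq; lra).
  assert (Am : Rabs m <= L) by (rewrite Rabs_pos_eq; lra).
  destruct (sol1_spec S l) as [H1l D1l]. destruct (sol1_spec S m) as [H1m D1m].
  destruct (sol3_spec S l) as [H2l D2l]. destruct (sol3_spec S m) as [H2m D2m].
  destruct (Bd1 l _ Al H1l D1l t Ht) as [P0 [P1 [P2 P3]]].
  destruct (Bd2 l _ Al H2l D2l t Ht) as [R0 [R1 [R2 R3]]].
  destruct (Bd2 m _ Am H2m D2m t Ht) as [Q0 [Q1 [Q2 Q3]]].
  destruct (Lip1 l m _ _ Al Am H1l H1m D1l D1m t Ht) as [U0 [U1 [U2 U3]]].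
  destruct (Lip2 l m _ _ Al Am H2l H2m D2l D2m t Ht) as [V0 [V1 [V2 V3]]].
  pose proof (Rabs_pos (l - m)) as Hp.
  assert (W1 : C1 * Rabs (l - m) <= C * Rabs (l - m)) by (apply Rmult_le_compat_r; unfold C; lra).
  assert (W2 : C2 * Rabs (l - m) <= C * Rabs (l - m)) by (apply Rmult_le_compat_r; unfold C; lra).
  assert (HC : 0 < C) by (unfold C; lra).
  assert (E1 : C1 <= C) by (unfold C; lra). assert (E2 : C2 <= C) by (unfold C; lra).
  assert (CC : 0 <= C * C) by nra.
  assert (CCe : 0 <= C * C * Rabs (l - m)) by (apply Rmult_le_pos; lra).
  assert (Prod : forall p q r s, Rabs p <= C -> Rabs q <= C -> Rabs r <= C -> Rabs s <= C ->
    Rabs (p * q - r * s) <= 2 * C * C).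
  { intros p q r s Hpp Hq Hr Hs. unfold Rminus. eapply Rle_trans; [apply Rabs_triang|].
    rewrite Rabs_Ropp, !Rabs_mult.
    pose proof (Rmult_le_compat _ _ _ _ (Rabs_pos p) (Rabs_pos q) Hpp Hq).
    pose proof (Rmult_le_compat _ _ _ _ (Rabs_pos r) (Rabs_pos s) Hr Hs). lra. }
  split; [|split; [|split]].
  - apply Rle_trans with (4 * C * C * Rabs (l - m)); [|lra].
    apply minor_lipschitz; lra.
  - apply Rle_trans with (4 * C * C * Rabs (l - m)); [|lra].
    apply minor_lipschitz; lra.
  - apply Rle_trans with (2 * C * C); [apply Prod; lra | lra].
  - apply Rle_trans with (2 * C * C); [apply Prod; lra | lra].
Qed.

(** The boundary conditions of [V]; those of [U] are the same conditions for the reflected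
    system. *)
Definition clamped_hinge (S : system) (x : jet) : Prop :=
  j0 x (lo S) = 0 /\ j2 x (lo S) = 0 /\ j0 x (hi S) = 0 /\ j1 x (hi S) = 0.

Definition no_mode (S : system) (bc : jet -> Prop) (lam : R) : Prop :=
  forall x, hom S lam x (lo S) (hi S) -> bc x -> forall t, lo S <= t <= hi S -> j0 x t = 0.

(** A zero at [hi] would give a mode for a parameter below [L]. At an interior zero a nonnegative
    Wronskian has a minimum, so [hinge_minor] vanishes as well and some combination of [sol1] and
    [sol3] has a triple zero there; concavity then annihilates it on [[lo, t]]. *)
Lemma wronskian_pos (S : system) (L : R) : 0 <= L ->
  (forall lam, 0 < lam < L -> no_mode S (clamped_hinge S) lam) ->
  forall t, lo S < t < hi S -> 0 < wronskian S L t.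
Proof.
  intros HL Hno. pose proof (lo_hi S) as Hab.
  destruct (minors_bound S L HL) as [C [HC Hmin]].
  destruct (coeff_bound S) as [B [HB Hb]].
  assert (Hzero : forall t, lo S < t <= hi S -> 0 < wronskian S 0 t).
  { intros t Ht. destruct (sol1_spec S 0) as [H1 D1].
    destruct (sol3_spec S 0) as [H2 D2].
    now apply (minors_pos_zero S _ _ H1 H2 D1 D2). }
  assert (HBC : 0 < B * C) by (apply Rmult_lt_0_compat; lra).
  assert (HLBC : 0 < (1 + L) * (B * C)) by (apply Rmult_lt_0_compat; lra).
  (* Uniformly in the parameter, the minor of [j1] and [j3] starts at 1 and loses at most one half
     on an interval of length [n]. *)
  destruct (small_factor _ HLBC) as [n [Hn Hn2]].
  apply (positivity_continuation (wronskian S) (lo S) (hi S) L n C); auto.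
  - intros l t Hl Ht Htd.
    destruct (sol1_spec S l) as [H1 D1]. destruct (sol3_spec S l) as [H2 D2].
    assert (H1s : hom S l (sol1 S l) (lo S) t) by (restrict H1).
    assert (H2s : hom S l (sol3 S l) (lo S) t) by (restrict H2).
    apply (minors_pos S l (lo S) t _ _ H1s H2s D1 D2); [|lra].
    intros s Hs.
    set (m24 := minor j1 j3 (sol1 S l) (sol3 S l)).
    assert (E0 : m24 (lo S) = 1).
    { destruct D1 as [_ [P1 [_ P3]]], D2 as [_ [Q1 [_ Q3]]].
      unfold m24, minor. rewrite P1, P3, Q1, Q3; ring. }
    destruct (Req_dec s (lo S)) as [->|Ns]; [lra|].
    destruct (mean_value m24 _ (lo S) s ltac:(lra) (fun u Hu => m24_derive S l (lo S) t _ _ H1s H2s u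
       (conj (proj1 Hu) (Rle_trans _ _ _ (proj2 Hu) (proj2 Hs))))) as [u [Hu E]].
    destruct (Hmin l l u Hl Hl ltac:(lra)) as [_ [_ [W1 W2]]].
    destruct (Hb u ltac:(lra)) as [Br [_ Bq]]. pose proof (cr_pos S u); pose proof (cq_pos S u).
    set (m34 := minor j2 j3 (sol1 S l) (sol3 S l) u) in *.
    fold (wronskian S l u) in E.
    assert (X1 : Rabs (cr S u * m34) <= B * C).
    { rewrite Rabs_mult, (Rabs_pos_eq (cr S u)) by lra. apply Rmult_le_compat; auto using Rabs_pos; lra. }
    assert (X2 : Rabs (l * cq S u * wronskian S l u) <= L * (B * C)).
    { rewrite !Rabs_mult, (Rabs_pos_eq (cq S u)), (Rabs_pos_eq l), Rmult_assoc by lra.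
      apply Rmult_le_compat; [lra | apply Rmult_le_pos; [lra | apply Rabs_pos] | lra |].
      apply Rmult_le_compat; auto using Rabs_pos; lra. }
    apply Rabs_le_between in X1, X2.
    assert (- ((1 + L) * (B * C)) <= cr S u * m34 - l * cq S u * wronskian S l u) by lra.
    assert ((1 + L) * (B * C) * (s - lo S) <= (1 + L) * (B * C) * n) by (apply Rmult_le_compat_l; lra).
    nra.
  - intros l m t Hl Hm Ht. now apply Hmin.
  - intros l t Hl Ht. destruct (sol1_spec S l) as [H1 _].
    destruct (sol3_spec S l) as [H2 _].
    eapply is_derive_cont. exact (m12_derive S l (lo S) (hi S) _ _ H1 H2 t Ht).
  - intros l Hl E. destruct (Req_dec l 0) as [->|Nl]; [specialize (Hzero (hi S)); lra|].
    destruct (sol1_spec S l) as [H1 D1]. destruct (sol3_spec S l) as [H2 D2].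
    pose proof (cubic_pos S l _ ltac:(lra) H2 D2 (hi S) ltac:(lra)) as Cp.
    destruct D1 as [P0 [P1 [P2 P3]]], D2 as [Q0 [Q1 [Q2 Q3]]].
    (* This combination vanishes at [hi], and its slope there is minus the Wronskian. *)
    set (x := jlin (j0 (sol3 S l) (hi S)) (sol1 S l) (- j0 (sol1 S l) (hi S)) (sol3 S l)).
    assert (Hx : hom S l x (lo S) (hi S)) by now apply hom_lin.
    assert (Zx : forall t, lo S <= t <= hi S -> j0 x t = 0).
    { apply (Hno l); [lra | exact Hx |]. unfold clamped_hinge, x; simpl. rewrite P0, P2, Q0, Q2.
      repeat split; try ring. unfold wronskian, minor in E. lra. }
    destruct (jet_zero S x _ _ _ Hab Hx Zx (lo S) ltac:(lra)) as [Z1 _].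
    unfold x in Z1; simpl in Z1. rewrite P1, Q1 in Z1. lra.
  - intros l t Hl Hpos Ht E0.
    destruct (sol1_spec S l) as [H1 D1]. destruct (sol3_spec S l) as [H2 D2].
    pose proof (cubic_pos S l _ ltac:(lra) H2 D2) as Cp.
    destruct D1 as [P0 [P1 [P2 P3]]], D2 as [Q0 [Q1 [Q2 Q3]]].
    pose proof (m12_derive S l (lo S) (hi S) _ _ H1 H2) as Wd.
    change (minor j0 j1 (sol1 S l) (sol3 S l))
      with (wronskian S l) in Wd.
    assert (E13 : hinge_minor S l t = 0).
    { apply Rmult_eq_reg_l with (cr S t); [|pose proof (cr_pos S t); lra]. rewrite Rmult_0_r.
      specialize (Wd t ltac:(lra)). apply is_derive_Reals in Wd.
      rewrite <- (deriv_minimum (wronskian S l) (lo S) (hi S) t (exist _ _ Wd)); try lra.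
      - unfold derive_pt; simpl. reflexivity.
      - intros s Hs1 Hs2. rewrite E0. apply Hpos; lra. }
    set (k := j0 (sol1 S l) t / j0 (sol3 S l) t).
    pose proof (Cp t ltac:(lra)) as Ct.
    assert (Ek : k * j0 (sol3 S l) t = j0 (sol1 S l) t) by (unfold k; field; lra).
    set (D := jlin 1 (sol1 S l) (- k) (sol3 S l)).
    assert (HD : hom S l D (lo S) (hi S)) by now apply hom_lin.
    assert (HDs : hom S l D (lo S) t) by (restrict HD).
    assert (D0 : j0 D t = 0) by (unfold D; simpl; lra).
    assert (D1 : j1 D t = 0).
    { unfold D; simpl. unfold wronskian, minor in E0.
      apply Rmult_eq_reg_l with (j0 (sol3 S l) t); [|lra].
      rewrite <- Ek in E0. nra. }
    assert (D2 : j2 D t = 0).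
    { unfold D; simpl. unfold hinge_minor, minor in E13.
      apply Rmult_eq_reg_l with (j0 (sol3 S l) t); [|lra].
      rewrite <- Ek in E13. nra. }
    (* The quotient of [sol1] by [sol3] has derivative minus the Wronskian over a square, hence is
       nonincreasing, and [k] is its value at [t]. *)
    assert (Dp : forall s, lo S <= s <= t -> 0 <= j0 D s).
    { intros s Hs. destruct (Req_dec s (lo S)) as [->|Ns].
      { unfold D; simpl. rewrite P0, Q0. lra. }
      assert (Hr : j0 (sol1 S l) t / j0 (sol3 S l) t <= j0 (sol1 S l) s / j0 (sol3 S l) s).
      { apply (nonincreasing (fun u => j0 (sol1 S l) u / j0 (sol3 S l) u)
          (fun u => - wronskian S l u / (j0 (sol3 S l) u) ^ 2) s t); [| |lra..].
        - intros u Hu. apply ratio_derive; [|apply Cp]; lra.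
        - intros u Hu. pose proof (Cp u ltac:(lra)). specialize (Hpos u ltac:(lra)).
          assert (0 < / (j0 (sol3 S l) u) ^ 2) by (apply Rinv_0_lt_compat, pow_lt; lra).
          unfold Rdiv. nra. }
      fold k in Hr. pose proof (Cp s ltac:(lra)) as Cs.
      assert (j0 (sol1 S l) s / j0 (sol3 S l) s * j0 (sol3 S l) s = j0 (sol1 S l) s)
        by (field; lra).
      unfold D; simpl. nra. }
    assert (N2 : forall s, lo S <= s <= t -> j2 D s <= 0).
    { apply (j2_nonpos S D _ _ _ HDs); [|unfold D; simpl; rewrite P2, Q2; lra | lra].
      intros s Hs; apply Rmult_le_pos; [lra | now apply Dp]. }
    assert (N1 : forall s, lo S <= s <= t -> 0 <= j1 D s).
    { intros s Hs. rewrite <- D1. apply (j1_decr S D _ _ _ HDs N2); lra. }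
    assert (N0 : forall s, lo S <= s <= t -> j0 D s = 0).
    { intros s Hs. apply Rle_antisym; [|now apply Dp]. rewrite <- D0.
      apply (j0_incr S D _ _ _ HDs N1); lra. }
    destruct (jet_zero S D _ (lo S) t ltac:(lra) HDs N0 (lo S) ltac:(lra)) as [Z1 _].
    unfold D in Z1; simpl in Z1. rewrite P1, Q1 in Z1. lra.
Qed.

(** * Positive solutions with one further zero, and the ground state *)

(** At [c = hi] only the weak sign of the slope is required, because the Wronskian may vanish there
    when [lam] is the first eigenvalue in [V]. *)
Definition bump (S : system) (lam c : R) (v : jet) : Prop :=
  hom S lam v (lo S) (hi S) /\ j0 v (lo S) = 0 /\ j1 v (lo S) = 1 /\ j2 v (lo S) = 0 /\
  j0 v c = 0 /\ (forall t, lo S < t < c -> 0 < j0 v t) /\ j1 v c <= 0 /\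
  (c < hi S -> j1 v c < 0).

Definition bump_sol (S : system) (lam c : R) : jet :=
  jlin 1 (sol1 S lam) (- (j0 (sol1 S lam) c / j0 (sol3 S lam) c)) (sol3 S lam).

(** Where the Wronskian is positive, the quotient of [sol1] by [sol3] decreases strictly, so
    subtracting its value at [c] leaves a function positive before [c]. The slope at [c] is minus
    the Wronskian divided by [j0 (sol3 S lam) c]. *)
Lemma bump_sol_spec (S : system) (lam c : R) :
  0 <= lam -> (forall t, lo S < t < hi S -> 0 < wronskian S lam t) -> lo S < c <= hi S ->
  bump S lam c (bump_sol S lam c).
Proof.
  intros Hl HW Hc.
  destruct (sol1_spec S lam) as [H1 [P0 [P1 [P2 P3]]]].
  destruct (sol3_spec S lam) as [H2 D2].
  pose proof (cubic_pos S lam _ Hl H2 D2) as Cp. destruct D2 as [Q0 [Q1 [Q2 Q3]]].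
  set (k := j0 (sol1 S lam) c / j0 (sol3 S lam) c).
  pose proof (Cp c Hc) as Cc.
  assert (Ek : k * j0 (sol3 S lam) c = j0 (sol1 S lam) c) by (unfold k; field; lra).
  unfold bump_sol. fold k. set (v := jlin 1 (sol1 S lam) (- k) (sol3 S lam)).
  assert (Hv : hom S lam v (lo S) (hi S)) by now apply hom_lin.
  assert (V0 : j0 v c = 0) by (unfold v; simpl; lra).
  assert (Vp : forall t, lo S < t < c -> 0 < j0 v t).
  { intros t Ht.
    assert (Hr : - (j0 (sol1 S lam) t / j0 (sol3 S lam) t) <
      - (j0 (sol1 S lam) c / j0 (sol3 S lam) c)).
    { apply (increasing_strict (fun u => - (j0 (sol1 S lam) u / j0 (sol3 S lam) u))
        (fun u => wronskian S lam u / (j0 (sol3 S lam) u) ^ 2) t c); [| |lra..].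
      - intros u Hu. pose proof (Cp u ltac:(lra)).
        replace (wronskian S lam u / j0 (sol3 S lam) u ^ 2)
          with (- (- wronskian S lam u / j0 (sol3 S lam) u ^ 2)) by (field; lra).
        apply (is_derive_opp (fun u => j0 (sol1 S lam) u / j0 (sol3 S lam) u)).
        apply ratio_derive; lra.
      - intros u Hu. pose proof (Cp u ltac:(lra)).
        apply Rdiv_lt_0_compat; [apply HW; lra | apply pow_lt; lra]. }
    fold k in Hr. pose proof (Cp t ltac:(lra)) as Ct.
    assert (j0 (sol1 S lam) t / j0 (sol3 S lam) t * j0 (sol3 S lam) t = j0 (sol1 S lam) t)
      by (field; lra).
    unfold v; simpl. nra. }
  split; [exact Hv|].
  split; [unfold v; simpl; rewrite P0, Q0; ring|].
  split; [unfold v; simpl; rewrite P1, Q1; ring|].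
  split; [unfold v; simpl; rewrite P2, Q2; ring|].
  split; [exact V0|]. split; [exact Vp|]. split.
  - assert (Hs : hom S lam (jopp v) (lo S) c).
    { apply solves_sub with (lo S) (hi S); [|lra..].
      apply solves_ext with (1 := jopp_solves S v _ _ _ Hv). intros; simpl; ring. }
    destruct (right_zero_nonpos S (jopp v) _ (lo S) c c Hs) as [N _].
    + intros t Ht. change (-1 * j0 v t + 0 * j0 v t <= 0). destruct (Req_dec t (lo S)) as [->|N1].
      { unfold v; simpl; rewrite P0, Q0; lra. }
      destruct (Req_dec t c) as [->|N2]; [lra|]. specialize (Vp t ltac:(lra)). lra.
    + lra.
    + change (-1 * j0 v c + 0 * j0 v c = 0); lra.
    + change (0 <= -1 * j1 v c + 0 * j1 v c) in N; lra.
  - intros Hch. unfold v; simpl. specialize (HW c ltac:(lra)). unfold wronskian, minor in HW.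
    apply Rmult_lt_reg_l with (j0 (sol3 S lam) c); [exact Cc|].
    rewrite <- Ek in HW. nra.
Qed.

Lemma ivt_lipschitz (F : R -> R) (L C : R) : 0 < L -> 0 <= C ->
  (forall l m, 0 <= l <= L -> 0 <= m <= L -> Rabs (F l - F m) <= C * Rabs (l - m)) ->
  0 < F 0 -> F L < 0 -> exists l, 0 < l < L /\ F l = 0.
Proof.
  intros HL HC Hlip H0 H1.
  set (G := fun t => - F (clamp 0 L t)).
  assert (HG : forall t, continuity_pt G t).
  { intros t e He. exists (e / (C + 1)). split; [apply Rdiv_lt_0_compat; lra|].
    intros s [_ Hs]. simpl in *. unfold Rdist in *. unfold G.
    replace (- F (clamp 0 L s) - - F (clamp 0 L t)) with (- (F (clamp 0 L s) - F (clamp 0 L t))) by ring.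
    rewrite Rabs_Ropp.
    pose proof (Hlip _ _ (clamp_in 0 L s ltac:(lra)) (clamp_in 0 L t ltac:(lra))) as H.
    pose proof (clamp_lip 0 L s t ltac:(lra)) as H2.
    assert (E : e / (C + 1) * (C + 1) = e) by (field; lra).
    pose proof (Rabs_pos (s - t)). nra. }
  destruct (IVT G 0 L) as [l [Hl El]].
  - exact HG.
  - exact HL.
  - unfold G. rewrite clamp_id; lra.
  - unfold G. rewrite clamp_id; lra.
  - unfold G in El. rewrite clamp_id in El by exact Hl. exists l. split; [|lra].
    split; apply Rnot_le_lt; intros N.
    + replace l with 0 in El by lra. lra.
    + replace l with L in El by lra. lra.
Qed.

Lemma hom_decompose (S : system) (lam : R) (x : jet) :
  hom S lam x (lo S) (hi S) -> j0 x (lo S) = 0 -> j2 x (lo S) = 0 ->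
  forall t, lo S <= t <= hi S ->
   let y := jlin (j1 x (lo S)) (sol1 S lam) (j3 x (lo S)) (sol3 S lam) in
   j0 x t = j0 y t /\ j1 x t = j1 y t /\ j2 x t = j2 y t /\ j3 x t = j3 y t.
Proof.
  intros Hx X0 X2 t Ht y.
  destruct (sol1_spec S lam) as [H1 [P0 [P1 [P2 P3]]]].
  destruct (sol3_spec S lam) as [H2 [Q0 [Q1 [Q2 Q3]]]].
  apply (hom_unique S lam 0 (j1 x (lo S)) 0 (j3 x (lo S))); [exact Hx | | | | exact Ht].
  - now apply hom_lin.
  - repeat split; assumption.
  - unfold y, data; simpl. rewrite P0, P1, P2, P3, Q0, Q1, Q2, Q3. repeat split; ring.
Qed.

(** The conditions at [lo] leave the span of [sol1] and [sol3]; vanishing at [hi], where [sol3] is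
    positive, leaves one dimension. *)
Lemma bump_multiple (S : system) (lam : R) (x : jet) :
  0 <= lam -> hom S lam x (lo S) (hi S) -> j0 x (lo S) = 0 -> j2 x (lo S) = 0 -> j0 x (hi S) = 0 ->
  (exists t, lo S <= t <= hi S /\ j0 x t <> 0) ->
  j1 x (lo S) <> 0 /\ forall t, lo S <= t <= hi S ->
    j1 x t = j1 x (lo S) * j1 (bump_sol S lam (hi S)) t /\
    j2 x t = j1 x (lo S) * j2 (bump_sol S lam (hi S)) t.
Proof.
  intros Hl Hx X0 X2 Xb [s [Hs Hne]]. pose proof (lo_hi S) as Hab.
  destruct (sol3_spec S lam) as [H2 D2].
  pose proof (cubic_pos S lam _ Hl H2 D2 (hi S) ltac:(lra)) as Cp.
  pose proof (hom_decompose S lam x Hx X0 X2) as Hd. simpl in Hd.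
  destruct (Hd (hi S) ltac:(lra)) as [Eb _]. rewrite Xb in Eb.
  assert (E3 : j3 x (lo S) = - j1 x (lo S) * (j0 (sol1 S lam) (hi S) / j0 (sol3 S lam) (hi S))).
  { apply Rmult_eq_reg_r with (j0 (sol3 S lam) (hi S)); [|lra].
    unfold Rdiv. rewrite !Rmult_assoc, Rinv_l by lra. lra. }
  split.
  - intros E1. apply Hne. rewrite E1 in E3. destruct (Hd s Hs) as [-> _]. rewrite E3, E1. ring.
  - intros t Ht. destruct (Hd t Ht) as [_ [E1 [E2 _]]]. rewrite E1, E2, E3.
    unfold bump_sol; simpl. split; ring.
Qed.

(** Otherwise [j2 <= 0] throughout, the slope is at least its value at [hi], and [v] would be
    nondecreasing towards its zero at [hi]. *)
Lemma bump_clamped_convex (S : system) (lam : R) (v : jet) :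
  0 <= lam -> bump S lam (hi S) v -> 0 <= j1 v (hi S) -> 0 < j2 v (hi S).
Proof.
  intros Hl [Hv [V0 [V1 [V2 [Vb [Vp _]]]]]] H1. pose proof (lo_hi S) as Hab.
  apply Rnot_le_lt; intros Hle.
  assert (Vnn : forall t, lo S <= t <= hi S -> 0 <= j0 v t)
    by (apply nonneg_closed; auto; lra).
  assert (N2 : forall s, lo S <= s <= hi S -> j2 v s <= 0).
  { apply (j2_nonpos S v _ _ _ Hv); [|lra..]. intros t Ht. apply Rmult_le_pos; auto. }
  assert (N1 : forall s, lo S <= s <= hi S -> 0 <= j1 v s).
  { intros s Hs. apply Rle_trans with (1 := H1). apply (j1_decr S v _ _ _ Hv N2); lra. }
  pose proof (j0_incr S v _ _ _ Hv N1 ((lo S + hi S) / 2) (hi S) ltac:(lra) ltac:(lra) ltac:(lra)).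
  specialize (Vp ((lo S + hi S) / 2) ltac:(lra)). lra.
Qed.

Definition eigen (S : system) (bc : jet -> Prop) (lam : R) : Prop :=
  exists x, hom S lam x (lo S) (hi S) /\ bc x /\ exists t, lo S <= t <= hi S /\ j0 x t <> 0.

Lemma not_eigen_no_mode (S : system) (bc : jet -> Prop) (lam : R) :
  ~ eigen S bc lam -> no_mode S bc lam.
Proof.
  intros H x Hx Hbc t Ht. apply NNPP; intros N. apply H.
  exists x; split; [exact Hx|]; split; [exact Hbc|]. exists t; split; assumption.
Qed.

(** At [hi], [hinge_minor] is positive for parameter zero and negative for [L], where the
    eigenfunction is a multiple of a bump clamped at [hi] and therefore convex there. The
    intermediate zero is an eigenvalue in [X]; this gives [lambda1 < lambdaV]. *)
Lemma hinged_eigen_below (S : system) (L : R) :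
  0 < L -> eigen S (clamped_hinge S) L ->
  (forall lam, 0 < lam < L -> no_mode S (clamped_hinge S) lam) ->
  exists lam, 0 < lam < L /\ eigen S (hinged S) lam.
Proof.
  intros HL [x [Hx [[X0 [X2 [Xb X1b]]] Xne]]] Hno. pose proof (lo_hi S) as Hab.
  pose proof (bump_sol_spec S L (hi S) ltac:(lra) (wronskian_pos S L ltac:(lra) Hno) ltac:(lra)) as Hv.
  destruct (bump_multiple S L x ltac:(lra) Hx X0 X2 Xb Xne) as [Xn Hm].
  destruct (Hm (hi S) ltac:(lra)) as [E1 _]. rewrite X1b in E1.
  assert (V1 : j1 (bump_sol S L (hi S)) (hi S) = 0).
  { destruct (Rmult_integral _ _ (eq_sym E1)); [contradiction | assumption]. }
  pose proof (bump_clamped_convex S L _ ltac:(lra) Hv ltac:(lra)) as V2.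
  destruct (minors_bound S L ltac:(lra)) as [C [HC Hmin]].
  destruct (ivt_lipschitz (fun l => hinge_minor S l (hi S)) L C HL ltac:(lra)) as [l [Hl El]].
  - intros l m Hl Hm'. apply Hmin; lra.
  - destruct (sol1_spec S 0) as [H1 D1]. destruct (sol3_spec S 0) as [H2 D2].
    apply (minors_pos_zero S _ _ H1 H2 D1 D2). lra.
  - destruct (sol3_spec S L) as [H2 D2].
    pose proof (cubic_pos S L _ ltac:(lra) H2 D2 (hi S) ltac:(lra)) as Cp.
    unfold hinge_minor, minor. unfold bump_sol in V2; simpl in V2.
    assert (0 < j0 (sol3 S L) (hi S) * (1 * j2 (sol1 S L) (hi S) +
       - (j0 (sol1 S L) (hi S) / j0 (sol3 S L) (hi S)) * j2 (sol3 S L) (hi S)))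
      by now apply Rmult_lt_0_compat.
    replace (j0 (sol1 S L) (hi S) * j2 (sol3 S L) (hi S) - j2 (sol1 S L) (hi S) * j0 (sol3 S L) (hi S))
      with (- (j0 (sol3 S L) (hi S) * (1 * j2 (sol1 S L) (hi S) +
       - (j0 (sol1 S L) (hi S) / j0 (sol3 S L) (hi S)) * j2 (sol3 S L) (hi S)))) by (field; lra).
    lra.
  - exists l. split; [exact Hl|].
    destruct (sol1_spec S l) as [H1 D1]. destruct (sol3_spec S l) as [H2 D2].
    pose proof (cubic_pos S l _ ltac:(lra) H2 D2 (hi S) ltac:(lra)) as Cp.
    destruct D1 as [P0 [P1 [P2 P3]]], D2 as [Q0 [Q1 [Q2 Q3]]].
    set (y := jlin (j0 (sol3 S l) (hi S)) (sol1 S l) (- j0 (sol1 S l) (hi S)) (sol3 S l)).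
    assert (Hy : hom S l y (lo S) (hi S)) by now apply hom_lin.
    exists y. split; [exact Hy|]. split.
    + unfold hinged, y; simpl. rewrite P0, P2, Q0, Q2. unfold hinge_minor, minor in El.
      repeat split; lra.
    + apply (jet_nonzero S y _ _ _ (lo S) Hab Hy); [lra|].
      left. unfold y; simpl. rewrite P1, Q1. lra.
Qed.

Definition ground_state (S : system) (lam : R) (phi : jet) : Prop :=
  hom S lam phi (lo S) (hi S) /\ hinged S phi /\ strongly_pos S phi.

(** A hinged eigenfunction is a multiple of the bump with zero at [hi], which is positive inside;
    its slope at [hi] is negative, since a clamped bump cannot have [j2 = 0] there. *)
Lemma ground_state_exists (S : system) (lam : R) :
  0 < lam -> (forall t, lo S < t < hi S -> 0 < wronskian S lam t) -> eigen S (hinged S) lam ->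
  exists phi, ground_state S lam phi.
Proof.
  intros Hl HW [x [Hx [[X0 [X2 [Xb X2b]]] Xne]]]. pose proof (lo_hi S) as Hab.
  pose proof (bump_sol_spec S lam (hi S) ltac:(lra) HW ltac:(lra)) as Hv.
  destruct (bump_multiple S lam x ltac:(lra) Hx X0 X2 Xb Xne) as [Xn Hm].
  destruct (Hm (hi S) ltac:(lra)) as [_ E2]. rewrite X2b in E2.
  assert (V2 : j2 (bump_sol S lam (hi S)) (hi S) = 0).
  { destruct (Rmult_integral _ _ (eq_sym E2)); [contradiction | assumption]. }
  exists (bump_sol S lam (hi S)).
  assert (V1b : j1 (bump_sol S lam (hi S)) (hi S) < 0).
  { apply Rnot_le_lt; intros N. pose proof (bump_clamped_convex S lam _ ltac:(lra) Hv N). lra. }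
  destruct Hv as [Hv [V0 [V1 [Va2 [Vb [Vp _]]]]]].
  split; [exact Hv|]. split; [repeat split; assumption|]. split; [exact Vp|]. split; lra.
Qed.

(** Fit under [v] the largest multiple of the ground state. If [j2 v (hi S) <= 0], the gap is
    concave, because [lam > lam1] gives its source the right sign. Vanishing at both ends and
    touched, the gap is zero, and then so are [k] and [v]. *)
Lemma bump_convex_above (S : system) (lam1 lam : R) (phi v : jet) :
  0 < lam1 < lam -> ground_state S lam1 phi -> bump S lam (hi S) v -> 0 < j2 v (hi S).
Proof.
  intros Hl [Hphi [[F0 [F2 [Fb F2b]]] [Fp [F1 F1b]]]] [Hv [V0 [V1 [V2 [Vb [Vp [V1b _]]]]]]].
  pose proof (lo_hi S) as Hab. apply Rnot_le_lt; intros Hle.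
  pose proof (jopp_solves S v _ _ _ Hv) as Hov.
  assert (Fnn : forall t, lo S <= t <= hi S -> 0 <= j0 phi t)
    by (apply nonneg_closed; auto; lra).
  assert (Vnn : forall t, lo S <= t <= hi S -> 0 <= j0 v t)
    by (apply nonneg_closed; auto; lra).
  destruct (touching S (jopp v) phi _ _ (lo S) (hi S) Hab Hov Hphi Fnn Fp) as [k [Dneg [K2 K3]]].
  - right. apply dominated_right; simpl; lra.
  - right. apply dominated_left; simpl; lra.
  - assert (Hk : k <= 0).
    { apply K2. intros t Ht. specialize (Vnn t Ht). simpl; lra. }
    set (D := jlin 1 (jopp v) (- k) phi) in *.
    (* Written in terms of [D], the source keeps a multiple of [phi] whose sign is fixed by [k <= 0]
       and [lam1 < lam]. *)
    set (f := fun t => lam * j0 D t + (lam1 - lam) * (- k) * j0 phi t).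
    assert (HD : solves S D f (lo S) (hi S)).
    { apply solves_ext with (1 := solves_lin S 1 (- k) _ _ _ _ _ _ Hov Hphi).
      intros t Ht. unfold f, D; simpl. ring. }
    assert (Df : forall t, lo S <= t <= hi S -> f t <= 0).
    { intros t Ht. unfold f. specialize (Dneg t Ht). specialize (Fnn t Ht).
      assert (0 <= (lam - lam1) * (- k) * j0 phi t) by (apply Rmult_le_pos; [apply Rmult_le_pos; lra | lra]).
      assert (lam * j0 D t <= 0) by nra. lra. }
    pose proof (jopp_solves S D _ _ _ HD) as HoD.
    assert (N2 : forall s, lo S <= s <= hi S -> 0 <= j2 D s).
    { intros s Hs. assert (j2 (jopp D) s <= 0); [|simpl in *; lra].
      apply (j2_nonpos S (jopp D) _ _ _ HoD); [| | |exact Hs].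
      - intros t Ht; specialize (Df t Ht); lra.
      - unfold D; simpl. rewrite V2, F2; lra.
      - unfold D; simpl. rewrite F2b; lra. }
    assert (D0a : j0 D (lo S) = 0) by (unfold D; simpl; rewrite V0, F0; ring).
    assert (D0b : j0 D (hi S) = 0) by (unfold D; simpl; rewrite Vb, Fb; ring).
    assert (Mono := j1_incr S D _ _ _ HD N2).
    assert (Final : (forall t, lo S <= t <= hi S -> j0 D t = 0) -> False).
    { intros Z. destruct (jet_zero S D _ _ _ Hab HD Z ((lo S + hi S) / 2) ltac:(lra)) as [_ [_ [_ Ef]]].
      unfold f in Ef. rewrite Z in Ef by lra. specialize (Fp ((lo S + hi S) / 2) ltac:(lra)).
      assert (k = 0).
      { destruct (Rmult_integral ((lam1 - lam) * - k) (j0 phi ((lo S + hi S) / 2))) as [E|E]; [lra | | lra].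
        destruct (Rmult_integral _ _ E); lra. }
      specialize (Z ((lo S + hi S) / 2) ltac:(lra)). subst k. unfold D in Z; simpl in Z.
      specialize (Vp ((lo S + hi S) / 2) ltac:(lra)). lra. }
    assert (AtLo : 0 <= j1 D (lo S) -> False).
    { intros E. apply Final. intros t Ht. apply Rle_antisym; [now apply Dneg|].
      rewrite <- D0a. apply (j0_incr S D _ _ _ HD); [|lra..].
      intros u Hu. apply Rle_trans with (1 := E). apply Mono; lra. }
    assert (AtHi : j1 D (hi S) <= 0 -> False).
    { intros E. apply Final. intros t Ht. apply Rle_antisym; [now apply Dneg|].
      rewrite <- D0b. apply (j0_decr S D _ _ _ HD); [|lra..].
      intros u Hu. apply Rle_trans with (2 := E). apply Mono; lra. }
    destruct K3 as [[t [Ht Et]] | [Kl | Kr]].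
    + destruct (interior_zero_nonpos S D _ _ _ t HD Dneg Ht Et) as [E1 _].
      apply Final. intros s Hs. apply Rle_antisym; [now apply Dneg|].
      destruct (Rle_dec s t) as [L|L].
      * rewrite <- Et. apply (j0_decr S D f (lo S) t); [restrict HD | |lra..].
        intros u Hu. rewrite <- E1. apply Mono; lra.
      * rewrite <- Et. apply (j0_incr S D f t (hi S)); [restrict HD | |lra..].
        intros u Hu. rewrite <- E1. apply Mono; lra.
    + destruct (contact_left S (jopp v) phi _ _ _ k Hab HD Dneg Kl) as [_ E].
      destruct (E F0) as [E1 _]. apply AtLo. fold D in E1. lra.
    + destruct (contact_right S (jopp v) phi _ _ _ k Hab HD Dneg Kr) as [_ E].
      destruct (E Fb) as [E1 _]. apply AtHi. fold D in E1. lra.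
Qed.

(** * Beyond the first eigenvalue *)

(** [j2] is nonnegative at [c] and nonpositive at the contact, so [j3 <= 0] somewhere up to it and,
    being nonincreasing, ever after. From the contact on, [j2], [j1] and [D] can only decrease, and
    [j0 D d = 0] leaves [D = 0]. *)
Lemma contact_propagates (S : system) (D : jet) (f : R -> R) (c d t : R) :
  solves S D f c d -> (forall s, c <= s <= d -> f s <= 0) ->
  (forall s, c <= s <= d -> j0 D s <= 0) -> 0 <= j2 D c -> j0 D d = 0 ->
  c <= t < d -> j0 D t = 0 -> j1 D t = 0 -> forall s, t <= s <= d -> j0 D s = 0.
Proof.
  intros HD Hf Hneg Hc Hd Ht E0 E1.
  destruct (left_zero_nonpos S D f c d t HD Hneg Ht E0) as [_ N].
  destruct (N E1) as [E2 N3].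
  pose proof (jopp_solves S D f c d HD) as Ho.
  assert (M3 : forall u v, c <= u -> u <= v -> v <= d -> j3 D v <= j3 D u).
  { intros u v Hu Huv Hv. pose proof (j3_incr S (jopp D) _ c d Ho) as K.
    specialize (K ltac:(intros s Hs; specialize (Hf s Hs); lra) u v Hu Huv Hv). simpl in K. lra. }
  assert (H3 : forall s, t <= s <= d -> j3 D s <= 0).
  { destruct (Req_dec t c) as [->|Nt].
    - intros s Hs. apply Rle_trans with (j3 D c); [apply M3; lra|]. apply N3; lra.
    - destruct (j2_mean S D f c t) as [u [Hu E]]; [restrict HD | lra |].
      assert (j3 D u <= 0).
      { apply Rnot_lt_le; intros L. pose proof (cg_pos S u).
        assert (0 < cg S u * j3 D u * (t - c)) by (repeat apply Rmult_lt_0_compat; lra). lra. }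
      intros s Hs. apply Rle_trans with (j3 D u); [apply M3; lra | assumption]. }
  assert (Hsub : solves S D f t d) by (restrict HD).
  assert (H2 : forall s, t <= s <= d -> j2 D s <= 0).
  { intros s Hs. apply Rle_trans with (2 := E2). apply (j2_decr S D f t d Hsub H3); lra. }
  assert (H1 : forall s, t <= s <= d -> j1 D s <= 0).
  { intros s Hs. rewrite <- E1. apply (j1_decr S D f t d Hsub H2); lra. }
  intros s Hs. apply Rle_antisym; [apply Hneg; lra|].
  rewrite <- Hd. apply (j0_decr S D f t d Hsub H1); lra.
Qed.

(** Touch [D] by the bump with zero at [c]. Whatever the contact, the difference has zero slope at
    [c]; the bump has negative slope there and [D] zero slope, so the multiplier is zero and
    [D <= 0]. *)
Lemma clamped_zero (S : system) (lam c : R) (v D : jet) (h : R -> R) :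
  0 <= lam -> lo S < c < hi S -> bump S lam c v ->
  solves S D (source lam D (fun t => - h t)) (lo S) c ->
  (forall t, lo S <= t <= c -> 0 <= h t) -> (forall t, lo S <= t <= c -> 0 <= j0 D t) ->
  j0 D (lo S) = 0 -> 0 <= j2 D (lo S) -> j0 D c = 0 -> j1 D c = 0 ->
  forall t, lo S <= t <= c -> j0 D t = 0.
Proof.
  intros Hl Hc [Hv [V0 [V1 [V2 [Vc [Vp [_ V1c]]]]]]] HD Hh Dnn D0 D2 Dc0 Dc1.
  specialize (V1c ltac:(lra)).
  assert (Hvs : hom S lam v (lo S) c) by (restrict Hv).
  assert (Vnn : forall t, lo S <= t <= c -> 0 <= j0 v t)
    by (apply nonneg_closed; auto; lra).
  destruct (touching S D v _ _ (lo S) c ltac:(lra) HD Hvs Vnn Vp) as [k [Eneg [_ K3]]].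
  - right. apply dominated_right; lra.
  - right. apply dominated_left; lra.
  - pose proof (solves_sub_multiple S lam k _ _ D v _ HD Hvs) as HE.
    set (E := jlin 1 D (- k) v) in *.
    assert (Ef : forall t, lo S <= t <= c -> source lam E (fun t => - h t) t <= 0).
    { intros t Ht; specialize (Eneg t Ht); specialize (Hh t Ht); unfold source; nra. }
    assert (E2 : 0 <= j2 E (lo S)) by (unfold E; simpl; rewrite V2; lra).
    assert (Ec : j0 E c = 0) by (unfold E; simpl; rewrite Dc0, Vc; ring).
    assert (Propag : forall t, lo S <= t < c -> j0 E t = 0 -> j1 E t = 0 -> j1 E c = 0).
    { intros t Ht F0 F1.
      pose proof (contact_propagates S E _ (lo S) c t HE Ef Eneg E2 Ec Ht F0 F1) as Z.
      apply (jet_zero S E (source lam E (fun t => - h t)) t c); [lra | | exact Z | lra].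
      restrict HE. }
    assert (E1c : j1 E c = 0).
    { destruct K3 as [[t [Ht Et]] | [Kl | Kr]].
      - destruct (interior_zero_nonpos S E _ _ _ t HE Eneg Ht Et) as [F1 _].
        apply (Propag t); auto; lra.
      - destruct (contact_left S D v _ (lo S) c k ltac:(lra) HE Eneg Kl) as [F0 F].
        destruct (F V0) as [F1 _]. apply (Propag (lo S)); auto; lra.
      - destruct (contact_right S D v _ (lo S) c k ltac:(lra) HE Eneg Kr) as [F0 F].
        now destruct (F Vc). }
    assert (k = 0).
    { unfold E in E1c; simpl in E1c. rewrite Dc1 in E1c.
      destruct (Rmult_integral k (j1 v c)); lra. }
    intros t Ht. apply Rle_antisym; [|now apply Dnn].
    specialize (Eneg t Ht). unfold E in Eneg; simpl in Eneg. subst k. lra.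
Qed.

(** If [j1 x (hi S) >= 0], the multiple [k] of [v] fitted over [x] turns out to be zero: every
    contact makes the jet of the difference at [hi] degenerate, while [j2 v (hi S) > 0]. Then [x] is
    nonpositive and convex with zero value and slope at [hi], and so vanishes. *)
Lemma slope_neg_hi_above (S : system) (lam : R) (v x : jet) (h : R -> R) :
  0 <= lam -> bump S lam (hi S) v -> 0 < j2 v (hi S) ->
  solves S x (source lam x (fun t => - h t)) (lo S) (hi S) -> hinged S x ->
  (forall t, lo S <= t <= hi S -> 0 <= h t) ->
  (exists t, lo S <= t <= hi S /\ h t <> 0) -> j1 x (hi S) < 0.
Proof.
  intros Hl [Hv [V0 [V1 [V2 [Vb [Vp [V1b _]]]]]]] V2b Hx [X0 [X2 [Xb X2b]]] Hh [th [Hth Hne]].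
  pose proof (lo_hi S) as Hab. apply Rnot_le_lt; intros Hle.
  assert (Vnn : forall t, lo S <= t <= hi S -> 0 <= j0 v t)
    by (apply nonneg_closed; auto; lra).
  destruct (touching S x v _ _ (lo S) (hi S) Hab Hx Hv Vnn Vp) as [k [Dneg [_ K3]]].
  - right. apply dominated_right; lra.
  - right. destruct V1b as [L|E].
    + now apply dominated_left.
    (* With [v] flat at [hi], domination comes from [j2 v (hi S) > 0], and any positive multiple
       will do. *)
    + exists 1. right; simpl. split; [rewrite Xb, Vb; ring|]. rewrite E, X2b.
      destruct Hle as [L|L]; [left; lra | right; split; [lra | left; lra]].
  - pose proof (solves_sub_multiple S lam k _ _ x v _ Hx Hv) as HD.
    set (D := jlin 1 x (- k) v) in *.
    assert (Df : forall t, lo S <= t <= hi S -> source lam D (fun t => - h t) t <= 0).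
    { intros t Ht; specialize (Dneg t Ht); specialize (Hh t Ht); unfold source; nra. }
    assert (D2 : 0 <= j2 D (lo S)) by (unfold D; simpl; rewrite X2, V2; lra).
    assert (Db : j0 D (hi S) = 0) by (unfold D; simpl; rewrite Xb, Vb; ring).
    assert (Hk0 : forall t, lo S <= t < hi S -> j0 D t = 0 -> j1 D t = 0 -> k = 0 /\ j1 D (hi S) = 0).
    { intros t Ht F0 F1.
      pose proof (contact_propagates S D _ (lo S) (hi S) t HD Df Dneg D2 Db Ht F0 F1) as Z.
      destruct (jet_zero S D (source lam D (fun t => - h t)) t (hi S)) with (t := hi S)
        as [Z1 [Z2 _]]; [lra | restrict HD | exact Z | lra |].
      split; [|exact Z1].
      unfold D in Z2; simpl in Z2. rewrite X2b in Z2.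
      destruct (Rmult_integral k (j2 v (hi S))); lra. }
    assert (Hk : k = 0 /\ j1 D (hi S) = 0).
    { destruct K3 as [[t [Ht Et]] | [Kl | Kr]].
      - destruct (interior_zero_nonpos S D _ _ _ t HD Dneg Ht Et) as [F1 _].
        apply (Hk0 t); auto; lra.
      - destruct (contact_left S x v _ _ _ k Hab HD Dneg Kl) as [F0 F].
        destruct (F V0) as [F1 _]. apply (Hk0 (lo S)); auto; lra.
      - destruct (contact_right S x v _ _ _ k Hab HD Dneg Kr) as [F0 F].
        destruct (F Vb) as [F1 F2]. fold D in F1, F2. split; [|exact F1].
        unfold D in F1, F2; simpl in F1, F2. rewrite X2b in F2.
        assert (Kp : 0 <= k) by (apply Rnot_lt_le; intros L; nra).
        destruct V1b as [L|E]; [nra|].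
        apply Rle_antisym; [|exact Kp].
        (* Value and slope at [hi] do not depend on the multiplier here, so the failure of smaller
           multiples shows in the third entry. *)
        assert (k * j2 v (hi S) <= 0).
        { apply small_multiple with (- j2 v (hi S)). intros e He L. apply (Kr e He).
          right; simpl. rewrite Xb, Vb, X2b, E in *. split; [ring|]. right; split; [lra | left; lra]. }
        apply Rnot_lt_le; intros L. nra. }
    destruct Hk as [-> D1].
    assert (Ex : forall t, j0 D t = j0 x t) by (intros; unfold D; simpl; ring).
    pose proof (jopp_solves S D _ _ _ HD) as Ho.
    assert (N2 : forall s, lo S <= s <= hi S -> 0 <= j2 D s).
    { intros s Hs. assert (K : j2 (jopp D) s <= 0).
      - apply (j2_nonpos S (jopp D) _ _ _ Ho); [| | |exact Hs].
        + intros t Ht; specialize (Df t Ht); lra.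
        + unfold D; simpl; rewrite X2, V2; lra.
        + unfold D; simpl; rewrite X2b; lra.
      - change (-1 * j2 D s + 0 * j2 D s <= 0) in K. lra. }
    assert (N1 : forall s, lo S <= s <= hi S -> j1 D s <= 0).
    { intros s Hs. rewrite <- D1. apply (j1_incr S D _ _ _ HD N2); lra. }
    assert (N0 : forall s, lo S <= s <= hi S -> j0 D s = 0).
    { intros s Hs. apply Rle_antisym; [now apply Dneg|]. rewrite <- Db.
      apply (j0_decr S D _ _ _ HD N1); lra. }
    apply Hne. destruct (jet_zero S D _ _ _ Hab HD N0 th Hth) as [_ [_ [_ E]]].
    unfold source in E. rewrite (N0 th Hth) in E. lra.
Qed.

(** Once the slopes are known, a nonpositive interior value of [x] makes the least [k] with
    [x + k v >= 0] nonnegative. The slopes rule out contact at the ends; an interior contact is a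
    double zero, which [clamped_zero] spreads to the left and, by reflection, to the right. *)
Lemma inverse_negative_at (S : system) (lam : R) :
  0 < lam ->
  (forall t, lo S < t < hi S -> 0 < wronskian S lam t) ->
  (forall t, lo S < t < hi S -> 0 < wronskian (sref S) lam t) ->
  0 < j2 (bump_sol S lam (hi S)) (hi S) ->
  0 < j2 (bump_sol (sref S) lam (hi S)) (hi S) ->
  forall x h, solves S x (source lam x (fun t => - h t)) (lo S) (hi S) -> hinged S x ->
  (forall t, lo S <= t <= hi S -> 0 <= h t) ->
  (exists t, lo S <= t <= hi S /\ h t <> 0) -> strongly_pos S x.
Proof.
  intros Hl HW HW' V2b V2b' x h Hx Xh Hh Hne.
  pose proof (lo_hi S) as Hab.
  pose proof (bump_sol_spec S lam (hi S) ltac:(lra) HW ltac:(lra)) as Hv.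
  pose proof (bump_sol_spec (sref S) lam (hi S) ltac:(lra) HW' ltac:(simpl; lra)) as Hv'.
  assert (Sb : j1 x (hi S) < 0).
  { apply (slope_neg_hi_above S lam _ x h ltac:(lra) Hv V2b Hx Xh Hh Hne). }
  assert (Hxr : solves (sref S) (jref S x)
    (source lam (jref S x) (fun t => - h (lo S + hi S - t))) (lo S) (hi S))
    by exact (solves_reflected S x _ Hx).
  assert (Sa : 0 < j1 x (lo S)).
  { destruct Hne as [th [Hth Hne]].
    assert (K : j1 (jref S x) (hi S) < 0).
    { apply (slope_neg_hi_above (sref S) lam _ (jref S x)
        (fun t => h (lo S + hi S - t)) ltac:(lra) Hv' V2b' Hxr).
      - now apply hinged_ref.
      - simpl; intros t Ht; apply Hh; lra.
      - exists (lo S + hi S - th); simpl; split; [lra|].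
        now replace (lo S + hi S - (lo S + hi S - th)) with th by ring. }
    simpl in K. rewrite reflect_hi in K. lra. }
  split; [|split; assumption].
  set (v := bump_sol S lam (hi S)) in *. clearbody v.
  destruct Hv as [Hv [V0 [V1 [V2 [Vb [Vp [V1b _]]]]]]]. destruct Xh as [X0 [X2 [Xb X2b]]].
  intros t0 Ht0. apply Rnot_le_lt; intros Hle.
  assert (Vnn : forall t, lo S <= t <= hi S -> 0 <= j0 v t)
    by (apply nonneg_closed; auto; lra).
  pose proof (jopp_solves S x _ _ _ Hx) as Hox.
  destruct (touching S (jopp x) v _ _ (lo S) (hi S) Hab Hox Hv Vnn Vp) as [k [Eneg [_ K3]]].
  - right. exists 0. right; simpl. split; [rewrite X0, V0; ring|]. left; lra.
  - right. exists 0. right; simpl. split; [rewrite Xb, Vb; ring|]. left; lra.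
  - assert (Kp : 0 <= k).
    { specialize (Eneg t0 ltac:(lra)). specialize (Vp t0 Ht0). simpl in Eneg.
      apply Rnot_lt_le; intros L. nra. }
    set (D := jlin 1 x (- - k) v).
    assert (HD : solves S D (source lam D (fun t => - h t)) (lo S) (hi S)).
    { unfold D; apply solves_sub_multiple; assumption. }
    assert (Dnn : forall t, lo S <= t <= hi S -> 0 <= j0 D t).
    { intros t Ht; specialize (Eneg t Ht); unfold D; simpl in *; lra. }
    assert (HE : solves S (jlin 1 (jopp x) (- k) v)
       (fun t => 1 * - source lam x (fun t => - h t) t + - k * (lam * j0 v t)) (lo S) (hi S)).
    { exact (solves_lin S 1 (- k) _ _ _ _ _ _ Hox Hv). }
    destruct K3 as [[c [Hc Ec]] | [Kl | Kr]].
    + assert (D0 : j0 D c = 0) by (unfold D; simpl in *; lra).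
      destruct (interior_zero S D _ _ _ c HD Dnn Hc D0) as [D1 _].
      assert (Zl : forall t, lo S <= t <= c -> j0 D t = 0).
      { apply (clamped_zero S lam c (bump_sol S lam c) D h); auto.
        - lra.
        - apply bump_sol_spec; [lra | exact HW | lra].
        - restrict HD.
        - intros; apply Hh; lra.
        - intros; apply Dnn; lra.
        - unfold D; simpl; rewrite X0, V0; ring.
        - unfold D; simpl; rewrite X2, V2; lra. }
      assert (Zr : forall t, c <= t <= hi S -> j0 D t = 0).
      { set (c' := lo S + hi S - c).
        assert (Ec' : lo S + hi S - c' = c) by (unfold c'; ring).
        intros t Ht. replace t with (lo S + hi S - (lo S + hi S - t)) by ring.
        change (j0 (jref S D) (lo S + hi S - t) = 0).
        apply (clamped_zero (sref S) lam c' (bump_sol (sref S) lam c') (jref S D)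
          (fun t => h (lo S + hi S - t))).
        - lra.
        - simpl; unfold c'; lra.
        - apply bump_sol_spec; [lra | exact HW' | simpl; unfold c'; lra].
        - pose proof (solves_ref S D (source lam D (fun t => - h t)) c (hi S)) as K.
          rewrite reflect_hi in K. apply K.
          restrict HD.
        - simpl; intros s Hs; apply Hh; unfold c' in *; lra.
        - intros s Hs. change (0 <= j0 D (lo S + hi S - s)). simpl in Hs. apply Dnn; unfold c' in *; lra.
        - change (j0 D (lo S + hi S - lo S) = 0). rewrite reflect_lo.
          unfold D; simpl; rewrite Xb, Vb; ring.
        (* The third entry of [D] at [hi] is [k * j2 v (hi S)], whose sign comes from the convexity
           of the bump at [hi]. *)
        - change (0 <= j2 D (lo S + hi S - lo S)). rewrite reflect_lo.
          unfold D; simpl; rewrite X2b. nra.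
        - change (j0 D (lo S + hi S - c') = 0). now rewrite Ec'.
        - change (- j1 D (lo S + hi S - c') = 0). rewrite Ec', D1. ring.
        - simpl; unfold c'; lra. }
      assert (Z : forall t, lo S <= t <= hi S -> j0 D t = 0).
      { intros t Ht. destruct (Rle_dec t c); [apply Zl | apply Zr]; lra. }
      destruct Hne as [th [Hth Hne]]. apply Hne.
      destruct (jet_zero S D _ _ _ Hab HD Z th Hth) as [_ [_ [_ E]]].
      unfold source in E. rewrite (Z th Hth) in E. lra.
    + destruct (contact_left S (jopp x) v _ _ _ k Hab HE Eneg Kl) as [_ F].
      destruct (F V0) as [F1 _]. simpl in F1. rewrite V1 in F1. lra.
    + destruct (contact_right S (jopp x) v _ _ _ k Hab HE Eneg Kr) as [_ F].
      destruct (F Vb) as [F1 _]. simpl in F1. nra.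
Qed.

(* Passing from a constant to a variable coefficient: [weight] is the distance
   to the constant, and [kappa] its value at the ground state, where positivity
   breaks down. *)
Lemma comparison (S : system) (mu sg kappa : R) (phi : jet) :
  (forall x h, solves S x (fun t => mu * j0 x t + sg * h t) (lo S) (hi S) -> hinged S x ->
     (forall t, lo S <= t <= hi S -> 0 <= h t) ->
     (exists t, lo S <= t <= hi S /\ h t <> 0) -> strongly_pos S x) ->
  solves S phi (fun t => mu * j0 phi t + sg * (kappa * j0 phi t)) (lo S) (hi S) ->
  hinged S phi -> strongly_pos S phi ->
  forall x h weight,
    solves S x (fun t => mu * j0 x t + sg * (weight t * j0 x t + h t)) (lo S) (hi S) ->
    hinged S x ->
    (forall t, lo S <= t <= hi S -> 0 <= weight t < kappa) ->
    (forall t, lo S <= t <= hi S -> 0 <= h t) ->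
    (exists t, lo S <= t <= hi S /\ h t <> 0) -> strongly_pos S x.
Proof.
  intros HP Hphi [F0 [F2 [Fb F2b]]] [Fp [F1 F1b]] x h weight Hx Xh Hw Hh Hne.
  pose proof Xh as [X0 [X2 [Xb X2b]]]. pose proof (lo_hi S) as Hab.
  assert (Fnn : forall t, lo S <= t <= hi S -> 0 <= j0 phi t)
    by (apply nonneg_closed; auto; lra).
  assert (Xnn : forall t, lo S <= t <= hi S -> 0 <= j0 x t).
  { pose proof (jopp_solves S x _ _ _ Hx) as Hox.
    destruct (touching S (jopp x) phi _ _ (lo S) (hi S) Hab Hox Hphi Fnn Fp) as [k [Eneg [_ K3]]].
    - right. apply dominated_right; simpl; lra.
    - right. apply dominated_left; simpl; lra.
    - destruct (Rle_dec k 0) as [Hk|Hk].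
      { intros t Ht. specialize (Eneg t Ht). specialize (Fnn t Ht). simpl in Eneg. nra. }
      exfalso. apply Rnot_le_lt in Hk.
      assert (HE := solves_lin S 1 (- k) _ _ _ _ _ _ Hox Hphi).
      (* [D = x + k phi] is nonnegative with a contact, yet its source is nonnegative and not
         identically zero because [weight < kappa]; strong positivity of [D] contradicts the
         contact. *)
      set (D := jlin 1 x k phi).
      assert (SD : strongly_pos S D).
      { apply (HP D (fun t => weight t * j0 D t + h t + k * (kappa - weight t) * j0 phi t)).
        - apply solves_ext with (1 := solves_lin S 1 k _ _ _ _ _ _ Hx Hphi).
          intros t Ht; unfold D; simpl; ring.
        - unfold hinged, D; simpl. rewrite X0, X2, Xb, X2b, F0, F2, Fb, F2b. repeat split; ring.
        - intros t Ht. specialize (Hw t Ht). specialize (Hh t Ht). specialize (Fnn t Ht).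
          specialize (Eneg t Ht).
          assert (0 <= j0 D t) by (unfold D; simpl in *; lra).
          assert (0 <= weight t * j0 D t) by (apply Rmult_le_pos; lra).
          assert (0 <= k * (kappa - weight t) * j0 phi t)
            by (apply Rmult_le_pos; [apply Rmult_le_pos; lra | lra]). lra.
        - exists ((lo S + hi S) / 2). split; [lra|].
          set (t := (lo S + hi S) / 2). assert (Ht : lo S < t < hi S) by (unfold t; lra).
          specialize (Hw t ltac:(lra)). specialize (Hh t ltac:(lra)). specialize (Fp t Ht).
          specialize (Eneg t ltac:(lra)).
          assert (0 <= j0 D t) by (unfold D; simpl in *; lra).
          assert (0 <= weight t * j0 D t) by (apply Rmult_le_pos; lra).
          assert (0 < k * (kappa - weight t) * j0 phi t)
            by (apply Rmult_lt_0_compat; [apply Rmult_lt_0_compat; lra | lra]). lra. }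
      destruct SD as [Dp [D1 D1b]].
      destruct K3 as [[c [Hc Ec]] | [Kl | Kr]].
      + specialize (Dp c Hc). unfold D in Dp; simpl in *; lra.
      + destruct (contact_left S (jopp x) phi _ _ _ k Hab HE Eneg Kl) as [_ F].
        destruct (F F0) as [E1 _]. unfold D in D1; simpl in *; lra.
      + destruct (contact_right S (jopp x) phi _ _ _ k Hab HE Eneg Kr) as [_ F].
        destruct (F Fb) as [E1 _]. unfold D in D1b; simpl in *; lra. }
  apply (HP x (fun t => weight t * j0 x t + h t) Hx Xh).
  - intros t Ht. specialize (Hw t Ht). specialize (Hh t Ht). specialize (Xnn t Ht).
    assert (0 <= weight t * j0 x t) by (apply Rmult_le_pos; lra). lra.
  - destruct Hne as [t [Ht Hne]]. exists t. split; [exact Ht|].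
    specialize (Hw t Ht). specialize (Hh t Ht). specialize (Xnn t Ht).
    assert (0 <= weight t * j0 x t) by (apply Rmult_le_pos; lra). lra.
Qed.

(** * Reduction of the differential operator to the system *)

Lemma continue_in_pt (D : R -> Prop) (f : R -> R) (t : R) :
  continuity_pt f t -> continue_in f D t.
Proof.
  intros H e He. destruct (H e He) as [n [Hn K]]. exists n; split; [exact Hn|].
  intros s [[_ Hs] Hst]. apply K. split; [split; [exact I | exact Hs] | exact Hst].
Qed.

Lemma continue_in_ext (D : R -> Prop) (f g : R -> R) (t : R) :
  (forall s, D s -> f s = g s) -> D t -> continue_in f D t -> continue_in g D t.
Proof.
  intros E Ht H e He. destruct (H e He) as [n [Hn K]]. exists n; split; [exact Hn|].
  intros s Hs. specialize (K s Hs). destruct Hs as [[Hs _] _]. now rewrite <- !E by assumption.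
Qed.

Lemma D_in_ext (D : R -> Prop) (f g : R -> R) (l t : R) :
  (forall s, D s -> f s = g s) -> D t -> D_in f (fun _ => l) D t -> D_in g (fun _ => l) D t.
Proof.
  intros E Ht H e He. destruct (H e He) as [n [Hn K]]. exists n; split; [exact Hn|].
  intros s Hs. specialize (K s Hs). destruct Hs as [[Hs _] _]. now rewrite <- !E by assumption.
Qed.

Lemma is_derive_D_in (D : R -> Prop) (f : R -> R) (t l : R) :
  is_derive f t l -> D_in f (fun _ => l) D t.
Proof.
  intros H e He. apply is_derive_Reals in H. destruct (H e He) as [[n Hn] K].
  exists n; split; [exact Hn|]. intros s [[_ Hne] Hs]. simpl in *. unfold Rdist in *.
  specialize (K (s - t) ltac:(lra) Hs). now replace (t + (s - t)) with s in K by ring.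
Qed.

Lemma D_in_interior (a b t l : R) (f : R -> R) :
  a < t < b -> D_in f (fun _ => l) (seg a b) t -> is_derive (fun s => f (clamp a b s)) t l.
Proof.
  intros Ht H. apply is_derive_Reals. intros e He. destruct (H e He) as [n [Hn K]].
  assert (Hm : 0 < Rmin n (Rmin (t - a) (b - t))) by (repeat apply Rmin_glb_lt; lra).
  exists (mkposreal _ Hm). simpl. intros h Hh Hhm.
  pose proof (Rmin_l n (Rmin (t - a) (b - t))). pose proof (Rmin_r n (Rmin (t - a) (b - t))).
  pose proof (Rmin_l (t - a) (b - t)). pose proof (Rmin_r (t - a) (b - t)).
  pose proof Hhm as Hhm'. apply Rabs_def2 in Hhm'.
  rewrite !clamp_id by lra.
  specialize (K (t + h)). simpl in K. unfold Rdist in K.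
  replace (t + h - t) with h in K by ring.
  apply K. split; [split; [unfold seg; lra | lra] | lra].
Qed.

Lemma integral_of_derivative (a b : R) (f F' : R -> R) : a < b ->
  (forall t, continuity_pt F' t) ->
  (forall t, seg a b t -> D_in f (fun _ => F' t) (seg a b) t) ->
  forall t, seg a b t -> prim_from a (f a) F' t = f t.
Proof.
  intros Hab HF H t Ht.
  set (G := fun s => f (clamp a b s) - prim_from a (f a) F' s).
  destruct (MVT_gen G a t (fun _ => 0)) as [c [_ E]].
  - rewrite Rmin_left, Rmax_right by (unfold seg in Ht; lra). intros s Hs.
    replace 0 with (F' s - F' s) by ring.
    apply (is_derive_minus (fun s => f (clamp a b s)) (prim_from a (f a) F')).
    + apply D_in_interior; [unfold seg in Ht; lra|]. apply H. unfold seg in *; lra.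
    + now apply prim_from_derive.
  - intros s _. apply continuity_pt_minus; [|now apply prim_from_cont].
    apply clamp_cont; [lra|]. intros u Hu. eapply cont_deriv. now apply H.
  - unfold G in E. rewrite prim_from_start, !clamp_id in E; unfold seg in *; lra.
Qed.

Lemma deriv_spec (a b : R) (f : R -> R) (t : R) :
  derivable_on a b f -> seg a b t -> D_in f (fun _ => deriv a b f t) (seg a b) t.
Proof.
  intros H Ht. unfold deriv.
  apply (epsilon_spec (inhabits 0) (fun l => D_in f (fun _ => l) (seg a b) t)), H, Ht.
Qed.

(** Integrating the clamped top derivative [k] times gives functions differentiable on the whole
    line that agree with the derivatives within [[a, b]]; two-sided calculus then applies up to the
    end points. *)
Lemma Ck_extension (a b : R) (k : nat) (u : R -> R) : a < b -> Ck_on a b k u ->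
  exists us : nat -> R -> R,
    (forall i t, (i < k)%nat -> is_derive (us i) t (us (S i) t)) /\
    forall i t, (i <= k)%nat -> seg a b t -> us i t = deriv_n a b i u t.
Proof.
  intros Hab [Hd Hc].
  set (V := fix V m := match m with
    | O => fun t => deriv_n a b k u (clamp a b t)
    | S m' => prim_from a (deriv_n a b (k - S m') u a) (V m') end).
  assert (CV : forall m t, continuity_pt (V m) t).
  { induction m as [|m IH]; [apply clamp_cont; [lra | exact Hc] | now apply prim_from_cont]. }
  assert (EV : forall m t, (m <= k)%nat -> seg a b t -> V m t = deriv_n a b (k - m) u t).
  { induction m as [|m IH]; intros t Hm Ht; simpl V.
    - now rewrite Nat.sub_0_r, clamp_id.
    - apply (integral_of_derivative a b); [exact Hab | apply CV | | exact Ht].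
      intros s Hs. rewrite IH by (lia || exact Hs). replace (k - m)%nat with (S (k - S m)) by lia.
      now apply deriv_spec; [apply Hd; lia|]. }
  exists (fun i => V (k - i)%nat). split.
  - intros i t Hi. replace (k - i)%nat with (S (k - S i)) by lia. now apply prim_from_derive.
  - intros i t Hi Ht. rewrite EV by (lia || exact Ht). now replace (k - (k - i))%nat with i by lia.
Qed.

Lemma Ck_of_chain (a b : R) (n : nat) (us : nat -> R -> R) : a < b ->
  (forall i t, (i < n)%nat -> seg a b t -> is_derive (us i) t (us (S i) t)) ->
  (forall t, seg a b t -> continue_in (us n) (seg a b) t) ->
  Ck_on a b n (us O) /\
  forall i t, (i <= n)%nat -> seg a b t -> deriv_n a b i (us O) t = us i t.
Proof.
  intros Hab Hd Hc.
  assert (E : forall i, (i <= n)%nat -> forall t, seg a b t -> deriv_n a b i (us O) t = us i t).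
  { induction i as [|i IH]; intros Hi t Ht; [reflexivity|]. simpl.
    apply deriv_eq; [exact Hab | exact Ht |].
    apply D_in_ext with (us i); [intros s Hs; symmetry; apply IH; [lia | exact Hs] | exact Ht |].
    apply is_derive_D_in, Hd; [lia | exact Ht]. }
  split; [split|].
  - intros j Hj t Ht. exists (us (S j) t).
    apply D_in_ext with (us j); [intros s Hs; symmetry; apply E; [lia | exact Hs] | exact Ht |].
    now apply is_derive_D_in, Hd.
  - intros t Ht. apply continue_in_ext with (us n); [|exact Ht | now apply Hc].
    intros s Hs; symmetry; now apply E.
  - intros i t Hi Ht. now apply E.
Qed.

(** Disconjugacy keeps the solution [s] with a simple zero at [a] from vanishing again, so [s > 0]
    on [(a, b]]. Near [a] the solution [c] with [c a = 1] is positive, and a large multiple of [s]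
    takes over elsewhere. *)
Lemma positive_solution (a b : R) (p1 p2 : R -> R) : a < b ->
  (forall t, continuity_pt p1 t) -> (forall t, continuity_pt p2 t) ->
  disconjugate a b 2 (L2 a b p1 p2) ->
  exists y y' y'', (forall t, is_derive y t (y' t)) /\ (forall t, is_derive y' t (y'' t)) /\
    (forall t, a <= t <= b -> y'' t + p1 t * y' t + p2 t * y t = 0) /\
    (forall t, a <= t <= b -> 0 < y t).
Proof.
  intros Hab H1 H2 Hdis.
  destruct (second_order_ivp a b p1 p2 0 1 Hab H1 H2) as [s [s' [s'' [Ds [Ds' [Cs [Es [S0 S1]]]]]]]].
  destruct (second_order_ivp a b p1 p2 1 0 Hab H1 H2) as [c [c' [c'' [Dc [Dc' [_ [Ec [C0 _]]]]]]]].
  set (us := fun n => match n with O => s | S O => s' | _ => s'' end).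
  destruct (Ck_of_chain a b 2 us Hab) as [Ck E].
  { intros [|[|i]] t Hi Ht; [apply Ds | apply Ds' | lia]. }
  { intros t _. apply continue_in_pt, Cs. }
  assert (Nz : forall t, a < t <= b -> s t <> 0).
  { intros t Ht Et. apply (Hdis s Ck).
    - intros u Hu. unfold L2. change s with (us O).
      rewrite !E by (lia || exact Hu). simpl. now apply Es.
    - apply NNPP; intros N.
      assert (Z : forall u, a <= u <= b -> s u = 0).
      { intros u Hu. apply NNPP; intros Nu. apply N. exists u; split; assumption. }
      pose proof (derive_zero s a b a (s' a) Hab ltac:(lra) Z (Ds a)). lra.
    - exists ((a, 1%nat) :: (t, 1%nat) :: nil). split; [|split].
      + simpl. constructor; [|constructor; [simpl; tauto | constructor]].
        intros [E1|[]]. lra.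
      + reflexivity.
      + intros u m [Eu|[Eu|[]]]; inversion Eu; subst u m; (split; [unfold seg; lra|]);
          intros j Hj; (replace j with O by lia); simpl; assumption. }
  assert (Cont : forall t, continuity_pt s t) by (intros t; eapply is_derive_cont; apply Ds).
  assert (Contc : forall t, continuity_pt c t) by (intros t; eapply is_derive_cont; apply Dc).
  assert (Sp : forall t, a < t <= b -> 0 < s t).
  { destruct (pos_nbhd s' a) as [e [He Hpos]]; [eapply is_derive_cont; apply Ds' | lra|].
    intros t Ht. apply Rnot_le_lt; intros Hle.
    destruct (first_nonpositive s a t e) as [u [Hu [Eu _]]]; try assumption; try lra.
    - intros; apply Cont.
    - intros u Hu _. destruct (mean_value s s' a u) as [x [Hx E']]; [lra | intros; apply Ds|].
      assert (0 < s' x) by (apply Hpos, Rabs_def1; lra). nra.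
    - apply (Nz u); [lra | exact Eu]. }
  (* The multiplier of [s] is [/ e], so the small [e] delivered by compactness is a large
     multiple. *)
  destruct (uniform_on_segment (fun e t => a <= t <= b -> 0 < c t + / e * s t) a b) as [e [He HK]].
  - lra.
  - intros e e' t He' Hle H Ht. specialize (H Ht).
    assert (0 <= s t) by (destruct (Req_dec t a) as [->|]; [lra | left; apply Sp; lra]).
    assert (/ e <= / e') by (apply Rinv_le_contravar; lra). nra.
  - intros t Ht.
    assert (Hex : exists e, 0 < e /\ 0 < c t + / e * s t).
    { destruct (Req_dec t a) as [->|N].
      - exists 1. split; [lra|]. rewrite S0, C0; lra.
      - assert (St : 0 < s t) by (apply Sp; lra).
        set (K := Rabs (c t) / s t + 1).
        assert (HK : 0 < K).
        { unfold K. assert (0 <= Rabs (c t) / s t); [|lra].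
          apply Rmult_le_pos; [apply Rabs_pos | left; now apply Rinv_0_lt_compat]. }
        exists (/ K). split; [now apply Rinv_0_lt_compat|]. rewrite Rinv_inv.
        replace (K * s t) with (Rabs (c t) + s t) by (unfold K; field; lra).
        pose proof (Rle_abs (- c t)). rewrite Rabs_Ropp in *. lra. }
    destruct Hex as [e [He Hpos]].
    destruct (pos_nbhd (fun t => c t + / e * s t) t) as [n [Hn K]]; [|exact Hpos|].
    + apply continuity_pt_plus; [apply Contc|]. now apply cont_scal.
    + exists e, n. split; [exact He|]. split; [exact Hn|]. intros u _ Hu _. now apply K.
  - exists (fun t => 1 * c t + / e * s t), (fun t => 1 * c' t + / e * s' t),
      (fun t => 1 * c'' t + / e * s'' t).
    split; [intros t; now apply is_derive_lin|]. split; [intros t; now apply is_derive_lin|].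
    split.
    + intros t Ht. specialize (Es t Ht). specialize (Ec t Ht).
      replace (1 * c'' t + / e * s'' t + p1 t * (1 * c' t + / e * s' t) + p2 t * (1 * c t + / e * s t))
        with ((c'' t + p1 t * c' t + p2 t * c t) + / e * (s'' t + p1 t * s' t + p2 t * s t)) by ring.
      rewrite Es, Ec; ring.
    + intros t Ht. specialize (HK t Ht Ht). lra.
Qed.

(* Polya factorization: with [y > 0] a solution of the second order equation
   and [P = exp (int p1)], one has [L (y z) = (P y^2 z')' / (P y)]. *)
Lemma canonical_system (a b : R) (p1 p2 : R -> R) : a < b ->
  (forall t, seg a b t -> continue_in p1 (seg a b) t) ->
  (forall t, seg a b t -> continue_in p2 (seg a b) t) ->
  disconjugate a b 2 (L2 a b p1 p2) ->
  exists S, lo S = a /\ hi S = b /\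
    (forall u, Ck_on a b 4 u -> exists x,
       solves S x (T a b p1 p2 (fun _ => 0) u) a b /\
       forall t, seg a b t -> j0 x t = u t /\ j1 x t = deriv_n a b 1 u t /\
         cr S t * j2 x t = deriv_n a b 2 u t) /\
    (forall x f, solves S x f a b -> (forall t, seg a b t -> continue_in f (seg a b) t) ->
       Ck_on a b 4 (j0 x) /\
       forall t, seg a b t -> deriv_n a b 1 (j0 x) t = j1 x t /\
         deriv_n a b 2 (j0 x) t = cr S t * j2 x t /\ T a b p1 p2 (fun _ => 0) (j0 x) t = f t).
Proof.
  intros Hab H1 H2 Hdis.
  set (q1 := fun t => p1 (clamp a b t)). set (q2 := fun t => p2 (clamp a b t)).
  assert (C1 : forall t, continuity_pt q1 t) by (apply clamp_cont; [lra | exact H1]).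
  assert (C2 : forall t, continuity_pt q2 t) by (apply clamp_cont; [lra | exact H2]).
  assert (E1 : forall t, seg a b t -> q1 t = p1 t) by (intros t Ht; unfold q1; now rewrite clamp_id).
  assert (E2 : forall t, seg a b t -> q2 t = p2 t) by (intros t Ht; unfold q2; now rewrite clamp_id).
  destruct (positive_solution a b q1 q2 Hab C1 C2) as [y [y' [y'' [Dy [Dy' [Ey Yp]]]]]].
  { intros u Hu HL. apply (Hdis u Hu). intros t Ht. rewrite <- (HL t Ht). unfold L2.
    now rewrite E1, E2. }
  set (P := fun t => exp (prim_from a 0 q1 t)).
  assert (DP : forall t, is_derive P t (q1 t * P t)).
  { intros t. unfold P. apply (is_derive_comp exp (prim_from a 0 q1)).
    - apply is_derive_Reals, derivable_pt_lim_exp.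
    - now apply prim_from_derive. }
  assert (Pp : forall t, 0 < P t) by (intros; apply exp_pos).
  assert (Cy : forall t, continuity_pt y t) by (intros; eapply is_derive_cont; apply Dy).
  assert (CP : forall t, continuity_pt P t) by (intros; eapply is_derive_cont; apply DP).
  assert (Ycl : forall t, 0 < y (clamp a b t)) by (intros; apply Yp, clamp_in; lra).
  set (r := fun t => y (clamp a b t)). set (Q := fun t => P (clamp a b t)).
  assert (Cr : forall t, continuity_pt r t) by (apply continuity_pt_clamp; [lra | exact Cy]).
  assert (CQ : forall t, continuity_pt Q t) by (apply continuity_pt_clamp; [lra | exact CP]).
  assert (Hg : forall t, 0 < Q t * (r t * r t)).
  { intros t. apply Rmult_lt_0_compat; [apply Pp | apply Rmult_lt_0_compat; apply Ycl]. }
  assert (Cg : forall t, continuity_pt (fun t => / (Q t * (r t * r t))) t).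
  { intros t. apply (continuity_pt_inv (fun t => Q t * (r t * r t))).
    - now apply cont_mult; [|apply cont_mult].
    - specialize (Hg t); lra. }
  set (S := System a b r (fun t => / (Q t * (r t * r t))) (fun t => Q t * r t) Hab
    Cr Cg (cont_mult _ _ CQ Cr) Ycl (fun t => Rinv_0_lt_compat _ (Hg t))
    (fun t => Rmult_lt_0_compat _ _ (Pp _) (Ycl t))).
  assert (Er : forall t, seg a b t -> r t = y t) by (intros t Ht; unfold r; now rewrite clamp_id).
  assert (EQ : forall t, seg a b t -> Q t = P t) by (intros t Ht; unfold Q; now rewrite clamp_id).
  exists S. split; [reflexivity|]. split; [reflexivity|]. split.
  - intros u Hu.
    destruct (Ck_extension a b 4 u Hab Hu) as [us [DU EU]].
    set (u2 := us 2%nat). set (u3 := us 3%nat). set (u4 := us 4%nat).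
    assert (D2 : forall t, is_derive u2 t (u3 t)) by (intros; apply DU; lia).
    assert (D3 : forall t, is_derive u3 t (u4 t)) by (intros; apply DU; lia).
    (* With [z = u'' / y], the last entry is [P y^2 z'] with the quotient rule expanded. *)
    exists (Jet (us 0%nat) (us 1%nat) (fun t => u2 t / y t) (fun t => P t * (u3 t * y t - u2 t * y' t))).
    split.
    + intros t Ht. specialize (Yp t Ht). specialize (Ey t Ht). pose proof (Pp t).
      simpl.
      rewrite (Er t Ht), (EQ t Ht).
      split; [apply DU; lia|]. split.
      { replace (y t * (u2 t / y t)) with (u2 t) by (field; lra). apply DU; lia. }
      split.
      { replace (/ (P t * (y t * y t)) * (P t * (u3 t * y t - u2 t * y' t)))
          with ((u3 t * y t - u2 t * y' t) / y t ^ 2) by (field; lra).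
        apply is_derive_div; [apply D2 | apply Dy | lra]. }
      { unfold T. rewrite <- !EU by (lia || exact Ht). rewrite <- (E1 t Ht), <- (E2 t Ht).
        fold u2 u3 u4.
        replace (P t * y t * (u4 t + q1 t * u3 t + q2 t * u2 t + 0 * u t)) with
          (q1 t * P t * (u3 t * y t - u2 t * y' t) +
           P t * ((u4 t * y t + u3 t * y' t) - (u3 t * y' t + u2 t * y'' t))).
        (* The second order equation for [y] eliminates [y''], which makes the factorization
           exact. *)
        2:{ replace (y'' t) with (- (q1 t * y' t + q2 t * y t)) by lra. ring. }
        apply (is_derive_mult P (fun t => u3 t * y t - u2 t * y' t)); [apply DP | | exact Rmult_comm].
        apply (is_derive_minus (fun t => u3 t * y t) (fun t => u2 t * y' t)).
        - apply (is_derive_mult u3 y); [apply D3 | apply Dy | exact Rmult_comm].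
        - apply (is_derive_mult u2 y'); [apply D2 | apply Dy' | exact Rmult_comm]. }
    + intros t Ht. specialize (Yp t Ht).
      split; [apply EU; [lia | exact Ht]|]. split; [apply EU; [lia | exact Ht]|].
      change (r t * (u2 t / y t) = deriv_n a b 2 u t).
      rewrite (Er t Ht), <- EU by (lia || exact Ht). fold u2. field; lra.
  - intros x f Hx Hf.
    (* The inverse passage: [u'' = y z], and [u3] is its derivative with [z' = w / (P y^2)]
       inserted. *)
    set (u2 := fun t => y t * j2 x t).
    set (u3 := fun t => y' t * j2 x t + j3 x t / (P t * y t)).
    set (us := fun n => match n with O => j0 x | 1%nat => j1 x | 2%nat => u2 | 3%nat => u3
       | _ => fun t => f t - q1 t * u3 t - q2 t * u2 t end).
    assert (Du2 : forall t, seg a b t -> is_derive u2 t (u3 t)).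
    { intros t Ht. destruct (Hx t Ht) as [_ [_ [d2 _]]]. simpl in d2. rewrite (Er t Ht), (EQ t Ht) in d2.
      specialize (Yp t Ht). pose proof (Pp t).
      replace (u3 t) with (y' t * j2 x t + y t * (/ (P t * (y t * y t)) * j3 x t))
        by (unfold u3; field; lra).
      apply (is_derive_mult y (j2 x)); [apply Dy | exact d2 | exact Rmult_comm]. }
    assert (Du3 : forall t, seg a b t -> is_derive u3 t (f t - q1 t * u3 t - q2 t * u2 t)).
    { intros t Ht. destruct (Hx t Ht) as [_ [_ [d2 d3]]]. simpl in d2, d3.
      rewrite (Er t Ht), (EQ t Ht) in d2, d3.
      specialize (Yp t Ht). pose proof (Pp t). specialize (Ey t Ht).
      replace (f t - q1 t * u3 t - q2 t * u2 t) with
        ((y'' t * j2 x t + y' t * (/ (P t * (y t * y t)) * j3 x t)) +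
         (P t * y t * f t * (P t * y t) - j3 x t * (q1 t * P t * y t + P t * y' t)) / (P t * y t) ^ 2).
      2:{ replace (y'' t) with (- (q1 t * y' t + q2 t * y t)) by lra. unfold u3, u2. field; lra. }
      apply (is_derive_plus (fun t => y' t * j2 x t) (fun t => j3 x t / (P t * y t))).
      - apply (is_derive_mult y' (j2 x)); [apply Dy' | exact d2 | exact Rmult_comm].
      - apply (is_derive_div (j3 x) (fun t => P t * y t)); [exact d3 | |].
        + apply (is_derive_mult P y); [apply DP | apply Dy | exact Rmult_comm].
        + assert (0 < P t * y t) by now apply Rmult_lt_0_compat. lra. }
    destruct (Ck_of_chain a b 4 us Hab) as [Ck E].
    + intros [|[|[|[|i]]]] t Hi Ht; [| | | |lia]; simpl.
      * apply (Hx t Ht).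
      * destruct (Hx t Ht) as [_ [d1 _]]. simpl in d1. now rewrite (Er t Ht) in d1.
      * now apply Du2.
      * now apply Du3.
    + intros t Ht. simpl.
      assert (Cu2 : continuity_pt u2 t) by (eapply is_derive_cont; now apply Du2).
      assert (Cu3 : continuity_pt u3 t) by (eapply is_derive_cont; now apply Du3).
      unfold continue_in. apply (limit_minus (fun t => f t - q1 t * u3 t) (fun t => q2 t * u2 t)).
      * apply (limit_minus f (fun t => q1 t * u3 t)); [now apply Hf|].
        apply (continue_in_pt (seg a b) (fun t => q1 t * u3 t)). apply continuity_pt_mult; auto.
      * apply (continue_in_pt (seg a b) (fun t => q2 t * u2 t)). apply continuity_pt_mult; auto.
    + split; [exact Ck|]. intros t Ht.
      pose proof (E 1%nat t ltac:(lia) Ht) as F1. pose proof (E 2%nat t ltac:(lia) Ht) as F2.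
      pose proof (E 3%nat t ltac:(lia) Ht) as F3. pose proof (E 4%nat t ltac:(lia) Ht) as F4.
      split; [exact F1|]. split.
      { change (deriv_n a b 2 (us O) t = r t * j2 x t). rewrite F2, (Er t Ht). reflexivity. }
      unfold T. change (j0 x) with (us O). rewrite F2, F3, F4.
      change (f t - q1 t * u3 t - q2 t * u2 t + p1 t * u3 t + p2 t * u2 t + 0 * us O t = f t).
      rewrite <- (E1 t Ht), <- (E2 t Ht). ring.
Qed.

(** * Eigenvalues of [T[0]] as modes of the system, and the two assertions *)

Lemma ground_state_ref (S : system) (lam : R) (phi : jet) :
  ground_state S lam phi -> ground_state (sref S) lam (jref S phi).
Proof.
  intros [H [Hh [Hp [H1 H2]]]]. split; [exact (solves_reflected S phi _ H)|].
  split; [now apply hinged_ref|]. unfold strongly_pos; simpl.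
  rewrite reflect_lo, reflect_hi. split; [|lra]. intros t Ht; apply Hp; lra.
Qed.

Theorem corollary6p2
  (a b : R) (hab : a < b)
  (p1 p2 : R -> R)
  (hp1 : Ck_on a b 3 p1) (hp2 : Ck_on a b 2 p2)
  (hdis : disconjugate a b 2 (L2 a b p1 p2))
  (c : R -> R) (hc : Ck_on a b 0 c)
  (lambda1 lambda2 lambda3 : R)
  (hlambda1 :
     is_least_positive_eigenvalue a b (T a b p1 p2 (fun _ => 0)) (X a b) lambda1)
  (lambdaX1 lambdaX3 : R)
  (hlambdaX1 :
     is_biggest_negative_eigenvalue a b (T a b p1 p2 (fun _ => 0)) (X1 a b) lambdaX1)
  (hlambdaX3 :
     is_biggest_negative_eigenvalue a b (T a b p1 p2 (fun _ => 0)) (X3 a b) lambdaX3)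
  (hlambda2 : lambda2 = Rmax lambdaX1 lambdaX3)
  (lambdaU lambdaV : R)
  (hlambdaU :
     is_least_positive_eigenvalue a b (T a b p1 p2 (fun _ => 0)) (U a b) lambdaU)
  (hlambdaV :
     is_least_positive_eigenvalue a b (T a b p1 p2 (fun _ => 0)) (V a b) lambdaV)
  (hlambda3 : lambda3 = Rmin lambdaU lambdaV) :
  ((forall t, a <= t <= b -> - lambda1 < c t /\ c t <= - lambda2) ->
     strongly_inverse_positive a b (T a b p1 p2 c) (X a b)) /\
  ((forall t, a <= t <= b -> - lambda3 <= c t /\ c t < - lambda1) ->
     strongly_inverse_negative a b (T a b p1 p2 c) (X a b)).
Proof.
  assert (Cp1 : forall t, seg a b t -> continue_in p1 (seg a b) t).
  { intros t Ht. destruct hp1 as [H _]. destruct (H 0%nat ltac:(lia) t Ht) as [l Hl].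
    eapply cont_deriv; exact Hl. }
  assert (Cp2 : forall t, seg a b t -> continue_in p2 (seg a b) t).
  { intros t Ht. destruct hp2 as [H _]. destruct (H 0%nat ltac:(lia) t Ht) as [l Hl].
    eapply cont_deriv; exact Hl. }
  destruct (canonical_system a b p1 p2 hab Cp1 Cp2 hdis) as [S [Ea [Eb [Fwd Bwd]]]].
  set (T0 := T a b p1 p2 (fun _ => 0)) in *.
  subst a b. set (a := lo S) in *. set (b := hi S) in *.
  assert (Sa : seg a b a) by (unfold seg; lra).
  assert (Sb : seg a b b) by (unfold seg; lra).
  (* A nontrivial solution of the system yields an eigenvalue in any space whose boundary conditions
     it meets; extremality of the given eigenvalues is always applied through this. *)
  assert (Mode : forall lam x (E : (R -> R) -> Prop), hom S lam x a b ->
    (Ck_on a b 4 (j0 x) -> deriv_n a b 1 (j0 x) a = j1 x a -> deriv_n a b 1 (j0 x) b = j1 x b ->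
     deriv_n a b 2 (j0 x) a = cr S a * j2 x a -> deriv_n a b 2 (j0 x) b = cr S b * j2 x b -> E (j0 x)) ->
    (exists t, a <= t <= b /\ j0 x t <> 0) -> is_eigenvalue a b T0 E lam).
  { intros lam x E Hx HE Hne.
    destruct (Bwd x _ Hx) as [Ck D].
    - intros t Ht. apply continue_in_pt, (continuity_pt_scal (j0 x)).
      apply (solves_cont S x _ a b Hx t Ht).
    - exists (j0 x). split; [|split; [exact Hne|]].
      + apply HE; [exact Ck | apply (D a Sa) | apply (D b Sb) | apply (D a Sa) | apply (D b Sb)].
      + intros t Ht. apply (D t Ht). }
  assert (Z2 : forall x t, cr S t * j2 x t = 0 -> j2 x t = 0).
  { intros x t E. pose proof (cr_pos S t). destruct (Rmult_integral _ _ E); [lra | assumption]. }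
  assert (Xfwd : forall u, X a b u -> exists x, solves S x (T0 u) a b /\ hinged S x /\
    forall t, seg a b t -> j0 x t = u t /\ j1 x t = deriv_n a b 1 u t).
  { intros u [Ck [U0 [Ub [U2 U2b]]]]. destruct (Fwd u Ck) as [x [Hx Ex]].
    exists x. split; [exact Hx|]. split.
    - destruct (Ex a Sa) as [F0 [_ F2]]. destruct (Ex b Sb) as [G0 [_ G2]].
      unfold hinged; fold a b.
      repeat split; [now rewrite F0 | apply Z2; now rewrite F2 | now rewrite G0 | apply Z2; now rewrite G2].
    - intros t Ht. destruct (Ex t Ht) as [F0 [F1 _]]. now split. }
  destruct hlambda1 as [E1 [L1 Min1]]. destruct hlambdaV as [EV [LV MinV]].
  destruct hlambdaU as [_ [LU MinU]].
  destruct hlambdaX1 as [_ [LX1 MinX1]]. destruct hlambdaX3 as [_ [LX3 MinX3]].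
  assert (H1 : eigen S (hinged S) lambda1).
  { destruct E1 as [u [Xu [[t [Ht Hne]] Hu]]].
    destruct (Xfwd u Xu) as [x [Hx [Xh Ex]]]. exists x. split; [|split; [exact Xh|]].
    - apply solves_ext with (1 := Hx). intros s Hs. destruct (Ex s Hs) as [-> _]. now apply Hu.
    - exists t. split; [exact Ht|]. now destruct (Ex t Ht) as [-> _]. }
  assert (HV : eigen S (clamped_hinge S) lambdaV).
  { destruct EV as [u [[Ck [U0 [U2 [Ub U1b]]]] [[t [Ht Hne]] Hu]]].
    destruct (Fwd u Ck) as [x [Hx Ex]]. exists x. split; [|split].
    - apply solves_ext with (1 := Hx). intros s Hs. destruct (Ex s Hs) as [-> _]. now apply Hu.
    - destruct (Ex a Sa) as [F0 [_ F2]]. destruct (Ex b Sb) as [G0 [G1 _]].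
      unfold clamped_hinge; fold a b.
      repeat split; [now rewrite F0 | apply Z2; now rewrite F2 | now rewrite G0 | now rewrite G1].
    - exists t. split; [exact Ht|]. now destruct (Ex t Ht) as [-> _]. }
  assert (H1min : forall lam, 0 < lam -> eigen S (hinged S) lam -> lambda1 <= lam).
  { intros lam Hl [x [Hx [[X0 [X2 [Xb X2b]]] Hne]]]. apply Min1; [|exact Hl].
    apply (Mode lam x _ Hx); [|exact Hne]. intros Ck _ _ D2 D2b. split; [exact Ck|].
    split; [exact X0|]. split; [exact Xb|]. rewrite D2, D2b.
    fold a b in X2, X2b. rewrite X2, X2b. split; ring. }
  assert (HVno : forall lam, 0 < lam < lambdaV -> no_mode S (clamped_hinge S) lam).
  { intros lam Hl. apply not_eigen_no_mode. intros [x [Hx [[X0 [X2 [Xb X1b]]] Hne]]].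
    assert (lambdaV <= lam); [|lra]. apply MinV; [|lra].
    apply (Mode lam x _ Hx); [|exact Hne]. intros Ck _ D1b D2 _. split; [exact Ck|].
    split; [exact X0|]. split; [rewrite D2; fold a in X2; rewrite X2; ring|].
    split; [exact Xb|]. rewrite D1b. exact X1b. }
  (* Reflecting a mode back exchanges the ends and turns the conditions of [V] into those of [U]. *)
  assert (HUno : forall lam, 0 < lam < lambdaU -> no_mode (sref S) (clamped_hinge (sref S)) lam).
  { intros lam Hl. apply not_eigen_no_mode. intros [x [Hx [[X0 [X2 [Xb X1b]]] [t [Ht Hne]]]]].
    simpl in X0, X2, Xb, X1b, Ht.
    assert (lambdaU <= lam); [|lra]. apply MinU; [|lra].
    apply (Mode lam (jref S x) _ (solves_unref S x _ Hx)).
    - intros Ck D1 _ _ D2b. unfold a, b in *. simpl in D1, D2b.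
      rewrite reflect_lo in D1. rewrite reflect_hi in D2b.
      split; [exact Ck|]. split; [simpl; now rewrite reflect_lo|].
      split; [simpl; rewrite D1, X1b; ring|]. split; [simpl; now rewrite reflect_hi|].
      simpl; rewrite D2b, X2; ring.
    - exists (a + b - t). split; [unfold a, b in *; lra|]. simpl. fold a b.
      now replace (a + b - (a + b - t)) with t by ring. }
  (* Places [lambda1] in the range where the Wronskian is known to be positive. *)
  assert (L1V : lambda1 < lambdaV).
  { destruct (hinged_eigen_below S lambdaV LV HV HVno) as [lam [Hl Hlam]].
    assert (lambda1 <= lam) by (apply H1min; [lra | exact Hlam]). lra. }
  destruct (ground_state_exists S lambda1 L1) as [phi Hphi]; [|exact H1|].
  { apply wronskian_pos; [lra|]. intros lam Hl; apply HVno; lra. }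
  pose proof Hphi as [Hphi0 [Hphi1 Hphi2]].
  split.
  - intros Hc u Xu Hpos [th [Hth Hne]].
    set (M := - lambda2).
    assert (HM : 0 < M) by (unfold M; subst lambda2; unfold Rmax; destruct (Rle_dec lambdaX1 lambdaX3); lra).
    destruct (positive_cubic_exists S M HM) as [A HA].
    { intros m x Hm Hx [X0 [X1' [X2 X3']]] Xb. fold a b in Hx, X0, X1', X2, X3', Xb.
      assert (- m <= lambdaX3).
      { apply MinX3; [|lra]. apply (Mode (- m) x _ Hx).
        - intros Ck D1 _ D2 _. split; [exact Ck|]. split; [exact X0|].
          split; [now rewrite D1|]. split; [rewrite D2, X2; ring | exact Xb].
        - apply (jet_nonzero S x _ a b a hab Hx Sa). right; lra. }
      pose proof (Rmax_r lambdaX1 lambdaX3). unfold M in Hm. lra. }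
    destruct (positive_cubic_exists (sref S) M HM) as [A' HA'].
    { intros m x Hm Hx [X0 [X1' [X2 X3']]] Xb. simpl in X0, X1', X2, X3', Xb, Hx.
      pose proof (solves_unref S x _ Hx) as Hrx.
      assert (- m <= lambdaX1).
      { apply MinX1; [|lra]. apply (Mode (- m) (jref S x) _ Hrx).
        - intros Ck _ D1b _ D2b. unfold a, b in *. simpl in D1b, D2b. rewrite reflect_hi in D1b, D2b.
          split; [exact Ck|]. split; [simpl; now rewrite reflect_lo|].
          split; [simpl; now rewrite reflect_hi|]. split; [simpl; rewrite D1b, X1'; ring|].
          simpl; rewrite D2b, X2; ring.
        - apply (jet_nonzero S (jref S x) _ a b b hab Hrx Sb).
          right. unfold b; simpl. rewrite reflect_hi. lra. }
      pose proof (Rmax_l lambdaX1 lambdaX3). unfold M in Hm. lra. }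
    destruct (Xfwd u Xu) as [x [Hx [Xh Ex]]].
    assert (SP : strongly_pos S x).
    (* [T[c]u = f] reads [T[0]u = - M u + ((M - c) u + f)], and the bounds on [c] say exactly
       [0 <= M - c < lambda1 + M]. *)
    { apply (comparison S (- M) 1 (lambda1 + M) phi) with (h := T a b p1 p2 c u) (weight := fun t => M - c t).
      - intros y h Hy. apply (inverse_positive_at S M A A'); [lra | exact HA | exact HA' |].
        apply solves_ext with (1 := Hy). intros; unfold source; ring.
      - apply solves_ext with (1 := Hphi0). intros; ring.
      - exact Hphi1.
      - exact Hphi2.
      - apply solves_ext with (1 := Hx). intros t Ht. destruct (Ex t Ht) as [-> _].
        unfold T0, T. ring.
      - exact Xh.
      - intros t Ht. specialize (Hc t Ht). unfold M. lra.
      - exact Hpos.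
      - exists th. split; assumption. }
    destruct SP as [P0 [P1 P2]]. split; [|split].
    + intros t Ht. destruct (Ex t ltac:(unfold seg; lra)) as [<- _]. now apply P0.
    + destruct (Ex a Sa) as [_ <-]. exact P1.
    + destruct (Ex b Sb) as [_ <-]. exact P2.
  - intros Hc u Xu Hpos [th [Hth Hne]].
    (* The bounds on [c] at the single point [a] separate the two constants. *)
    assert (H13 : lambda1 < lambda3) by (destruct (Hc a Sa); lra).
    assert (H3U : lambda3 <= lambdaU) by (subst lambda3; apply Rmin_l).
    assert (H3V : lambda3 <= lambdaV) by (subst lambda3; apply Rmin_r).
    assert (HW : forall t, a < t < b -> 0 < wronskian S lambda3 t).
    { apply wronskian_pos; [lra|]. intros lam Hl; apply HVno; lra. }
    assert (HW' : forall t, a < t < b -> 0 < wronskian (sref S) lambda3 t).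
    { apply (wronskian_pos (sref S)); [lra|]. intros lam Hl; apply HUno; lra. }
    assert (B : 0 < j2 (bump_sol S lambda3 b) b).
    { apply (bump_convex_above S lambda1 lambda3 phi); [lra | exact Hphi |].
      apply bump_sol_spec; [lra | exact HW | fold a b; lra]. }
    assert (B' : 0 < j2 (bump_sol (sref S) lambda3 b) b).
    { apply (bump_convex_above (sref S) lambda1 lambda3 (jref S phi));
        [lra | now apply ground_state_ref |].
      apply bump_sol_spec; [lra | exact HW' | simpl; fold a b; lra]. }
    destruct (Xfwd u Xu) as [x [Hx [Xh Ex]]].
    assert (SP : strongly_pos S (jopp x)).
    (* For [- u] the equation reads [T[0](- u) = lambda3 (- u) - ((lambda3 + c) (- u) + T[c]u)]; the
       ground state corresponds to the constant weight [lambda3 - lambda1]. *)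
    { apply (comparison S lambda3 (-1) (lambda3 - lambda1) phi)
        with (h := T a b p1 p2 c u) (weight := fun t => lambda3 + c t).
      - intros y h Hy. apply (inverse_negative_at S lambda3 ltac:(lra) HW HW' B B').
        apply solves_ext with (1 := Hy). intros; unfold source; ring.
      - apply solves_ext with (1 := Hphi0). intros; ring.
      - exact Hphi1.
      - exact Hphi2.
      - apply solves_ext with (1 := jopp_solves S x _ _ _ Hx). intros t Ht. simpl.
        destruct (Ex t Ht) as [-> _]. unfold T0, T. ring.
      - destruct Xh as [X0 [X2 [Xb X2b]]]. unfold hinged; simpl. rewrite X0, X2, Xb, X2b. repeat split; ring.
      - intros t Ht. specialize (Hc t Ht). lra.
      - exact Hpos.
      - exists th. split; assumption. }
    destruct SP as [P0 [P1 P2]]. simpl in P0, P1, P2. fold a b in P0, P1, P2. split; [|split].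
    + intros t Ht. destruct (Ex t ltac:(unfold seg; lra)) as [<- _]. specialize (P0 t Ht). lra.
    + destruct (Ex a Sa) as [_ <-]. lra.
    + destruct (Ex b Sb) as [_ <-]. lra.
Qed.
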